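(* Let $k$ be an algebraically closed field of characteristic zero. Let $R$ be a filtered Artin-Schelter regular algebra of dimension $2$ over $k$ which is not PI, and let $H$ be a finite dimensional Hopf algebra over $k$ acting on $R$ inner-faithfully. If the $H$-action preserves the filtration of $R$, then $H$ is a group algebra. In particular, if $R$ is the first Weyl algebra $A_1(k)=k\langle u,v\rangle/(vu-uv-1)$ (with the standard filtration), then $H$ is a group algebra.
   Context: An algebra $R$ is filtered Artin-Schelter (AS) regular of dimension $d$ if $R$ is generated by a finite dimensional subspace $U$ with $1\notin U$ such that, for $F_n=(k1+U)^n$ (with $F_{-1}=0$, $F_0=k1$), the associated graded algebra $\mathrm{gr}_F R=\bigoplus_{n\ge 0}F_n/F_{n-1}$ is an AS regular algebra of global dimension $d$. A connected graded algebra $A$ is AS regular of dimension $d$ if it has global dimension $d<\infty$, finite Gelfand-Kirillov dimension, and $\mathrm{Ext}^i_A(k,A)=0$ for $i\ne d$, $\mathrm{Ext}^d_A(k,A)\cong k$ up to a degree shift (on both sides). For $d=2$ (generated in degree $1$) such an algebra is isomorphic to $k\langle u,v\rangle/(vu-uv-u^2)$ or to $k\langle u,v\rangle/(vu-quv)$ with $q\in k^\times$; here $\dim U=2$. A Hopf algebra $H$ acts on an algebra $R$ if $R$ is a left $H$-module algebra; the action preserves the filtration if $k1+U$ (hence every $F_n$) is an $H$-submodule. A left $H$-module $M$ is inner-faithful if $IM\neq 0$ for every nonzero Hopf ideal $I$ of $H$; $H$ acts on $R$ inner-faithfully if the $H$-module $R$ is inner-faithful. PI means satisfying a polynomial identity.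 The standard filtration of $A_1(k)$ is the one given by $U=ku\oplus kv$. *)

(* Defs.v *)
From HB Require Import structures.
From mathcomp Require Import all_boot all_order all_algebra all_fingroup all_field.
From mathcomp Require Import finmap.
From mathcomp.multinomials Require Import monalg.

Set Implicit Arguments.
Unset Strict Implicit.
Unset Printing Implicit Defensive.

Import GRing.Theory.
Local Open Scope ring_scope.

(* Subspaces of possibly infinite-dimensional spaces are predicates V -> Prop;
   {vspace V} is used only for finite-dimensional ambient spaces. *)
Section Subspaces.
Variables (k : fieldType) (V : lmodType k).
Implicit Types (U X : V -> Prop).

Definition subspace U : Prop :=
  U 0 /\ forall (a : k) x y, U x -> U y -> U (a *: x + y).

Definition lspan X (v : V) : Prop :=
  exists (n : nat) (c : 'I_n -> k) (x : 'I_n -> V),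
    (forall i, X (x i)) /\ v = \sum_(i < n) c i *: x i.

Definition lspan_seq (s : seq V) : V -> Prop := lspan (fun x => x \in s).

Definition fin_dim U : Prop := exists s : seq V, forall x, U x <-> lspan_seq s x.

Definition dim_le U (n : nat) : Prop :=
  exists s : seq V, (size s <= n)%N /\ forall x, U x -> lspan_seq s x.

(* V is the internal direct sum of the V_n. *)
Definition direct_sum (Vn : nat -> V -> Prop) : Prop :=
  (forall v, exists (n : nat) (f : nat -> V),
      (forall i, Vn i (f i)) /\ v = \sum_(i < n) f i) /\
  (forall (n : nat) (f : nat -> V), (forall i, Vn i (f i)) ->
      \sum_(i < n) f i = 0 -> forall i, (i < n)%N -> f i = 0).

End Subspaces.

Section FreeAlgebra.
Variables (k : fieldType) (I : choiceType).

(* k<x_i | i in I>, with k-basis the words in I *)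
Definition free_alg := {malg k[{fmonom I}]}.

Definition fvar (i : I) : free_alg := mkmalgU (fmu i) 1.

Definition free_eval (R : algType k) (x : I -> R) (f : free_alg) : R :=
  \sum_(w <- msupp f) mcoeff w f *: \prod_(i <- fmonom_val w) x i.

Definition ideal_gen (r : free_alg) : free_alg -> Prop :=
  lspan (fun z : free_alg => exists a b : free_alg, z = a * r * b).

(* R is k<x_i | i in I>/(r), the x i being the images of the variables. *)
Definition presented_by (R : algType k) (x : I -> R) (r : free_alg) : Prop :=
  (forall y : R, exists f : free_alg, free_eval x f = y) /\
  (forall f : free_alg, free_eval x f = 0 <-> ideal_gen r f).

End FreeAlgebra.

Definition PI (k : fieldType) (R : algType k) : Prop :=
  exists (n : nat) (f : free_alg k 'I_n),
    f <> 0 /\ forall x : 'I_n -> R, free_eval x f = 0.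

Definition is_weyl (k : fieldType) (R : algType k) (u v : R) : Prop :=
  let U := fvar k false in let V := fvar k true in
  presented_by (fun i : bool => if i then v else u) (V * U - U * V - 1).

(* Left modules over a ring B; right modules are left modules over B^c. *)
Section Homological.
Variable B : pzRingType.

Definition projective (P : lmodType B) : Prop :=
  forall (M N : lmodType B) (g : {linear M -> N}) (f : {linear P -> N}),
    (forall y, exists x, g x = y) ->
    exists h : {linear P -> M}, forall x, g (h x) = f x.

Record proj_resolution (M : lmodType B) := ProjResolution {
  res_mod :> nat -> lmodType B;
  res_diff : forall n, {linear res_mod n.+1 -> res_mod n};
  res_aug : {linear res_mod 0 -> M};
  res_proj : forall n, projective (res_mod n);
  res_aug_surj : forall y, exists x, res_aug x = y;
  res_exact0 : forall x, res_aug x = 0 <-> exists y, res_diff 0 y = x;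
  res_exact : forall n x,
    res_diff n x = 0 <-> exists y, res_diff n.+1 y = x
}.

Definition proj_dim_le (M : lmodType B) (d : nat) : Prop :=
  exists P : proj_resolution M, forall n, (d < n)%N -> forall x : P n, x = 0.

Definition gldim_le (d : nat) : Prop :=
  forall M : lmodType B, proj_dim_le M d.

Definition gldim_eq (d : nat) : Prop :=
  gldim_le d /\ forall n, (n < d)%N -> ~ gldim_le n.

(* Ext^i_B(M, B) = (cocycles) / (coboundaries) in Hom_B(P, B), with the right
   B-action (f . b)(x) = f(x) b. *)
Section Ext.
Variables (M : lmodType B) (P : proj_resolution M).

Definition cocycle i (f : {linear P i -> B^o}) : Prop :=
  forall x, f (res_diff P i x) = 0.

Definition coboundary i : {linear P i -> B^o} -> Prop :=
  match i return {linear P i -> B^o} -> Prop with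
  | 0 => fun f => forall x, f x = 0
  | j.+1 => fun f => exists g : {linear P j -> B^o},
                       forall x, f x = g (res_diff P j x)
  end.

Definition Ext_vanishes i : Prop :=
  forall f : {linear P i -> B^o}, cocycle f -> coboundary f.

(* Ext^i_B(M, B) is isomorphic, as a right B-module, to K with B acting
   through eps. The isomorphism is given as a surjection from the cocycles to K
   with kernel the coboundaries. *)
Definition Ext_iso_trivial (K : fieldType) (eps : {rmorphism B -> K}) i : Prop :=
  exists phi : {linear P i -> B^o} -> K,
  [/\ forall f g h : {linear P i -> B^o}, cocycle f -> cocycle g ->
        (forall x, h x = f x + g x) -> phi h = phi f + phi g,
      forall (f h : {linear P i -> B^o}) (b : B), cocycle f ->
        (forall x, h x = (f x : B) * b) -> phi h = phi f * eps b,
      forall c : K, exists f : {linear P i -> B^o}, cocycle f /\ phi f = c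
    & forall f : {linear P i -> B^o}, cocycle f ->
        (phi f = 0 <-> coboundary f)].

End Ext.
End Homological.

(* K as a left B-module through eps : B -> K *)
Definition trivial_mod (B : pzRingType) (K : fieldType)
  (eps : {rmorphism B -> K}) : Type := K.

Section TrivialModule.
Variables (B : pzRingType) (K : fieldType) (eps : {rmorphism B -> K}).

HB.instance Definition _ := GRing.Zmodule.copy (trivial_mod eps) K.

Let scale (b : B) (x : trivial_mod eps) : trivial_mod eps := eps b * (x : K).

Fact trivial_scaleA a b x : scale a (scale b x) = scale (a * b) x.
Proof. by rewrite /scale rmorphM mulrA. Qed.
Fact trivial_scale1 : left_id 1 scale.
Proof. by move=> x; rewrite /scale rmorph1 mul1r. Qed.
Fact trivial_scaleDr : right_distributive scale +%R.
Proof. by move=> a x y; exact: mulrDr. Qed.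
Fact trivial_scaleDl x : {morph scale^~ x : a b / a + b}.
Proof. by move=> a b; rewrite /scale rmorphD mulrDl. Qed.

HB.instance Definition _ := GRing.Zmodule_isLmodule.Build B (trivial_mod eps)
  trivial_scaleA trivial_scale1 trivial_scaleDr trivial_scaleDl.

(* eps as a character of the opposite ring *)
Definition conv_aug : B^c -> K := eps.

Fact conv_aug_zmod : zmod_morphism conv_aug.
Proof. by move=> x y; exact: (rmorphB eps). Qed.
Fact conv_aug_monoid : monoid_morphism conv_aug.
Proof.
by split=> [|x y]; [exact: (rmorph1 eps) | rewrite mulrC; exact: (rmorphM eps)].
Qed.

HB.instance Definition _ := GRing.isZmodMorphism.Build B^c K conv_aug conv_aug_zmod.
HB.instance Definition _ :=
  GRing.isMonoidMorphism.Build B^c K conv_aug conv_aug_monoid.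

(* Ext^i_B(K, B) = 0 for i <> d and Ext^d_B(K, B) = K. Projective resolutions
   exist and Ext does not depend on them, so the quantifier over P is harmless. *)
Definition gorenstein (d : nat) : Prop :=
  forall P : proj_resolution (trivial_mod eps),
    (forall i, i != d -> Ext_vanishes P i) /\ Ext_iso_trivial P eps d.

End TrivialModule.

Section Filtrations.
Variables (k : fieldType) (R : algType k).
Implicit Types (U X Y : R -> Prop).

Definition mul_span X Y : R -> Prop :=
  lspan (fun z => exists x y, [/\ X x, Y y & z = x * y]).

Definition one_plus U : R -> Prop := fun x => exists a u, U u /\ x = a%:A + u.

Fixpoint filt U (n : nat) : R -> Prop :=
  match n with
  | 0 => fun x => exists a : k, x = a%:A
  | m.+1 => mul_span (filt U m) (one_plus U)
  end.

(* F_(n-1), with F_(-1) = 0 *)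
Definition filt_pred U (n : nat) : R -> Prop :=
  match n with 0 => fun x => x = 0 | m.+1 => filt U m end.

(* GKdim R < oo: for the finite-dimensional subspaces V of R, the growth of
   dim (k1 + V)^n is polynomial of bounded degree. *)
Definition finite_GKdim : Prop :=
  exists d : nat, forall s : seq R, exists C : nat, forall n, (0 < n)%N ->
    dim_le (filt (lspan_seq s) n) (C * n ^ d).

End Filtrations.

Section Graded.
Variables (k : fieldType) (A : algType k) (grade : nat -> A -> Prop).

Definition connected_graded : Prop :=
  [/\ forall n, subspace (grade n),
      direct_sum grade,
      forall x, grade 0 x <-> exists a : k, x = a%:A,
      (1 : A) <> 0
    & forall m n x y, grade m x -> grade n y -> grade (m + n) (x * y)].

Definition augmentation (eps : {rmorphism A -> k}) : Prop :=
  (forall a : k, eps a%:A = a) /\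
  (forall n x, (0 < n)%N -> grade n x -> eps x = 0).

(* The degree shift in Ext^d_A(k, A) = k(l) is forgotten. *)
Definition AS_regular (d : nat) : Prop :=
  [/\ connected_graded,
      gldim_eq A d /\ gldim_eq A^c d,
      finite_GKdim A
    & exists eps : {rmorphism A -> k},
        [/\ augmentation eps, gorenstein eps d
          & gorenstein (conv_aug eps : {rmorphism A^c -> k}) d]].

End Graded.

Section FilteredRegular.
Variables (k : fieldType) (R : algType k) (U : R -> Prop).

(* A, with the graded pieces grade n, is the associated graded algebra of R:
   the symbol map sym n, which is only meaningful on F_n, induces an isomorphism
   from F_n/F_(n-1) to grade n. *)
Definition is_assoc_graded (A : algType k) (grade : nat -> A -> Prop)
    (sym : nat -> R -> A) : Prop :=
  [/\ direct_sum grade,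
      forall n a x y, filt U n x -> filt U n y ->
        sym n (a *: x + y) = a *: sym n x + sym n y,
      forall n a, grade n a <-> exists x, filt U n x /\ sym n x = a,
      forall n x, filt U n x -> (sym n x = 0 <-> filt_pred U n x)
    & sym 0%N 1 = 1 /\
      forall m n x y, filt U m x -> filt U n y ->
        sym (m + n)%N (x * y) = sym m x * sym n y].

Definition filtered_AS_regular (d : nat) : Prop :=
  [/\ subspace U /\ fin_dim U,
      ~ U 1,
      forall x, exists n, filt U n x
    & exists (A : algType k) (grade : nat -> A -> Prop) (sym : nat -> R -> A),
        is_assoc_graded grade sym /\ AS_regular grade d].

End FilteredRegular.

Section Tensor.
Variables (k : fieldType) (V W : vectType k).

(* The tensor product of V and W, the matrix entries being the coordinates with
   respect to the tensor products of the vectors of vbasis V and vbasis W. *)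
Definition tensor : vectType k := 'M[k]_(\dim {:V}, \dim {:W}).

Definition tens (v : V) (w : W) : tensor :=
  \matrix_(i, j) (coord (vbasis {:V}) i v * coord (vbasis {:W}) j w).

(* The linear map on the tensor product induced by a bilinear b: on
   t = \sum t1 \otimes t2 it is the Sweedler sum \sum b t1 t2. *)
Definition tlift (X : lmodType k) (b : V -> W -> X) (t : tensor) : X :=
  \sum_i \sum_j t i j *: b (vbasis {:V})`_i (vbasis {:W})`_j.

Definition tensv (I : {vspace V}) (J : {vspace W}) : {vspace tensor} :=
  <<[seq tens x y | x <- vbasis I, y <- vbasis J]>>%VS.

End Tensor.

Section Hopf.
Variables (k : fieldType) (H : falgType k).

Record hopf_structure := HopfStructure {
  comul : {linear H -> tensor H H};
  counit : {linear H -> k^o};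
  antipode : {linear H -> H};
  comulA : forall h,
    tlift (fun h1 h2 => tlift (fun h21 h22 => tens (tens h1 h21) h22) (comul h2))
      (comul h)
    = tlift (fun h1 h2 => tens (comul h1) h2) (comul h);
  counitl : forall h, tlift (fun h1 h2 => (counit h1 : k) *: h2) (comul h) = h;
  counitr : forall h, tlift (fun h1 h2 => (counit h2 : k) *: h1) (comul h) = h;
  comul1 : comul 1 = tens 1 1;
  comulM : forall g h, comul (g * h) =
    tlift (fun g1 g2 => tlift (fun h1 h2 => tens (g1 * h1) (g2 * h2)) (comul h))
      (comul g);
  counit1 : counit 1 = 1;
  counitM : forall g h, counit (g * h) = counit g * counit h;
  antipodel : forall h,
    tlift (fun h1 h2 => antipode h1 * h2) (comul h) = (counit h : k)%:A;
  antipoder : forall h,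
    tlift (fun h1 h2 => h1 * antipode h2) (comul h) = (counit h : k)%:A
}.

Variable S : hopf_structure.

Definition hopf_ideal (I : {vspace H}) : Prop :=
  [/\ forall x h, x \in I -> h * x \in I /\ x * h \in I,
      forall x, x \in I -> comul S x \in (tensv I {:H} + tensv {:H} I)%VS,
      forall x, x \in I -> counit S x = 0
    & forall x, x \in I -> antipode S x \in I].

(* S is the group Hopf algebra k[G], the e g being the basis of group elements. *)
Definition is_group_algebra : Prop :=
  exists (gT : finGroupType) (e : gT -> H),
  [/\ basis_of {:H} [seq e g | g : gT],
      e 1%g = 1 /\ (forall g h, e (g * h)%g = e g * e h),
      forall g, comul S (e g) = tens (e g) (e g)
    & forall g, counit S (e g) = 1 /\ antipode S (e g) = e g^-1%g].

Section Action.
Variables (R : algType k) (act : H -> R -> R).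

Definition module_algebra : Prop :=
  [/\ (forall h a x y, act h (a *: x + y) = a *: act h x + act h y) /\
      (forall x a g h, act (a *: g + h) x = a *: act g x + act h x),
      (forall x, act 1 x = x) /\
      (forall g h x, act (g * h) x = act g (act h x)),
      forall h, act h 1 = (counit S h : k)%:A
    & forall h x y,
        act h (x * y) = tlift (fun h1 h2 => act h1 x * act h2 y) (comul S h)].

Definition inner_faithful : Prop :=
  forall I : {vspace H}, hopf_ideal I -> I != 0%VS ->
    exists h x, h \in I /\ act h x <> 0.

Definition preserves_filtration (U : R -> Prop) : Prop :=
  forall h x, one_plus U x -> one_plus U (act h x).

End Action.
End Hopf.

(* Main.v *)
Require Import Defs.
From HB Require Import structures.
From mathcomp Require Import all_boot all_order all_algebra all_fingroup all_field.
From mathcomp Require Import cyclic ring zify.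
From mathcomp Require Import finmap.
From mathcomp.multinomials Require Import monalg.
From mathcomp Require boolp.

Set Implicit Arguments.
Unset Strict Implicit.
Unset Printing Implicit Defensive.

Import Order.TTheory GRing.Theory Num.Theory.
Local Open Scope ring_scope.

(* Let u, v generate R and write h u = a(h) u + b(h) v + e(h), h v = c(h) u + d(h) v + f(h).
   Inner-faithfulness says that the functionals a, ..., f generate the dual Hopf algebra K = H^*
   together with its antipode, so it suffices to show that a, ..., f commute: then K is commutative
   and H is cocommutative, hence a group algebra.
   The trivial module over A = gr R has the resolution 0 -> A(-2) -> A(-1)^2 -> A -> k, which forces
   a single nondegenerate quadratic relation in u and v. Up to a change of variables this relation is
   vu = quv + ga with q of infinite order, vu = uv + u^2 + (lower terms), vu = uv + u or vu = uv + 1,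
   except in the cases vu = quv + ga with q <> 1 a root of unity and vu = uv, where R is PI.
   Applying h to the relation gives quadratic identities among a, ..., f and a grouplike g of K, from
   which S^2 is computed on the generators. Since S has finite order (Radford), and so has
   conjugation by g, the unipotent or infinite order part of S^2 must vanish. *)

(** * Sweedler sums *)

(** That a commutative K makes H a group algebra is proved with traces: the trace of the regular
    representation of K is a sum of dim H characters, each character is evaluation at a group-like
    element of H, and these elements span H because the integral Λ is nondegenerate; here dim H must
    be nonzero in k. The case analysis runs on the operator p -> g^-1 S^2(p) g. The antipode of the
    coefficient matrix X is a quantum adjugate of X times g^-1, so conjugation by g is exactly what
    makes the square of the antipode explicit on the generators. Two further consequences of
    characteristic zero remove what finite order alone does not: a matrix of finite order whose
    trace is its size is the identity, which gives g = 1 for the Weyl algebra, and a skew primitive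
    element commuting with its group-like g is a multiple of g - 1. The quadratic relation is
    nondegenerate because the entries of the generating syzygy span A_1, which encodes that Ext^2 is
    one-dimensional with trivial action. Three or more generators would force exponential growth. In
    the PI cases R is finite over its centre and satisfies a standard identity. *)

Definition lin (k : fieldType) (V W : lmodType k) (f : V -> W) : Prop :=
  forall a x y, f (a *: x + y) = a *: f x + f y.

Section Lin.
Variable k : fieldType.
Implicit Types V W X : lmodType k.

Lemma lin_idf V : lin (fun x : V => x). Proof. by []. Qed.
Lemma lin_linear V W X (f : {linear W -> X}) (g : V -> W) :
  lin g -> lin (fun x => f (g x)).
Proof. by move=> hg a x y; rewrite hg linearP. Qed.
Lemma lin_hom (V W : vectType k) X (f : 'Hom(V, W)) (g : X -> V) :
  lin g -> lin (fun x => f (g x)).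
Proof. by move=> hg a x y; rewrite hg linearP. Qed.
Lemma lin_comp V W X (f : W -> X) (g : V -> W) : lin f -> lin g -> lin (fun x => f (g x)).
Proof. by move=> hf hg a x y; rewrite hg hf. Qed.
Lemma lin_mull V (A : algType k) (c : A) (f : V -> A) : lin f -> lin (fun x => c * f x).
Proof. by move=> hf a x y; rewrite hf mulrDr scalerAr. Qed.
Lemma lin_mulr V (A : algType k) (c : A) (f : V -> A) : lin f -> lin (fun x => f x * c).
Proof. by move=> hf a x y; rewrite hf mulrDl scalerAl. Qed.
Lemma lin_scl V W (c : k) (f : V -> W) : lin f -> lin (fun x => c *: f x).
Proof. by move=> hf a x y; rewrite hf scalerDr !scalerA mulrC. Qed.
Lemma lin_scr V W (w : W) (f : V -> k^o) : lin f -> lin (fun x => (f x : k) *: w).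
Proof. by move=> hf a x y; rewrite hf scalerDl scalerA. Qed.
Lemma lin_add V W (f g : V -> W) : lin f -> lin g -> lin (fun x => f x + g x).
Proof. by move=> hf hg a x y; rewrite hf hg scalerDr addrACA. Qed.
Lemma lin_opp V W (f : V -> W) : lin f -> lin (fun x => - f x).
Proof. by move=> hf a x y; rewrite hf opprD scalerN. Qed.
Lemma lin_sum V W (I : Type) (r : seq I) (P : pred I) (f : I -> V -> W) :
  (forall i, lin (f i)) -> lin (fun x => \sum_(i <- r | P i) f i x).
Proof.
move=> hf a x y; rewrite scaler_sumr -big_split; apply: eq_bigr => i _.
exact: hf.
Qed.
Lemma lin0 V W (f : V -> W) : lin f -> f 0 = 0.
Proof. by move=> hf; have := hf (-1) 0 0; rewrite scaler0 addr0 scaleN1r addNr. Qed.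
Lemma linD V W (f : V -> W) : lin f -> forall x y, f (x + y) = f x + f y.
Proof. by move=> hf x y; have := hf 1 x y; rewrite !scale1r. Qed.
Lemma linZ V W (f : V -> W) : lin f -> forall a x, f (a *: x) = a *: f x.
Proof. by move=> hf a x; have := hf a x 0; rewrite !addr0 (lin0 hf) addr0. Qed.
Lemma linS V W (f : V -> W) (hf : lin f) (I : Type) (r : seq I) (P : pred I) F :
  f (\sum_(i <- r | P i) F i) = \sum_(i <- r | P i) f (F i).
Proof.
by apply: (big_morph f _ (lin0 hf)) => x y; rewrite (linD hf).
Qed.

Section Tlift.
Variables V W : vectType k.

Lemma lin_tliftr X (b : V -> W -> X) : lin (tlift b).
Proof.
move=> a s t; rewrite /tlift scaler_sumr -big_split; apply: eq_bigr => i _.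
rewrite scaler_sumr -big_split; apply: eq_bigr => j _ /=.
by rewrite !mxE scalerDl scalerA.
Qed.
Lemma tlift_tens X (b : V -> W -> X) x y :
  (forall y, lin (fun x => b x y)) -> (forall x, lin (b x)) ->
  tlift b (tens x y) = b x y.
Proof.
move=> h1 h2; rewrite [x in RHS](coord_vbasis (memvf x)).
rewrite [in RHS](linS (h1 y)); apply: eq_bigr => i _.
rewrite (linZ (h1 y)) [y in RHS](coord_vbasis (memvf y)) (linS (h2 _)) scaler_sumr.
by apply: eq_bigr => j _; rewrite (linZ (h2 _)) scalerA mxE.
Qed.
Lemma eq_tlift X (b b' : V -> W -> X) t :
  (forall x y, b x y = b' x y) -> tlift b t = tlift b' t.
Proof. by move=> h; apply: eq_bigr => i _; apply: eq_bigr => j _; rewrite h. Qed.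
Lemma tlift_map X (Y : lmodType k) (f : X -> Y) (b : V -> W -> X) t : lin f ->
  f (tlift b t) = tlift (fun x y => f (b x y)) t.
Proof.
move=> hf; rewrite (linS hf); apply: eq_bigr => i _.
by rewrite (linS hf); apply: eq_bigr => j _; rewrite (linZ hf).
Qed.
Lemma lin_tliftl X (Y : lmodType k) (b : Y -> V -> W -> X) t : (forall x y, lin (fun z => b z x y)) ->
  lin (fun z => tlift (b z) t).
Proof. by move=> hb; apply: lin_sum => i; apply: lin_sum => j; apply: lin_scl. Qed.
Lemma lin_tensl y : lin (fun x : V => tens x y : tensor V W).
Proof.
by move=> a x x'; apply/matrixP => i j; rewrite !mxE linearP mulrDl mulrA.
Qed.
Lemma lin_tensr x : lin (fun y : W => tens x y : tensor V W).
Proof.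
by move=> a y y'; apply/matrixP => i j; rewrite !mxE linearP mulrDr mulrCA.
Qed.
Lemma tlift_tensK (t : tensor V W) : tlift (fun x y => tens x y) t = t.
Proof.
apply/matrixP => i j; rewrite /tlift summxE (bigD1 i) //= summxE (bigD1 j) //= !mxE.
rewrite !coord_free ?(basis_free (vbasisP _)) // !eqxx !mulr1.
rewrite [X in _ + X + _]big1 => [|j' hj]; last first.
  by rewrite !mxE !coord_free ?(basis_free (vbasisP _)) // (negPf hj) !mulr0.
rewrite [X in _ + X]big1 ?addr0 // => i' hi; rewrite summxE big1 // => j' _.
by rewrite !mxE !coord_free ?(basis_free (vbasisP _)) // (negPf hi) mul0r mulr0.
Qed.
End Tlift.
End Lin.

Section Sweedler.
Variables (k : fieldType) (H : falgType k) (S : hopf_structure H).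

(* Sweedler's sum of the b(h_1, h_2). *)
Definition sweedler (X : lmodType k) (b : H -> H -> X) (h : H) : X := tlift b (comul S h).

Implicit Types X Y : lmodType k.

Lemma eq_sw X (b b' : H -> H -> X) h : (forall x y, b x y = b' x y) -> sweedler b h = sweedler b' h.
Proof. exact: eq_tlift. Qed.
Lemma lin_swr X (b : H -> H -> X) : lin (sweedler b).
Proof. by move=> a x y; rewrite /sweedler linearP lin_tliftr. Qed.
Lemma lin_swl X Y (b : Y -> H -> H -> X) h : (forall x y, lin (fun z => b z x y)) ->
  lin (fun z => sweedler (b z) h).
Proof. exact: lin_tliftl. Qed.
Lemma lin_sw X Y (b : H -> H -> X) (f : Y -> H) : lin f -> lin (fun x => sweedler b (f x)).
Proof. by apply: lin_comp; apply: lin_swr. Qed.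
Lemma sw_map X Y (f : X -> Y) (b : H -> H -> X) h : lin f ->
  f (sweedler b h) = sweedler (fun x y => f (b x y)) h.
Proof. exact: tlift_map. Qed.
Lemma sw_swap X (b : H -> H -> H -> H -> X) g h :
  sweedler (fun x y => sweedler (fun z w => b x y z w) h) g = sweedler (fun z w => sweedler (fun x y => b x y z w) g) h.
Proof.
rewrite /sweedler /tlift.
under eq_bigr do under eq_bigr do
  (rewrite scaler_sumr; under eq_bigr do rewrite scaler_sumr).
under [RHS]eq_bigr do under eq_bigr do
  (rewrite scaler_sumr; under eq_bigr do rewrite scaler_sumr).
under eq_bigr do rewrite exchange_big.
rewrite exchange_big; apply: eq_bigr => i _.
under eq_bigr do rewrite exchange_big.
rewrite exchange_big; apply: eq_bigr => j _.
apply: eq_bigr => i' _; apply: eq_bigr => j' _.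
by rewrite !scalerA mulrC.
Qed.
End Sweedler.

(** Recursion on the syntax of a multilinear expression: at a product-like node the branch free of
    the bound variable is recognised as a constant function, and the search continues in the other
    branch. *)
Ltac lin := intros; lazymatch goal with
  | |- lin (fun x => x) => exact: lin_idf
  | |- lin (sweedler _ _) => exact: lin_swr
  | |- lin (tlift _) => exact: lin_tliftr
  | |- lin (fun_of_lfun _) => exact: linearP
  | |- lin (GRing.Linear.sort _) => exact: linearP
  | |- lin (fun x => tens (@?f x) (@?g x)) => lazymatch f with
      | fun _ => ?c => apply: (@lin_comp _ _ _ _ (fun z => tens c z) g); [exact: lin_tensr | lin]
      | _ => lazymatch g with fun _ => ?c =>
         apply: (@lin_comp _ _ _ _ (fun z => tens z c) f); [exact: lin_tensl | lin] end
      end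
  | |- lin (fun x => - (@?f x)) => apply: (@lin_opp _ _ _ f); lin
  | |- lin (fun x => (@?f x) + (@?g x)) => apply: (@lin_add _ _ _ f g); lin
  | |- lin (fun x => (@?f x) * (@?g x)) => lazymatch f with
      | fun _ => ?c => let T := type of c in apply: (@lin_mull _ _ T c g); lin
      | _ => lazymatch g with fun _ => ?c =>
         let T := type of c in apply: (@lin_mulr _ _ T c f); lin end
      end
  | |- lin (fun x => (@?f x) *: (@?g x)) => lazymatch f with
      | fun _ => ?c => apply: (@lin_scl _ _ _ c g); lin
      | _ => lazymatch g with fun _ => ?c => apply: (@lin_scr _ _ _ c f); lin end
      end
  | |- lin (fun x => sweedler ?S (@?b x) (@?f x)) => lazymatch b with
      | fun _ => ?c => apply: (@lin_sw _ _ S _ _ c f); lin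
      | _ => lazymatch f with fun _ => ?h => apply: (@lin_swl _ _ S _ _ b h); lin end
      end
  | |- lin (fun x => tlift (@?b x) ?h) => apply: (@lin_tliftl _ _ _ _ _ b h); lin
  | |- lin (fun x => fun_of_lfun ?g (@?f x)) => apply: (@lin_hom _ _ _ _ g f); lin
  | |- lin (fun x => GRing.Linear.sort ?g (@?f x)) => apply: (@lin_linear _ _ _ _ g f); lin
  | hf : lin ?g |- lin ?g => exact: hf
  | hf : lin ?g |- lin (fun x => ?g (@?f x)) => apply: (@lin_comp _ _ _ _ g f); [exact: hf | lin]
  | |- lin (fun x => ?b (@?f x) (@?g x) (@?h x)) => first [solve [eauto] |
      lazymatch g with fun _ => ?c => lazymatch h with fun _ => ?d =>
      apply: (@lin_comp _ _ _ _ (fun z => b z c d) f); [by eauto | lin] end end |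
      lazymatch f with fun _ => ?c => lazymatch h with fun _ => ?d =>
      apply: (@lin_comp _ _ _ _ (fun z => b c z d) g); [by eauto | lin] end end |
      lazymatch f with fun _ => ?c => lazymatch g with fun _ => ?d =>
      apply: (@lin_comp _ _ _ _ (fun z => b c d z) h); [by eauto | lin] end end]
  | |- lin (fun x => ?b (@?f x) (@?g x)) => first [solve [eauto] |
      lazymatch g with fun _ => ?c =>
        apply: (@lin_comp _ _ _ _ (fun z => b z c) f); [by eauto | lin] end |
      lazymatch f with fun _ => ?c =>
        apply: (@lin_comp _ _ _ _ (fun z => b c z) g); [by eauto | lin] end]
  | |- lin (fun x => ?b (@?f x)) =>
      first [solve [eauto] | apply: (@lin_comp _ _ _ _ b f); [by eauto | lin]]
  | |- lin _ => solve [eauto]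
  end.

Section HopfBasics.
Variables (k : fieldType) (H : falgType k) (S : hopf_structure H).
Implicit Types (X Y : lmodType k) (g h x y : H).
Local Notation sw := (sweedler S).
Local Notation A := (antipode S).
Local Notation eps := (counit S).

(** Coassociativity pushed through the linear map [F] that the trilinear [b] induces on the triple
    tensor product. All later regrouping of nested Sweedler sums uses this form. *)
Lemma swA X (b : H -> H -> H -> X) h :
  (forall y z, lin (fun x => b x y z)) -> (forall x z, lin (fun y => b x y z)) ->
  (forall x y, lin (fun z => b x y z)) ->
  sw (fun x y => sw (fun y1 y2 => b x y1 y2) y) h =
  sw (fun x y => sw (fun x1 x2 => b x1 x2 y) x) h.
Proof.
move=> b1 b2 b3.
pose F (t : tensor (tensor H H) H) : X := tlift (fun t z => tlift (fun x y => b x y z) t) t.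
have linF : lin F by apply: lin_tliftr.
have hF1 z : lin (fun t : tensor H H => tlift (fun x y => b x y z) t) by apply: lin_tliftr.
have hF2 (t : tensor H H) : lin (fun z => tlift (fun x y => b x y z) t) by lin.
have := congr1 F (comulA S h).
rewrite !(tlift_map _ _ linF) => E; transitivity (tlift (fun x y => F (tlift
  (fun y1 y2 => tens (tens x y1) y2) (comul S y))) (comul S h)).
  apply: eq_tlift => x y; rewrite (tlift_map _ _ linF); apply: eq_tlift => y1 y2.
  by rewrite /F tlift_tens // tlift_tens.
by rewrite E; apply: eq_tlift => x y; rewrite /F tlift_tens.
Qed.

Lemma swM X (b : H -> H -> X) g h :
  (forall y, lin (fun x => b x y)) -> (forall x, lin (fun y => b x y)) ->
  sw b (g * h) = sw (fun x y => sw (fun z w => b (x * z) (y * w)) h) g.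
Proof.
move=> b1 b2; rewrite -[LHS]/(tlift b (comul S (g * h))) comulM (tlift_map _ _ (lin_tliftr b)).
apply: eq_tlift => x y; rewrite (tlift_map _ _ (lin_tliftr b)).
by apply: eq_tlift => z w; rewrite tlift_tens.
Qed.

Lemma sw1 X (b : H -> H -> X) :
  (forall y, lin (fun x => b x y)) -> (forall x, lin (fun y => b x y)) -> sw b 1 = b 1 1.
Proof. by move=> b1 b2; rewrite -[LHS]/(tlift b (comul S 1)) comul1 tlift_tens. Qed.

Lemma sw_epsl X (f : H -> X) h : lin f -> sw (fun x y => (eps x : k) *: f y) h = f h.
Proof.
move=> hf; rewrite -[in RHS](counitl S h) (tlift_map _ _ hf).
by apply: eq_tlift => x y; rewrite (linZ hf).
Qed.

Lemma sw_epsr X (f : H -> X) h : lin f -> sw (fun x y => (eps y : k) *: f x) h = f h.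
Proof.
move=> hf; rewrite -[in RHS](counitr S h) (tlift_map _ _ hf).
by apply: eq_tlift => x y; rewrite (linZ hf).
Qed.

Lemma sw_Sl X (f : H -> X) h : lin f -> sw (fun x y => f (A x * y)) h = (eps h : k) *: f 1.
Proof. by move=> hf; rewrite -sw_map // -(linZ hf) -antipodel. Qed.

Lemma sw_Sr X (f : H -> X) h : lin f -> sw (fun x y => f (x * A y)) h = (eps h : k) *: f 1.
Proof. by move=> hf; rewrite -sw_map // -(linZ hf) -antipoder. Qed.

(** Both sides are convolution inverses of the multiplication H ⊗ H -> H. [T] is the triple product
    S(g_1 h_1) g_2 h_2 S(h_3) S(g_3), which collapses to one side or the other according to the end
    at which the antipode axiom is applied. *)
Lemma antipodeM g h : A (g * h) = A h * A g.
Proof.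
pose T := sw (fun g1 g' => sw (fun h1 h' => sw (fun g2 g3 => sw (fun h2 h3 =>
  A (g1 * h1) * (g2 * h2 * (A h3 * A g3))) h') g') h) g.
transitivity T.
  rewrite -[g in LHS](counitr S g) -[h in LHS](counitr S h).
  have l1 : lin (fun g => A (g * tlift (fun h1 h2 => (eps h2 : k) *: h1) (comul S h))) by lin.
  rewrite (tlift_map _ _ l1); apply: eq_tlift => g1 g'.
  have l2 : lin (fun h => A ((eps g' : k) *: g1 * h)) by lin.
  rewrite (tlift_map _ _ l2); apply: eq_tlift => h1 h'.
  transitivity (sw (fun g2 g3 => (eps h' : k) *: (A (g1 * h1) * (g2 * A g3))) g').
    rewrite (@sw_Sr _ (fun x => (eps h' : k) *: (A (g1 * h1) * x))); last by lin.
    by rewrite mulr1 -scalerAl -scalerAr !linearZ /= !scalerA mulrC.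
  apply: eq_sw => g2 g3.
  transitivity (sw (fun h2 h3 => A (g1 * h1) * (g2 * (h2 * A h3) * A g3)) h').
    rewrite (@sw_Sr _ (fun x => A (g1 * h1) * (g2 * x * A g3))); last by lin.
    by rewrite mulr1.
  by apply: eq_sw => h2 h3; rewrite !mulrA.
transitivity (sw (fun g' g3 => sw (fun h' h3 => sw (fun g1 g2 => sw (fun h1 h2 =>
  A (g1 * h1) * (g2 * h2 * (A h3 * A g3))) h') g') h) g).
  rewrite /T; under eq_sw do rewrite sw_swap.
  rewrite swA; [|by lin..].
  apply: eq_sw => x y; rewrite [LHS]sw_swap.
  under eq_sw do rewrite sw_swap.
  rewrite (@swA _ (fun h1 h2 h3 => sw (fun g1 g2 => A (g1 * h1) * (g2 * h2 * (A h3 * A y))) x)); [|by lin..].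
  by apply: eq_sw => z w; rewrite sw_swap.
rewrite -[g in RHS](counitl S g) -[h in RHS](counitl S h).
have l1 : lin (fun g => A (tlift (fun h1 h2 => (eps h1 : k) *: h2) (comul S h)) * A g) by lin.
rewrite (tlift_map _ _ l1); apply: eq_tlift => g' g3.
have l2 : lin (fun h => A h * A ((eps g' : k) *: g3)) by lin.
rewrite (tlift_map _ _ l2); apply: eq_tlift => h' h3.
transitivity (sw (fun x y => A x * y * (A h3 * A g3)) (g' * h')).
  rewrite swM; [|by lin..]; apply: eq_sw => x y; apply: eq_sw => z w; by rewrite !mulrA.
rewrite (@sw_Sl _ (fun x => x * (A h3 * A g3))); last by lin.
by rewrite mul1r counitM !linearZ /= -scalerAl -scalerAr !scalerA mulrC.
Qed.

Lemma antipode1 : A 1 = 1.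
Proof.
have := @sw_Sl _ (fun x => x) 1 (@lin_idf _ _).
rewrite sw1; [|by lin..]; by rewrite mulr1 counit1 scale1r.
Qed.

Lemma counit_antipode h : eps (A h) = eps h.
Proof.
transitivity (sw (fun x y => (eps y : k) *: eps (A x)) h); first by rewrite sw_epsr //; lin.
transitivity (sw (fun x y => eps (A x * y)) h).
  by apply: eq_sw => x y; rewrite counitM mulrC.
rewrite (@sw_Sl _ (fun x => eps x)); last by lin.
by rewrite counit1 /GRing.scale /= mulr1.
Qed.

Lemma sw_antipode X (b : H -> H -> X) h :
  (forall y, lin (fun x => b x y)) -> (forall x, lin (fun y => b x y)) ->
  sw b (A h) = sw (fun x y => b (A y) (A x)) h.
Proof.
move=> b1 b2.
(* both sides equal the sum of the b((S h_1)_1 h_2 S h_5, (S h_1)_2 h_3 S h_4) *)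
pose G x y z := sw (fun s t => sw (fun u v => b (s * u) (t * v)) y) (A x) : X.
transitivity (sw (fun x z => sw (fun s t => sw (fun z1 z2 => sw (fun u v => sw (fun p q =>
   b (s * (u * A q)) (t * (v * A p))) z2) z1) z) (A x)) h).
  transitivity (sw (fun x z => (eps z : k) *: sw b (A x)) h).
    by rewrite (@sw_epsr _ (fun x => sw b (A x))) //; lin.
  apply: eq_sw => x z.
  rewrite (@sw_map _ _ _ _ _ (fun w => (eps z : k) *: w)); last by lin.
  apply: eq_sw => s t; symmetry.
  under eq_sw do rewrite sw_swap.
  have E z1 z2 : sw (fun u v => sw (fun p q => b (s * (u * A q)) (t * (v * A p))) z2) z1
    = sw (fun p q => sw (fun u v => b (s * (u * A q)) (t * (v * A p))) z1) z2 by rewrite sw_swap.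
  transitivity (sw (fun u z' => sw (fun v z2 => sw (fun p q => b (s * (u * A q)) (t * (v * A p))) z2) z') z).
    rewrite (@swA _ (fun u v z2 => sw (fun p q => b (s * (u * A q)) (t * (v * A p))) z2)); [|by lin..].
    by apply: eq_sw => z1 z2; rewrite E.
  transitivity (sw (fun u z' => b (s * (u * A z')) t) z).
    apply: eq_sw => u z'.
    rewrite (@swA _ (fun v p q => b (s * (u * A q)) (t * (v * A p)))); [|by lin..].
    transitivity (sw (fun x y => (eps x : k) *: b (s * (u * A y)) t) z').
      apply: eq_sw => x' y.
      rewrite (@sw_Sr _ (fun x => b (s * (u * A y)) (t * x))); last by lin.
      by rewrite mulr1.
    by rewrite sw_epsl //; lin.
  rewrite (@sw_Sr _ (fun x => b (s * x) t)); last by lin.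
  by rewrite mulr1.
transitivity (sw (fun x z => sw (fun z1 z2 => sw (fun s t => sw (fun u v => sw (fun p q =>
   b (s * (u * A q)) (t * (v * A p))) z2) z1) (A x)) z) h).
  by apply: eq_sw => x z; rewrite sw_swap.
rewrite swA; [|by lin..].
transitivity (sw (fun x y => (eps x : k) *: sw (fun p q => b (A q) (A p)) y) h); last first.
  by rewrite sw_epsl //; lin.
apply: eq_sw => x y.
transitivity (sw (fun x1 x2 => sw (fun s t => sw (fun p q => b (s * A q) (t * A p)) y) (A x1 * x2)) x).
  apply: eq_sw => x1 x2; rewrite swM; [|by lin..]; apply: eq_sw => s t.
  apply: eq_sw => u v; apply: eq_sw => p q; by rewrite !mulrA.
rewrite (@sw_Sl _ (fun w => sw (fun s t => sw (fun p q => b (s * A q) (t * A p)) y) w)); last by lin.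
rewrite sw1; [|by lin..]; congr (_ *: _).
by apply: eq_sw => p q; rewrite !mul1r.
Qed.
End HopfBasics.

(** * Integrals of finite dimensional Hopf algebras *)

Section DualBasis.
Variables (k : fieldType) (V : vectType k).

Definition vb (i : 'I_(\dim {:V})) : V := (vbasis {:V})`_i.
Definition cf (i : 'I_(\dim {:V})) : 'Hom(V, k^o) := linfun (coord (vbasis {:V}) i : V -> k^o).

Lemma cfE i v : cf i v = coord (vbasis {:V}) i v. Proof. by rewrite lfunE. Qed.

Lemma cf_vb i j : cf i (vb j) = (i == j)%:R.
Proof. by rewrite cfE coord_free ?(basis_free (vbasisP _)) // eq_sym. Qed.

Lemma dual_expand v : v = \sum_i (cf i v : k) *: vb i.
Proof.
by rewrite {1}(coord_vbasis (memvf v)); apply: eq_bigr => i _; rewrite cfE.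
Qed.

Lemma dual_expand_lin (X : lmodType k) (g : V -> X) v : lin g ->
  \sum_i (cf i v : k) *: g (vb i) = g v.
Proof.
move=> hg; rewrite {2}(dual_expand v) (linS hg).
by apply: eq_bigr => i _; rewrite (linZ hg).
Qed.

Lemma cf_sep v : (forall i, cf i v = 0) -> v = 0.
Proof. by move=> h; rewrite (dual_expand v) big1 // => i _; rewrite h scale0r. Qed.

Lemma cf_inj u v : (forall i, cf i u = cf i v) -> u = v.
Proof.
by move=> h; rewrite (dual_expand u) (dual_expand v); apply: eq_bigr => i _; rewrite h.
Qed.

Lemma hom_sep v : (forall p : 'Hom(V, k^o), p v = 0) -> v = 0.
Proof. by move=> h; apply: cf_sep => i. Qed.

Definition functional (p : V -> k^o) (hp : lin p) : {p' : 'Hom(V, k^o) | forall v, p' v = p v}.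
Proof.
exists (\sum_i (p (vb i) : k) *: cf i) => v.
rewrite sum_lfunE -(dual_expand_lin v hp).
by apply: eq_bigr => i _; rewrite scale_lfunE /GRing.scale /= mulrC.
Qed.
End DualBasis.

Lemma lin_fun_hom (k : fieldType) (V : vectType k) (W : vectType k) (f : V -> W) (hf : lin f) :
  exists f' : 'Hom(V, W), forall v, f' v = f v.
Proof.
pose F := GRing.isLinear.Build _ _ _ _ f (fun a => hf a).
pose f' : {linear V -> W} := HB.pack f F.
by exists (linfun f') => v; rewrite lfunE.
Qed.

Lemma inj_surj (k : fieldType) (V W : vectType k) (f : V -> W) : lin f ->
  (forall v, f v = 0 -> v = 0) -> dim V = dim W -> forall w, exists v, f v = w.
Proof.
move=> /lin_fun_hom[f' Ef] hi hd w.
have k0 : lker f' = 0%VS.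
  apply/eqP; rewrite -subv0; apply/subvP => v; rewrite memv_ker memv0 Ef => /eqP.
  by move/hi => ->.
have/vspaceP hs : limg f' = fullv.
  apply/eqP; rewrite eqEdim subvf dimvf -hd -dimvf limg_dim_eq ?k0 ?capv0 //=.
have : w \in limg f' by rewrite hs memvf.
by case/memv_imgP => v _ ->; exists v; rewrite Ef.
Qed.

Section Integrals.
Variables (k : fieldType) (H : falgType k) (S : hopf_structure H).
Implicit Types (X Y : lmodType k) (g h x y : H).
Local Notation sw := (sweedler S).
Local Notation A := (antipode S).
Local Notation eps := (counit S).

Lemma sw_sumb X (I : Type) (r : seq I) (P : pred I) (b : I -> H -> H -> X) h :
  sw (fun x y => \sum_(i <- r | P i) b i x y) h = \sum_(i <- r | P i) sw (b i) h.
Proof.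
rewrite /sweedler /tlift [RHS]exchange_big /=; apply: eq_bigr => i _.
rewrite [RHS]exchange_big /=; apply: eq_bigr => j _.
by rewrite scaler_sumr.
Qed.

(** Applying a functional p to the second clause gives l p = p(1) l in the convolution algebra: l is
    a right integral of the dual Hopf algebra. *)
Definition right_integral (l : H -> k^o) : Prop :=
  lin l /\ forall x, sw (fun x1 x2 => (l x1 : k) *: x2) x = (l x : k) *: 1.

(* The trace of y |-> f(y_1) S^2(y_2) x. *)
Definition trace_integral (f : 'Hom(H, k^o)) (x : H) : k^o :=
  \sum_i sw (fun y1 y2 => (f y1 : k) *: cf i (A (A y2) * x)) (vb i).

Lemma lin_trace_integral f : lin (trace_integral f).
Proof. by rewrite /trace_integral; apply: lin_sum => i; lin. Qed.

Lemma sw_AA X (b : H -> H -> X) h :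
  (forall y, lin (fun x => b x y)) -> (forall x, lin (fun y => b x y)) ->
  sw b (A (A h)) = sw (fun x y => b (A (A x)) (A (A y))) h.
Proof. by move=> b1 b2; rewrite sw_antipode // sw_antipode //; lin. Qed.

(** The coproduct of x is rewritten with S^2(y_2) multiplied into its first leg, at the price of a
    factor S(y_3) on the second. Cyclicity of the trace then brings this factor next to the
    following Sweedler component of the basis vector, where the antipode axiom leaves 1. *)
Lemma trace_integralP f : right_integral (trace_integral f).
Proof.
split=> [|x]; first exact: lin_trace_integral.
(* The inserted factor is S(y_3) S^2(y_2) = S(S(y_2) y_3), a counit. *)
have step X (b : H -> H -> X) y : (forall y, lin (fun x => b x y)) ->
    (forall x, lin (fun y => b x y)) ->
    sw (fun x1 x2 => b (A (A y) * x1) x2) x =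
    sw (fun y' y'' => sw (fun z1 z2 => b z1 (A y'' * z2)) (A (A y') * x)) y.
  move=> b1 b2; transitivity (sw (fun y' y'' => sw (fun y1 y2 => sw (fun x1 x2 =>
     b (A (A y1) * x1) (A y'' * (A (A y2) * x2))) x) y') y); last first.
    apply: eq_sw => y' y''; rewrite swM; [|by lin..].
    by rewrite sw_AA //; lin.
  rewrite -(@swA _ _ _ _ (fun y1 y2 y'' => sw (fun x1 x2 =>
     b (A (A y1) * x1) (A y'' * (A (A y2) * x2))) x)); [|by lin..].
  transitivity (sw (fun y' y'' => (eps y'' : k) *: sw (fun x1 x2 => b (A (A y') * x1) x2) x) y).
    by rewrite (@sw_epsr _ _ _ _ (fun y' => sw (fun x1 x2 => b (A (A y') * x1) x2) x)) //; lin.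
  apply: eq_sw => y1 y'.
  transitivity (sw (fun y2 y'' => sw (fun x1 x2 => b (A (A y1) * x1) (A (A y2 * y'') * x2)) x) y').
    rewrite (@sw_Sl _ _ _ _ (fun z => sw (fun x1 x2 => b (A (A y1) * x1) (A z * x2)) x)); last by lin.
    by congr (_ *: _); apply: eq_sw => x1 x2; rewrite antipode1 mul1r.
  by apply: eq_sw => y2 y''; apply: eq_sw => x1 x2; rewrite antipodeM !mulrA.
pose F y1 y' y'' w2 j : H :=
  (f y1 : k) *: ((cf j (A (A y') * x) : k) *: (A y'' * w2)).
transitivity (\sum_i sw (fun y1 y => sw (fun y' y'' =>
    \sum_j sw (fun w1 w2 => (cf i w1 : k) *: F y1 y' y'' w2 j) (vb j)) y) (vb i)).
  transitivity (\sum_i sw (fun y1 y => (f y1 : k) *: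
      sw (fun x1 x2 => (cf i (A (A y) * x1) : k) *: x2) x) (vb i)).
    rewrite /trace_integral; under eq_sw do rewrite scaler_suml.
    rewrite sw_sumb; apply: eq_bigr => i _.
    have E x1 x2 : (sw (fun y1 y2 => (f y1 : k) *: cf i (A (A y2) * x1)) (vb i) : k) *: x2
      = sw (fun y1 y2 => ((f y1 : k) *: cf i (A (A y2) * x1) : k) *: x2) (vb i).
      by rewrite (@sw_map _ _ _ _ _ (fun c : k^o => (c : k) *: x2)) //; lin.
    under eq_sw do rewrite E.
    rewrite sw_swap; apply: eq_sw => y1 y2; rewrite (@sw_map _ _ _ _ _ (fun z => (f y1 : k) *: z)); last by lin.
    by apply: eq_sw => x1 x2; rewrite scalerA.
  apply: eq_bigr => i _; apply: eq_sw => y1 y.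
  rewrite (step _ (fun u v => (cf i u : k) *: v)); [|by lin..].
  rewrite (@sw_map _ _ _ _ _ (fun z => (f y1 : k) *: z)); last by lin.
  apply: eq_sw => y' y''.
  rewrite (@sw_map _ _ _ _ _ (fun z => (f y1 : k) *: z)); last by lin.
  rewrite -(@dual_expand_lin _ _ _ (sw (fun z1 z2 => (f y1 : k) *: ((cf i z1 : k) *: (A y'' * z2)))) (A (A y') * x)); last by lin.
  apply: eq_bigr => j _; rewrite (@sw_map _ _ _ _ _ (fun z => (cf j (A (A y') * x) : k) *: z)); last by lin.
  apply: eq_sw => z1 z2; rewrite /F !scalerA; congr (_ *: _).
  by rewrite -!mulrA [LHS]mulrC -[LHS]mulrA mulrCA.
have linF : [/\ forall y' y'' w2 j, lin (fun y1 => F y1 y' y'' w2 j),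
   forall y1 y'' w2 j, lin (fun y' => F y1 y' y'' w2 j),
   forall y1 y' w2 j, lin (fun y'' => F y1 y' y'' w2 j) &
   forall y1 y' y'' j, lin (fun w2 => F y1 y' y'' w2 j)].
  by rewrite /F; split; lin.
case: linF => F1 F2 F3 F4.
(* Cyclicity of the trace: after exchanging the two sums over the dual basis, the sum over i is the
   expansion of w1 in the basis. *)
transitivity (\sum_j sw (fun w1 w2 => sw (fun y1 y => sw (fun y' y'' => F y1 y' y'' w2 j) y) w1) (vb j)).
  transitivity (\sum_i \sum_j sw (fun w1 w2 => (cf i w1 : k) *: sw (fun y1 y => sw (fun y' y'' => F y1 y' y'' w2 j) y) (vb i)) (vb j)).
    apply: eq_bigr => i _; under eq_sw do rewrite sw_sumb.
    rewrite sw_sumb; apply: eq_bigr => j _.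
    under eq_sw do rewrite sw_swap.
    rewrite sw_swap; apply: eq_sw => w1 w2.
    rewrite (@sw_map _ _ _ _ _ (fun z => (cf i w1 : k) *: z)); last by lin.
    by apply: eq_sw => y1 y; rewrite (@sw_map _ _ _ _ _ (fun z => (cf i w1 : k) *: z)) //; lin.
  rewrite exchange_big; apply: eq_bigr => j _ /=.
  rewrite -sw_sumb; apply: eq_sw => w1 w2.
  by rewrite (@dual_expand_lin _ _ _ (sw (fun y1 y => sw (fun y' y'' => F y1 y' y'' w2 j) y))) //; lin.
rewrite /trace_integral scaler_suml; apply: eq_bigr => j _.
rewrite -(@swA _ _ _ _ (fun y1 y w2 => sw (fun y' y'' => F y1 y' y'' w2 j) y)); [|by lin..].
rewrite (@sw_map _ _ _ _ _ (fun c : k^o => (c : k) *: (1 : H))); last by lin.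
apply: eq_sw => y1 t.
rewrite -(@swA _ _ _ _ (fun y' y'' w2 => F y1 y' y'' w2 j)); [|by lin..].
transitivity (sw (fun y' s => (eps s : k) *: F y1 y' 1 1 j) t).
  apply: eq_sw => y' s; rewrite /F.
  have -> : sw (fun y'' w2 => (f y1 : k) *: ((cf j (A (A y') * x) : k) *: (A y'' * w2))) s
   = (eps s : k) *: ((f y1 : k) *: ((cf j (A (A y') * x) : k) *: 1)).
    by rewrite -(@sw_Sl _ _ _ _ (fun z => (f y1 : k) *: ((cf j (A (A y') * x) : k) *: z))) //; lin.
  by rewrite antipode1 mulr1.
rewrite (@sw_epsr _ _ _ _ (fun y' => F y1 y' 1 1 j)) //.
by rewrite /F antipode1 mulr1 scalerA.
Qed.

(** If every trace integral vanished, so would every V(x), the sum of y_1 weighted by the trace in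
    S^2(y_2) x. But contracting V with S of a second leg produces S^2(y_3) S(y_2) = S(y_2 S(y_3)),
    which collapses, and what remains is the expansion of 1 in the basis. *)
Lemma trace_integral_neq0 : exists f x, trace_integral f x != 0.
Proof.
pose V x := \sum_i sw (fun y1 y2 => (cf i (A (A y2) * x) : k) *: y1) (vb i).
case: (boolP [exists i : 'I_(\dim {:H}), [exists j : 'I_(\dim {:H}), trace_integral (cf i) (vb j) != 0]]).
  by case/existsP => i /existsP[j h]; exists (cf i), (vb j).
move=> /existsPn hz; exfalso.
have V0 j : V (vb j) = 0.
  apply: cf_sep => i; have /existsPn/(_ j) := hz i; rewrite negbK => /eqP.
  have lc : lin (cf i) by lin.
  rewrite /V (linS lc) /trace_integral => E; rewrite -[RHS]E; apply: eq_bigr => l _.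
  rewrite (sw_map _ _ _ lc).
  by apply: eq_sw => y1 y2; rewrite linearZ /GRing.scale /= mulrC.
have: \sum_j sw (fun u v => (cf j (A v * 1) : k) *: u) (V (vb j)) = 0.
  by rewrite big1 // => j _; rewrite V0 (lin0 (lin_swr _ _)).
suff -> : \sum_j sw (fun u v => (cf j (A v * 1) : k) *: u) (V (vb j)) = 1.
  by move/eqP; rewrite oner_eq0.
transitivity (\sum_i sw (fun y' y2 => sw (fun u v => (cf i (A (A y2) * (A v * 1)) : k) *: u) y') (vb i)).
  transitivity (\sum_j \sum_i sw (fun y1 y2 => (cf i (A (A y2) * vb j) : k) *: sw (fun u v => (cf j (A v * 1) : k) *: u) y1) (vb i)).
    apply: eq_bigr => j _; rewrite /V (linS (lin_swr S _)).
    apply: eq_bigr => i _; rewrite (sw_map _ _ _ (lin_swr S _)).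
    by apply: eq_sw => y1 y2; rewrite (linZ (lin_swr S _)).
  rewrite exchange_big; apply: eq_bigr => i _ /=; rewrite -sw_sumb.
  apply: eq_sw => y1 y2.
  transitivity (sw (fun u v => \sum_j (cf j (A v * 1) : k) *: ((cf i (A (A y2) * vb j) : k) *: u)) y1).
    rewrite sw_sumb; apply: eq_bigr => j _.
    rewrite (@sw_map _ _ _ _ _ (fun z => (cf i (A (A y2) * vb j) : k) *: z)); last by lin.
    by apply: eq_sw => u v; rewrite !scalerA mulrC.
  apply: eq_sw => u v.
  by rewrite (@dual_expand_lin _ _ _ (fun z => (cf i (A (A y2) * z) : k) *: u)) //; lin.
transitivity (\sum_i (cf i (1 : H) : k) *: vb i); last by rewrite -dual_expand.
apply: eq_bigr => i _.
rewrite -(@swA _ _ _ _ (fun u v y2 => (cf i (A (A y2) * (A v * 1)) : k) *: u)); [|by lin..].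
rewrite -(@sw_epsr _ _ S _ (fun u => (cf i (1 : H) : k) *: u)); last by lin.
apply: eq_sw => u y.
transitivity (sw (fun v y2 => (cf i (A (v * A y2)) : k) *: u) y).
  by apply: eq_sw => v y2; rewrite antipodeM mulr1.
by rewrite (@sw_Sr _ _ _ _ (fun z => (cf i (A z) : k) *: u)) ?antipode1 //; lin.
Qed.
End Integrals.

Section Radford.
Variables (k : fieldType) (H : falgType k) (S : hopf_structure H).
Implicit Types (X Y : lmodType k) (g h x y z : H).
Local Notation sw := (sweedler S).
Local Notation A := (antipode S).
Local Notation eps := (counit S).

Section Integral.
Variables (l : H -> k^o) (rl : right_integral S l).
Hypothesis (l_neq0 : exists y, l y != 0).
Let linl : lin l := proj1 rl.
Let intl := proj2 rl.

(** Both sides equal the sum of l(x_1 y_1) x_2 y_2 S(y_3): one reads off the integral property at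
    the product of x with a part of y, the other the antipode axiom on y. *)
Lemma integral_exchange x y :
  sw (fun x1 x2 => (l (x1 * y) : k) *: x2) x = sw (fun y1 y2 => (l (x * y1) : k) *: A y2) y.
Proof.
transitivity (sw (fun y' y3 => sw (fun x1 x2 => sw (fun y1 y2 =>
  (l (x1 * y1) : k) *: (x2 * y2 * A y3)) y') x) y); last first.
  apply: eq_sw => y' y3; transitivity ((l (x * y') : k) *: 1 * A y3); last first.
    by rewrite -scalerAl mul1r.
  rewrite -intl swM; [|by lin..]; symmetry.
  rewrite (@sw_map _ _ _ _ _ (fun z => z * A y3)); last by lin.
  apply: eq_sw => x1 x2; rewrite (@sw_map _ _ _ _ _ (fun z => z * A y3)); last by lin.
  by apply: eq_sw => y1 y2; rewrite -scalerAl.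
rewrite sw_swap; apply: eq_sw => x1 x2; symmetry.
rewrite -(@swA _ _ _ _ (fun y1 y2 y3 => (l (x1 * y1) : k) *: (x2 * y2 * A y3))); [|by lin..].
rewrite -(@sw_epsr _ _ S _ (fun y => (l (x1 * y) : k) *: x2)); last by lin.
apply: eq_sw => y1 y''.
transitivity (sw (fun y2 y3 => (l (x1 * y1) : k) *: (x2 * (y2 * A y3))) y'').
  by apply: eq_sw => y2 y3; rewrite mulrA.
by rewrite (@sw_Sr _ _ _ _ (fun z => (l (x1 * y1) : k) *: (x2 * z))) ?mulr1 //; lin.
Qed.

(** A left radical element z has counit zero: by [integral_exchange] the sum of l(z_1 y) z_2
    vanishes for all y, and ε(z) l(y0) = l(z_1 S(z_2) y0) is a combination of such sums. The radical
    is moreover stable under x -> p(x_2) x_1, and the counit of that element is p(x). *)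
Lemma integral_nondegl x : (forall y, l (x * y) = 0) -> x = 0.
Proof.
have cu z : (forall y, l (z * y) = 0) -> eps z = 0.
  move=> hz; have [y0 ly0] := l_neq0.
  have z12 y : sw (fun x1 x2 => (l (x1 * y) : k) *: x2) z = 0.
    rewrite integral_exchange -[RHS](lin0 (lin_swr S (fun _ _ => 0 : H))).
    by rewrite /sweedler /tlift !big1 // => i _; rewrite big1 // => j _; rewrite ?hz ?scale0r scaler0.
  have : (eps z : k) *: l y0 = 0 :> k^o.
    transitivity (sw (fun z1 z2 => l (z1 * (A z2 * y0))) z).
      transitivity (sw (fun z1 z2 => l (z1 * A z2 * y0)) z).
        by rewrite (@sw_Sr _ _ _ _ (fun w => l (w * y0))) ?mul1r //; lin.
      by apply: eq_sw => z1 z2; rewrite mulrA.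
    transitivity (\sum_j cf j (A (sw (fun z1 z2 => (l (z1 * vb j) : k) *: z2) z) * y0)).
      have E j : cf j (A (sw (fun z1 z2 => (l (z1 * vb j) : k) *: z2) z) * y0)
         = sw (fun z1 z2 => (cf j (A z2 * y0) : k) *: l (z1 * vb j)) z.
        rewrite (@sw_map _ _ _ _ _ (fun w => cf j (A w * y0))); last by lin.
        apply: eq_sw => z1 z2; rewrite linearZ /= -scalerAl linearZ /=.
        by rewrite /GRing.scale /= mulrC.
      under [RHS]eq_bigr do rewrite E.
      rewrite -sw_sumb; apply: eq_sw => z1 z2.
      by rewrite (@dual_expand_lin _ _ _ (fun w => l (z1 * w))) //; lin.
    by rewrite big1 // => j _; rewrite z12 linear0 mul0r linear0.
  by move/eqP; rewrite mulf_eq0 (negPf ly0) orbF => /eqP.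
move=> hx; apply: hom_sep => p.
rewrite -(@sw_epsl _ _ S _ p); last by lin.
transitivity (eps (sw (fun x1 x2 => (p x2 : k) *: x1) x)).
  rewrite (@sw_map _ _ _ _ _ eps); last by lin.
  by apply: eq_sw => x1 x2; rewrite linearZ /GRing.scale /= mulrC.
apply: cu => y.
transitivity (p (sw (fun x1 x2 => (l (x1 * y) : k) *: x2) x)).
  have lp : lin p by lin.
  rewrite (sw_map _ _ _ lp) (@sw_map _ _ _ _ _ (fun w => l (w * y))); last by lin.
  by apply: eq_sw => x1 x2; rewrite -scalerAl (linZ linl) linearZ /GRing.scale /= mulrC.
rewrite integral_exchange.
by rewrite /sweedler /tlift !big1 ?linear0 // => i _; rewrite big1 // => j _; rewrite hx scale0r scaler0.
Qed.

Lemma dim_dual (V : vectType k) : dim V = dim 'Hom(V, k^o).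
Proof. by rewrite /dim /= muln1. Qed.

Lemma integral_rieszl (p : H -> k^o) : lin p -> exists x, forall y, p y = l (x * y).
Proof.
move=> /functional[p' Ep].
pose f x := \sum_i (l (x * vb i) : k) *: cf i.
have fE x y : f x y = l (x * y).
  rewrite /f sum_lfunE -(@dual_expand_lin _ _ _ (fun y => l (x * y)) y); last by lin.
  by apply: eq_bigr => i _; rewrite scale_lfunE /GRing.scale /= mulrC.
have lf : lin f by apply: lin_sum => i; lin.
have [|x Ex] := @inj_surj _ _ _ f lf _ (dim_dual H) p'.
  by move=> x fx; apply: integral_nondegl => y; rewrite -fE fx zero_lfunE.
by exists x => y; rewrite -fE Ex Ep.
Qed.

Lemma integral_nondegr y : (forall x, l (x * y) = 0) -> y = 0.
Proof.
move=> hy; apply: hom_sep => p.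
have [|x Ex] := @integral_rieszl p; first by lin.
by rewrite Ex.
Qed.

Lemma integral_rieszr (p : H -> k^o) : lin p -> exists x, forall y, p y = l (y * x).
Proof.
move=> /functional[p' Ep].
pose f x := \sum_i (l (vb i * x) : k) *: cf i.
have fE x y : f x y = l (y * x).
  rewrite /f sum_lfunE -(@dual_expand_lin _ _ _ (fun y => l (y * x)) y); last by lin.
  by apply: eq_bigr => i _; rewrite scale_lfunE /GRing.scale /= mulrC.
have lf : lin f by apply: lin_sum => i; lin.
have [|x Ex] := @inj_surj _ _ _ f lf _ (dim_dual H) p'.
  by move=> x fx; apply: integral_nondegr => y; rewrite -fE fx zero_lfunE.
by exists x => y; rewrite -fE Ex Ep.
Qed.

(** Write m = l(x -). Integrality of m turns into l(x_1 y) x_2 = l(x y) 1, and the y for which l(-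
    y) is the counit makes x a multiple of 1. *)
Lemma integral_unique (m : H -> k^o) : right_integral S m -> exists c : k, forall y, m y = c * l y.
Proof.
case=> linm intm; have [x Ex] := integral_rieszl linm.
have [|y1 Ey1] := @integral_rieszr eps; first by lin.
have E y : sw (fun x1 x2 => (l (x1 * y) : k) *: x2) x = (l (x * y) : k) *: 1.
  rewrite integral_exchange -Ex -(antipode1 S).
  transitivity (A (sw (fun y1 y2 => (m y1 : k) *: y2) y)).
    by rewrite sw_map; [apply: eq_sw => u v; rewrite linearZ /= Ex | lin].
  by rewrite intm linearZ.
have := E y1; under eq_sw do rewrite -Ey1.
rewrite sw_epsl; last by lin.
move=> xE; exists (l (x * y1)) => y; rewrite Ex [in LHS]xE.
by rewrite -scalerAl mul1r (linZ linl).
Qed.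

(** The Nakayama automorphism: ν(x) represents the functional l(x -) through the pairing on the
    other side, and nondegeneracy makes it linear and multiplicative. *)
Lemma nakayama : exists nu : H -> H, [/\ lin nu, forall x y, l (x * y) = l (y * nu x),
  forall x y, nu (x * y) = nu x * nu y & nu 1 = 1].
Proof.
have h x : exists z, forall y, l (x * y) = l (y * z).
  by apply: (@integral_rieszr (fun y => l (x * y))); lin.
have [nu nuE] := boolp.choice h.
have inj u v : (forall y, l (y * u) = l (y * v)) -> u = v.
  move=> E; apply/eqP; rewrite -subr_eq0; apply/eqP/integral_nondegr => y.
  by rewrite mulrBr -scaleN1r addrC linl E scaleN1r addNr.
exists nu; split=> // [a x y | x y |].
- apply: inj => z; rewrite mulrDr -scalerAr linl -!nuE mulrDl -scalerAl linl //.
- by apply: inj => z; rewrite -nuE -mulrA nuE -mulrA nuE mulrA.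
by apply: inj => z; rewrite -nuE mul1r mulr1.
Qed.

(** For each coordinate functional, y -> cf_i(y_1) l(y_2) is again a right integral, so uniqueness
    yields the scalars that are the coordinates of c. The last clause says Δ(c) = c ⊗ c, tested on
    bilinear maps. *)
Lemma distinguished : exists c : H, [/\ forall y, sw (fun y1 y2 => (l y2 : k) *: y1) y = (l y : k) *: c,
  eps c = 1 & forall X (b : H -> H -> X), (forall y, lin (fun x => b x y)) ->
  (forall x, lin (fun y => b x y)) -> sw b c = b c c].
Proof.
have [y0 /eqP ly0] := l_neq0.
pose y1 := (l y0)^-1 *: y0.
have ly1 : l y1 = 1 by rewrite (linZ linl) /GRing.scale /= mulVf //; apply/eqP.
pose c := sw (fun u v => (l v : k) *: u) y1.
have cE y : sw (fun u v => (l v : k) *: u) y = (l y : k) *: c.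
  apply: cf_inj => i.
  have ri : right_integral S (fun y => sw (fun u v => (l v : k) *: cf i u) y).
    split; first by lin.
    move=> x; transitivity (sw (fun x1 x' => (cf i x1 : k) *: sw (fun x2 x3 => (l x2 : k) *: x3) x') x).
      transitivity (sw (fun x' x3 => sw (fun x1 x2 => ((l x2 : k) *: cf i x1 : k) *: x3) x') x).
        apply: eq_sw => x' x3; rewrite (@sw_map _ _ _ _ _ (fun w : k^o => (w : k) *: x3)) //; lin.
      rewrite -(@swA _ _ _ _ (fun x1 x2 x3 => ((l x2 : k) *: cf i x1 : k) *: x3)); [|by lin..].
      apply: eq_sw => x1 x'; rewrite (@sw_map _ _ _ _ _ (fun w => (cf i x1 : k) *: w)); last by lin.
      by apply: eq_sw => x2 x3; rewrite scalerA mulrC.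
    rewrite (@sw_map _ _ _ _ _ (fun w : k^o => (w : k) *: (1 : H))); last by lin.
    by apply: eq_sw => x1 x'; rewrite intl scalerA mulrC.
  have [d Ed] := integral_unique ri.
  have lc : lin (cf i) by lin.
  have F z : cf i (sw (fun u v => (l v : k) *: u) z) = d * l z.
    rewrite -Ed (sw_map _ _ _ lc); apply: eq_sw => u v; by rewrite linearZ.
  by rewrite F linearZ /= /c F ly1 mulr1 /GRing.scale /= mulrC.
exists c; split=> //.
  rewrite /c (sw_map _ _ _ (lin_linear _ (@lin_idf _ _))).
  transitivity (sw (fun u v => (eps u : k) *: l v) y1).
    by apply: eq_sw => u v; rewrite linearZ /GRing.scale /= mulrC.
  by rewrite sw_epsl.
move=> X b b1 b2.
transitivity (sw (fun u v => (l v : k) *: sw b u) y1).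
  by rewrite /c sw_map; [apply: eq_sw => u v; rewrite (linZ (lin_swr _ _)) | lin].
transitivity (sw (fun u v => sw (fun u1 u2 => (l v : k) *: b u1 u2) u) y1).
  by apply: eq_sw => u v; rewrite (@sw_map _ _ _ _ _ (fun w => (l v : k) *: w)) //; lin.
rewrite -(@swA _ _ _ _ (fun u1 u2 v => (l v : k) *: b u1 u2)); [|by lin..].
transitivity (sw (fun u v => b u (sw (fun v1 v2 => (l v2 : k) *: v1) v)) y1).
  apply: eq_sw => u v; rewrite (sw_map _ _ _ (b2 u)).
  by apply: eq_sw => v1 v2; rewrite (linZ (b2 u)).
transitivity (sw (fun u v => b ((l v : k) *: u) c) y1).
  by apply: eq_sw => u v; rewrite cE (linZ (b2 u)) (linZ (b1 c)).
by rewrite -(@sw_map _ _ _ _ _ (fun z => b z c)) //; lin.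
Qed.
End Integral.
End Radford.

(** * The dual Hopf algebra and the order of the antipode *)

Section GrouplikeSpan.
Variables (k : fieldType) (V : vectType k) (T : Type) (ev : V -> T -> k^o) (D : V -> T -> T -> k^o).
Hypotheses (lin_ev : forall t, lin (fun v => ev v t)) (ev_sep : forall v, (forall t, ev v t = 0) -> v = 0).
Hypothesis lin_D : forall s t, lin (fun v => D v s t).

(** Expanding w = Σ c_j x_j in D(w) = w ⊗ w and comparing coefficients gives c_j (w - x_j) = 0, so w
    equals any x_j that occurs. The pairing [ev] and the coproduct [D] stay abstract because the
    result serves both group-likes of H and characters of H. *)
Lemma grouplike_in_span (X : seq V) w :
  free X -> (forall x, x \in X -> forall s t, D x s t = (ev x s : k) * ev x t) ->
  (forall s t, D w s t = (ev w s : k) * ev w t) -> w != 0 -> w \in <<X>>%VS -> w \in X.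
Proof.
move=> fX glX glw w0 wX; pose c i : k := coord (in_tuple X) i w.
have Ew : w = \sum_i (c i : k) *: ((in_tuple X)`_i : V) by apply: (@coord_span _ _ _ (in_tuple X)).
have [i ci] : exists i, c i != 0.
  apply/existsP; apply: contraNT w0 => /existsPn hz.
  by rewrite Ew big1 // => i _; have /negPn/eqP := hz i; rewrite /c => ->; rewrite scale0r.
suff -> : w = X`_i by rewrite mem_nth.
apply/eqP; rewrite -subr_eq0; apply/eqP; apply: ev_sep => t.
have : \sum_j (c j * (ev w t - ev X`_j t) : k) *: ((in_tuple X)`_j : V) = 0 :> V.
  apply: ev_sep => s; etransitivity; first exact: (linS (lin_ev s)).
  under eq_bigr do rewrite (linZ (lin_ev s)).
  transitivity ((ev w s : k) * ev w t - D w s t); last by rewrite glw subrr.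
  have -> : ev w s = \sum_j (c j : k) *: ev (in_tuple X)`_j s.
    rewrite {1}Ew; etransitivity; first exact: (linS (lin_ev s)).
    by apply: eq_bigr => j _; rewrite (linZ (lin_ev s)).
  have -> : D w s t = \sum_j (c j : k) *: D (in_tuple X)`_j s t.
    rewrite {1}Ew; etransitivity; first exact: (linS (lin_D s t)).
    by apply: eq_bigr => j _; rewrite (linZ (lin_D s t)).
  rewrite mulr_suml -sumrB; apply: eq_bigr => j _.
  rewrite glX ?mem_nth // /GRing.scale /= mulrBr mulrBl -!mulrA.
  by rewrite [ev w t * _]mulrC [ev _ t * ev _ s]mulrC.
move/(elimT (@freeP _ _ _ (in_tuple X)) fX (fun j => c j * (ev w t - ev X`_j t)))/(_ i)/eqP; rewrite mulf_eq0 (negPf ci) /= subr_eq0 => /eqP E.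
by rewrite (linD (lin_ev t)) -scaleN1r (linZ (lin_ev t)) E scaleN1r subrr.
Qed.

(** Without a repetition the first n terms would form a free family for every n, by
    [grouplike_in_span]. Applied to the powers of one group-like it yields finite order. *)
Lemma grouplike_repeat (v : nat -> V) : (forall n s t, D (v n) s t = (ev (v n) s : k) * ev (v n) t) ->
  (forall n, v n != 0) -> exists i j, (i < j)%N /\ v i = v j.
Proof.
move=> gl v0; apply: boolp.contrapT => hn.
pose X n := rev (mkseq v n).
have XS n : X n.+1 = v n :: X n by rewrite /X /mkseq -addn1 iotaD map_cat rev_cat.
have fX n : free (X n).
  elim: n => [|n IH]; first by rewrite nil_free.
  rewrite XS free_cons IH andbT; apply/negP => vn.
  have: v n \in X n.
    apply: grouplike_in_span => // x; rewrite mem_rev => /mapP[i _ ->]; exact: gl.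
  rewrite mem_rev => /mapP[i]; rewrite mem_iota => /= hi E; apply: hn; exists i, n; split=> //.
have := fX (\dim {:V}).+1; rewrite /free => /eqP.
move=> E; have := dimvS (subvf <<X (\dim {:V}).+1>>%VS).
by rewrite E size_rev size_mkseq ltnn.
Qed.
End GrouplikeSpan.

Section DualRing.
Variables (k : fieldType) (H : falgType k) (S : hopf_structure H).
Local Notation sw := (sweedler S).
Local Notation A := (antipode S).
Local Notation eps := (counit S).

(* H^* with the convolution product. *)
Definition dual : Type := let _ := S in 'Hom(H, k^o).
HB.instance Definition _ := Vector.on dual.

Definition ev (p : dual) (h : H) : k^o := (p : 'Hom(H, k^o)) h.

Implicit Types p q r : dual.

Lemma lin_ev p : lin (ev p). Proof. by rewrite /ev; lin. Qed.
Lemma lin_evl h : lin (fun p => ev p h).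
Proof. by move=> a p q; rewrite /ev add_lfunE scale_lfunE. Qed.
Lemma ev_inj p q : (forall h, ev p h = ev q h) -> p = q.
Proof. by move=> h; apply/lfunP. Qed.
Lemma evD p q h : ev (p + q) h = ev p h + ev q h. Proof. exact: (linD (lin_evl h)). Qed.
Lemma evZ a p h : ev (a *: p) h = a * ev p h. Proof. exact: (linZ (lin_evl h)). Qed.
Lemma evN p h : ev (- p) h = - ev p h. Proof. by rewrite -!scaleN1r (linZ (lin_evl h)). Qed.
Lemma ev0 h : ev 0 h = 0. Proof. exact: (lin0 (lin_evl h)). Qed.

Definition dual_of (f : H -> k^o) : dual := \sum_i (f (vb i) : k) *: (cf i : dual).
Lemma dual_ofE f : lin f -> forall h, ev (dual_of f) h = f h.
Proof.
move=> hf h; rewrite /ev /dual_of sum_lfunE -[RHS](dual_expand_lin h hf).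
by apply: eq_bigr => i _; rewrite scale_lfunE /GRing.scale /= mulrC.
Qed.

Definition conv p q : dual := dual_of (fun h => sw (fun u v => (ev p u : k) *: ev q v) h).
Lemma convE p q h : ev (conv p q) h = sw (fun u v => (ev p u : k) *: ev q v) h.
Proof. by rewrite /conv dual_ofE //; apply: lin_swr. Qed.
Definition dual1 : dual := dual_of eps.
Lemma dual1E h : ev dual1 h = eps h.
Proof. by rewrite dual_ofE //; lin. Qed.

Let le p : lin (ev p) := lin_ev p.

Fact convA : associative conv.
Proof.
move=> p q r; apply: ev_inj => h; rewrite !convE.
transitivity (sw (fun u v => sw (fun v1 v2 => (ev p u : k) *: ((ev q v1 : k) *: ev r v2)) v) h).
  apply: eq_sw => u v; rewrite convE (@sw_map _ _ _ _ _ (fun w => (ev p u : k) *: w)) //; lin.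
have e := le; rewrite swA; [|by lin..]; apply: eq_sw => u v; rewrite convE.
rewrite (@sw_map _ _ _ _ _ (fun w : k^o => (w : k) *: ev r v)); last by lin.
by apply: eq_sw => u1 u2; rewrite scalerA.
Qed.
Fact conv1l : left_id dual1 conv.
Proof.
by move=> p; apply: ev_inj => h; rewrite convE; under eq_sw do rewrite dual1E; rewrite sw_epsl.
Qed.
Fact conv1r : right_id dual1 conv.
Proof.
move=> p; apply: ev_inj => h; rewrite convE.
under eq_sw do rewrite dual1E /GRing.scale /= mulrC.
by rewrite sw_epsr.
Qed.
Fact convDl : left_distributive conv +%R.
Proof.
move=> p q r; apply: ev_inj => h; rewrite evD !convE.
transitivity (sw (fun u v => (ev p u : k) *: ev r v + (ev q u : k) *: ev r v) h).
  by apply: eq_sw => u v; rewrite evD scalerDl.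
rewrite /sweedler /tlift -big_split; apply: eq_bigr => i _; rewrite -big_split.
by apply: eq_bigr => j _; rewrite scalerDr.
Qed.
Fact convDr : right_distributive conv +%R.
Proof.
move=> p q r; apply: ev_inj => h; rewrite evD !convE.
transitivity (sw (fun u v => (ev p u : k) *: ev q v + (ev p u : k) *: ev r v) h).
  by apply: eq_sw => u v; rewrite evD scalerDr.
rewrite /sweedler /tlift -big_split; apply: eq_bigr => i _; rewrite -big_split.
by apply: eq_bigr => j _; rewrite scalerDr.
Qed.
Fact dual1_neq0 : dual1 != 0.
Proof.
apply/eqP => /(congr1 (fun p => ev p 1)); rewrite dual1E counit1 ev0 => /eqP.
by rewrite oner_eq0.
Qed.
HB.instance Definition _ := GRing.Zmodule_isNzRing.Build dual
  convA conv1l conv1r convDl convDr dual1_neq0.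
Fact conv_scalel (a : k) p q : a *: (p * q) = (a *: p) * q.
Proof.
apply: ev_inj => h; rewrite evZ !convE.
rewrite -[LHS]/((a : k) *: (sw _ h : k^o)) (@sw_map _ _ _ _ _ (fun w : k^o => a *: w)); last by lin.
by apply: eq_sw => u v; rewrite evZ scalerA.
Qed.
HB.instance Definition _ := GRing.Lmodule_isLalgebra.Build k dual conv_scalel.
Fact conv_scaler (a : k) p q : a *: (p * q) = p * (a *: q).
Proof.
apply: ev_inj => h; rewrite evZ !convE.
rewrite -[LHS]/((a : k) *: (sw _ h : k^o)) (@sw_map _ _ _ _ _ (fun w : k^o => a *: w)); last by lin.
by apply: eq_sw => u v; rewrite evZ /GRing.scale /= mulrCA.
Qed.
HB.instance Definition _ := GRing.Lalgebra_isAlgebra.Build k dual conv_scaler.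

Lemma evM p q h : ev (p * q) h = sw (fun u v => (ev p u : k) *: ev q v) h.
Proof. exact: convE. Qed.
Lemma ev1 h : ev 1 h = eps h. Proof. exact: dual1E. Qed.

(** The transpose of the antipode, that is, the antipode of the dual Hopf algebra. *)
Definition SK p : dual := dual_of (fun h => ev p (A h)).
Lemma SKE p h : ev (SK p) h = ev p (A h).
Proof. by rewrite dual_ofE // => a x y; rewrite linearP (le p). Qed.
Lemma SKM p q : SK (p * q) = SK q * SK p.
Proof.
apply: ev_inj => h; rewrite SKE !evM.
have e := le; rewrite (@sw_antipode _ _ _ _ (fun u v => (ev p u : k) *: ev q v)); [|by lin..].
by apply: eq_sw => u v; rewrite !SKE /GRing.scale /= mulrC.
Qed.
Lemma SK1 : SK 1 = 1. Proof. by apply: ev_inj => h; rewrite SKE !ev1 counit_antipode. Qed.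
Lemma SK_is_lin : lin SK.
Proof. by move=> a p q; apply: ev_inj => h; rewrite SKE !evD !evZ !SKE. Qed.
HB.instance Definition _ := GRing.isLinear.Build k dual dual _ SK SK_is_lin.
Lemma SK_iter n p h : ev (iter n SK p) h = ev p (iter n A h).
Proof. by elim: n p h => //= n IH p h; rewrite SKE IH -iterSr. Qed.

(** These are the group-like elements of the dual Hopf algebra, as algebra maps H -> k. *)
Definition character (g : dual) : Prop :=
  ev g 1 = 1 /\ forall x y, ev g (x * y) = (ev g x : k) * ev g y.

Lemma characterM f g : character f -> character g -> character (f * g).
Proof.
have e := le; case=> f1 fM [g1 gM]; split=> [|x y]; rewrite !evM.
  by rewrite sw1 ?f1 ?g1 ?scale1r //; lin.
rewrite swM; [|by lin..].
have E : (sw (fun u v => (ev f u : k) *: ev g v) x : k) * sw (fun u v => (ev f u : k) *: ev g v) y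
  = (sw (fun u v => (ev f u : k) *: ev g v) x : k) *: (sw (fun u v => (ev f u : k) *: ev g v) y : k^o) by [].
rewrite E (@sw_map _ _ _ _ _ (fun w : k^o => (w : k) *: _)); last by lin.
apply: eq_sw => u v; rewrite (@sw_map _ _ _ _ _ (fun w : k^o => _ *: w)); last by lin.
apply: eq_sw => u' v'; rewrite fM gM /GRing.scale /= -!mulrA; congr (_ * _).
by rewrite mulrCA.
Qed.
Lemma character1 : character 1.
Proof. by split=> [|x y]; rewrite !ev1 ?counit1 ?counitM. Qed.
Lemma characterX g n : character g -> character (g ^+ n).
Proof.
by move=> hg; elim: n => [|n IH]; [exact: character1 | rewrite exprS; exact: characterM].
Qed.
Lemma character_neq0 g : character g -> g != 0.
Proof. by case=> g1 _; apply/eqP => g0; move: g1; rewrite g0 ev0 => /eqP; rewrite eq_sym oner_eq0. Qed.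
Lemma characterV g : character g -> g * SK g = 1 /\ SK g * g = 1.
Proof.
have e := le; case=> g1 gM; split; apply: ev_inj => h; rewrite evM ev1.
  transitivity (sw (fun u v => ev g (u * A v)) h).
    by apply: eq_sw => u v; rewrite SKE gM.
  by rewrite (@sw_Sr _ _ _ _ (ev g)) // g1 /GRing.scale /= mulr1.
transitivity (sw (fun u v => ev g (A u * v)) h).
  by apply: eq_sw => u v; rewrite SKE gM.
by rewrite (@sw_Sl _ _ _ _ (ev g)) // g1 /GRing.scale /= mulr1.
Qed.

Lemma grouplike_order (c : H) : eps c = 1 ->
  (forall (X : lmodType k) (b : H -> H -> X), (forall y, lin (fun x => b x y)) ->
    (forall x, lin (fun y => b x y)) -> sw b c = b c c) ->
  [/\ c * A c = 1, A c * c = 1 & exists n, (0 < n)%N /\ c ^+ n = 1].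
Proof.
move=> c1 cD; have cV : c * A c = 1.
  rewrite -(cD _ (fun x y => x * A y)); [|by lin..].
  by rewrite (@sw_Sr _ _ _ _ (fun x => x)) ?c1 ?scale1r //; lin.
have cV' : A c * c = 1.
  rewrite -(cD _ (fun x y => A x * y)); [|by lin..].
  by rewrite (@sw_Sl _ _ _ _ (fun x => x)) ?c1 ?scale1r //; lin.
have cXD n (X : lmodType k) (b : H -> H -> X) : (forall y, lin (fun x => b x y)) ->
    (forall x, lin (fun y => b x y)) -> sw b (c ^+ n) = b (c ^+ n) (c ^+ n).
  elim: n X b => [|n IH] X b b1 b2; first by rewrite sw1.
  rewrite exprS swM // cD /=; [|by lin..].
  by rewrite IH; [|by lin..].
have ceps n : eps (c ^+ n) = 1.
  by elim: n => [|n IH]; rewrite ?counit1 // exprS counitM c1 IH mulr1.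
split=> //.
have [||s t|n s t|n|i [j [ij E]]] := @grouplike_repeat k H 'Hom(H, k^o) (fun x p => p x)
   (fun x p q => sw (fun u v => (p u : k) *: q v) x) _ _ _ (fun n => c ^+ n).
- by move=> p; lin.
- exact: hom_sep.
- by lin.
- by rewrite cXD //; lin.
- by apply/eqP => c0; have := ceps n; rewrite c0 linear0 => /eqP; rewrite eq_sym oner_eq0.
exists (j - i)%N; rewrite subn_gt0; split=> //.
have gV : A c ^+ i * c ^+ i = 1.
  have cc : GRing.comm (A c) c by rewrite /GRing.comm cV.
  by rewrite -exprMn_comm // cV' expr1n.
by have := congr1 (fun x => A c ^+ i * x) E; rewrite /= gV -{1}(subnKC (ltnW ij)) exprD mulrA gV mul1r => <-.
Qed.

Lemma character_order g : character g -> exists n, (0 < n)%N /\ g ^+ n = 1.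
Proof.
move=> cg.
have [|v hv|s t|n s t|n|i [j [ij E]]] := @grouplike_repeat _ _ _ ev (fun v s t => ev v (s * t)) _ _ _ (fun n => g ^+ n).
- exact: lin_evl.
- by apply: ev_inj => h; rewrite hv ev0.
- exact: lin_evl.
- by case: (characterX n cg).
- exact: character_neq0 (characterX n cg).
exists (j - i)%N; rewrite subn_gt0; split=> //.
have [_ gV] := characterV (characterX i cg).
by have := congr1 (fun x => SK (g ^+ i) * x) E; rewrite /= gV -{1}(subnKC (ltnW ij)) exprD mulrA gV mul1r => <-.
Qed.

(* Radford's formula S^4(x_1) a(x_2) = c a(x_1) x_2 c^-1, with a and c of finite order. *)
Lemma antipode_order : exists n, (0 < n)%N /\ forall x, iter n.*2 A x = x.
Proof.
have e := le.
have [f [y0 ly0]] := trace_integral_neq0 S.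
have rl := trace_integralP S f; set l := trace_integral S f in rl ly0.
have ex : exists y, l y != 0 by exists y0.
have linl := proj1 rl.
have [nu [lnu nuE nuM nu1]] := nakayama rl ex.
have [c [cE ceps cD]] := distinguished rl ex.
have [cV cV' [n1 [n1_gt0 cn1]]] := grouplike_order ceps cD.
pose a : dual := dual_of (fun x => eps (nu x)).
have aE x : ev a x = eps (nu x) by rewrite dual_ofE //; lin.
have ca : character a by split=> [|x y]; rewrite !aE ?nu1 ?counit1 // nuM counitM.
have [z0 z0E] : exists z0, forall x, eps x = l (z0 * x) by apply: (integral_rieszl rl ex); lin.
(* The element z0 with l(z0 -) equal to the counit fills one slot of [integral_exchange]; moving
   ν(x) around l leaves ε(ν(x_1)) = a(x_1). *)
have R1 x : A (A (nu x)) = sw (fun x1 x2 => (ev a x1 : k) *: x2) x.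
  transitivity (sw (fun z1 z2 => (l (z0 * z1) : k) *: A (A z2)) (nu x)).
    under eq_sw do rewrite -z0E.
    by rewrite (@sw_epsl _ _ _ _ (fun z => A (A z))) //; lin.
  transitivity (A (sw (fun y1 y2 => (l (y1 * nu x) : k) *: y2) z0)).
    rewrite (integral_exchange rl) (@sw_map _ _ _ _ _ A); last by lin.
    by apply: eq_sw => z1 z2; rewrite linearZ.
  rewrite (@sw_map _ _ _ _ _ A); last by lin.
  transitivity (sw (fun y1 y2 => (l (x * y1) : k) *: A y2) z0).
    by apply: eq_sw => y1 y2; rewrite linearZ /= -nuE.
  rewrite -(integral_exchange rl); apply: eq_sw => x1 x2.
  by rewrite nuE -z0E aE.
have lA : lin A by lin.
(* Mirror image of [integral_exchange]. The integral l is left invariant only up to c, whence the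
   factor S(c). *)
have E2 x y : sw (fun x1 x2 => (l (x2 * y) : k) *: A x1) x = sw (fun y1 y2 => (l (x * y2) : k) *: (y1 * A c)) y.
  transitivity (sw (fun y1 y' => y1 * A (sw (fun z1 z2 => (l z2 : k) *: z1) (x * y'))) y); last first.
    by apply: eq_sw => y1 y'; rewrite cE linearZ /= -scalerAr.
  transitivity (sw (fun y1 y' => sw (fun y2 y3 => sw (fun x1 x2 => (l (x2 * y3) : k) *: (y1 * A y2 * A x1)) x) y') y); last first.
    apply: eq_sw => y1 y'; rewrite (@sw_map _ _ _ _ _ (fun z => y1 * A z)); last by lin.
    rewrite swM; [|by lin..]; rewrite sw_swap; apply: eq_sw => x1 x2; apply: eq_sw => y2 y3.
    by rewrite linearZ /= antipodeM -scalerAr mulrA.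
  rewrite (@swA _ _ _ _ (fun y1 y2 y3 => sw (fun x1 x2 => (l (x2 * y3) : k) *: (y1 * A y2 * A x1)) x)); [|by lin..].
  rewrite -[LHS](@sw_epsl _ _ S _ (fun y => sw (fun x1 x2 => (l (x2 * y) : k) *: A x1) x)); last by lin.
  apply: eq_sw => y' y3.
  rewrite (@sw_Sr _ _ _ _ (fun z => sw (fun x1 x2 => (l (x2 * y3) : k) *: (z * A x1)) x)); last by lin.
  by congr (_ *: _); apply: eq_sw => x1 x2; rewrite mul1r.
have AcA : A (A c) = c.
  by rewrite -[LHS]mulr1 -cV' mulrA -antipodeM cV antipode1 mul1r.
(* The computation of [R1] from the other side; applying S^2 once more and inserting [R1] gives
   Radford's formula, [AA4]. *)
have R2 x : sw (fun x1 x2 => (ev a x2 : k) *: A (A x1)) x = c * nu x * A c.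
  transitivity (A (sw (fun x1 x2 => (l (z0 * nu x2) : k) *: A x1) x)).
    rewrite (sw_map _ _ _ lA); apply: eq_sw => x1 x2; by rewrite linearZ /= -z0E aE.
  transitivity (A (sw (fun y1 y2 => (l (y2 * nu x) : k) *: (y1 * A c)) z0)).
    congr (A _); transitivity (sw (fun x1 x2 => (l (x2 * z0) : k) *: A x1) x).
      by apply: eq_sw => x1 x2; rewrite nuE.
    by rewrite E2; apply: eq_sw => y1 y2; rewrite nuE.
  transitivity (c * sw (fun y1 y2 => (l (y2 * nu x) : k) *: A y1) z0).
    rewrite (sw_map _ _ _ lA) (@sw_map _ _ _ _ _ (fun z => c * z)); last by lin.
    by apply: eq_sw => y1 y2; rewrite linearZ /= antipodeM AcA -scalerAr.
  rewrite E2 -mulrA; congr (c * _).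
  transitivity (sw (fun y1 y2 => (eps y2 : k) *: (y1 * A c)) (nu x)).
    by apply: eq_sw => y1 y2; rewrite -z0E.
  by rewrite (@sw_epsr _ _ _ _ (fun y => y * A c)) //; lin.
pose L p x : H := sw (fun x1 x2 => (ev p x1 : k) *: x2) x.
pose R p x : H := sw (fun x1 x2 => (ev p x2 : k) *: x1) x.
have AA4 x : iter 4 A (R a x) = c * L a x * A c.
  transitivity (A (A (c * nu x * A c))).
    rewrite -R2 /=; congr (A (A _)).
    rewrite /R !(sw_map _ _ _ lA); apply: eq_sw => x1 x2; by rewrite !linearZ.
  by rewrite !antipodeM !AcA R1.
have RR p q x : R p (R q x) = R (p * q) x.
  rewrite /R (sw_map _ _ _ (lin_swr _ _)).
  transitivity (sw (fun x1 x' => sw (fun x2 x3 => (ev q x3 : k) *: ((ev p x2 : k) *: x1)) x') x).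
    rewrite swA; [|by lin..]; apply: eq_sw => u v.
    rewrite (linZ (lin_swr _ _)) (@sw_map _ _ _ _ _ (fun z => (ev q v : k) *: z)) //; lin.
  apply: eq_sw => x1 x'; rewrite evM (@sw_map _ _ _ _ _ (fun w : k^o => (w : k) *: x1)); last by lin.
  by apply: eq_sw => u v; rewrite !scalerA mulrC.
have LL p q x : L p (L q x) = L (q * p) x.
  rewrite /L (sw_map _ _ _ (lin_swr _ _)).
  transitivity (sw (fun x1 x' => sw (fun x2 x3 => (ev q x1 : k) *: ((ev p x2 : k) *: x3)) x') x).
    apply: eq_sw => u v.
    by rewrite (linZ (lin_swr _ _)) (@sw_map _ _ _ _ _ (fun z => (ev q u : k) *: z)) //; lin.
  rewrite swA; [|by lin..]; apply: eq_sw => x1 x'.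
  rewrite evM (@sw_map _ _ _ _ _ (fun w : k^o => (w : k) *: x')); last by lin.
  by apply: eq_sw => u v; rewrite !scalerA.
have LR p q x : L p (R q x) = R q (L p x).
  rewrite /L /R !(sw_map _ _ _ (lin_swr _ _)).
  transitivity (sw (fun x' x3 => sw (fun x1 x2 => (ev q x3 : k) *: ((ev p x1 : k) *: x2)) x') x).
    apply: eq_sw => u v.
    by rewrite (linZ (lin_swr _ _)) (@sw_map _ _ _ _ _ (fun z => (ev q v : k) *: z)) //; lin.
  rewrite -(@swA _ _ _ _ (fun x1 x2 x3 => (ev q x3 : k) *: ((ev p x1 : k) *: x2))); [|by lin..].
  apply: eq_sw => u v.
  rewrite (linZ (lin_swr _ _)) (@sw_map _ _ _ _ _ (fun z => (ev p u : k) *: z)); last by lin.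
  by apply: eq_sw => x2 x3; rewrite !scalerA mulrC.
have A4M x y : iter 4 A (x * y) = iter 4 A x * iter 4 A y by rewrite /= !antipodeM.
have A4c : iter 4 A c = c by rewrite /= !AcA.
have A4Ac : iter 4 A (A c) = A c by rewrite /= !AcA.
have iterX (d : H) : iter 4 A d = d -> forall m, iter 4 A (d ^+ m) = d ^+ m.
  move=> hd; elim=> [|m IH]; first by rewrite /= !antipode1.
  by rewrite exprS A4M hd IH.
(* The left and right translations [L] and [R] commute and S^4 fixes c and S(c), so the formula can
   be iterated. *)
have main m x : iter (4 * m) A (R (a ^+ m) x) = c ^+ m * L (a ^+ m) x * A c ^+ m.
  elim: m x => [|m IH] x.
    rewrite mul1r mulr1 /R /L.
    under eq_sw do rewrite ev1.
    under [RHS]eq_sw do rewrite ev1.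
    by rewrite (sw_epsr _ _ (@lin_idf _ H)) (sw_epsl _ _ (@lin_idf _ H)).
  rewrite mulnS iterD exprSr -RR IH !A4M LR AA4 LL !iterX //.
  by rewrite exprSr exprS !mulrA.
have [n2 [n2_gt0 an2]] := character_order ca.
(* At m = n1 n2 the powers of a and of c are trivial, so S^(4m) is the identity; the exponent in the
   claim counts squares of S, hence the doubling. *)
exists ((n1 * n2).*2)%N; split; first by rewrite double_gt0 muln_gt0 n1_gt0.
move=> x; have := main (n1 * n2)%N x.
have -> : (4 * (n1 * n2))%N = (n1 * n2).*2.*2 by rewrite -!muln2 -mulnA mulnC.
have cN : c ^+ (n1 * n2) = 1 by rewrite exprM cn1 expr1n.
have aN : a ^+ (n1 * n2) = 1 by rewrite mulnC exprM an2 expr1n.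
rewrite cN aN.
have -> : A c ^+ (n1 * n2) = 1.
  have cc : GRing.comm (A c) c by rewrite /GRing.comm cV.
  by rewrite -[LHS]mulr1 -[X in _ * X]cN -exprMn_comm // cV' expr1n.
rewrite mul1r mulr1 /R /L.
under eq_sw do rewrite ev1.
under [RHS]eq_sw do rewrite ev1.
by rewrite (sw_epsr _ _ (@lin_idf _ H)) (sw_epsl _ _ (@lin_idf _ H)).
Qed.

Lemma SK_order : exists n, (0 < n)%N /\ forall p, iter n.*2 SK p = p.
Proof.
have [n [n0 h]] := antipode_order; exists n; split=> // p.
by apply: ev_inj => x; rewrite SK_iter h.
Qed.
End DualRing.

(** * Simultaneous triangularisation of commuting matrices *)

Section CommutingMatrices.
Variable k : closedFieldType.

(** Induction on the size: an eigenspace of a non-scalar member of the family is proper and stable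
    under all the others, so the family restricts to it. *)
Lemma common_row_eigenvector (T : Type) n (M : T -> 'M[k]_n) : (0 < n)%N ->
  (forall s t, M s *m M t = M t *m M s) ->
  exists2 v : 'rV_n, v != 0 & forall t, exists a, v *m M t = a *: v.
Proof.
have [m] := ubnP n; elim: m => // m IH in n M *; rewrite ltnS => nm n_gt0 MC.
have [hs|/boolp.existsNP[t0 nsc]] := boolp.EM (forall t, exists a, M t = a%:M).
  exists (const_mx 1).
    by apply/eqP => /rowP/(_ (Ordinal n_gt0)); rewrite !mxE => /eqP; rewrite oner_eq0.
  by move=> t; have [a ->] := hs t; exists a; rewrite mul_mx_scalar.
have [a a_eig] : exists a, eigenvalue (M t0) a.
  have /closed_rootP[a ra] : size (char_poly (M t0)) != 1%N.
    by rewrite size_char_poly; case: (n) n_gt0.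
  by exists a; rewrite eigenvalue_root_char.
pose W := eigenspace (M t0) a; pose B := row_base W.
have stab t : (B *m M t <= B)%MS.
  rewrite eq_row_base -/W; apply/eigenspaceP.
  have BW : B *m M t0 = a *: B by apply/eigenspaceP; rewrite eq_row_base.
  by rewrite -mulmxA MC mulmxA BW -scalemxAl.
have fB : row_free B by apply: row_base_free.
have [M' M'E] : exists M' : T -> 'M_(\rank W), forall t, M' t *m B = B *m M t.
  by exists (fun t => B *m M t *m pinvmx B) => t; rewrite mulmxKpV.
have rW : (\rank W < n)%N.
  rewrite ltn_neqAle rank_leq_col andbT; apply/eqP => rn; apply: nsc; exists a.
  have /eigenspaceP : (1%:M <= W)%MS by rewrite sub1mx row_full_unit -row_free_unit /row_free rn.
  by rewrite mul1mx scalemx1.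
have rW0 : (0 < \rank W)%N by rewrite lt0n mxrank_eq0.
clearbody B; have [//||v v0 hv] := IH _ M' (leq_trans rW nm).
  move=> s t; apply: (row_free_inj fB).
  by rewrite /= -!mulmxA !M'E !mulmxA !M'E -!mulmxA MC.
exists (v *m B); first by rewrite mulmx_free_eq0.
by move=> t; have [b E] := hv t; exists b; rewrite -mulmxA -M'E mulmxA E scalemxAl.
Qed.

(** A common eigenvector makes every matrix block triangular; its 1 x 1 block is a character, and
    the remaining block is again a representation. *)
Lemma trace_sum_characters (K : algType k) : (forall p q : K, p * q = q * p) ->
  forall n (M : K -> 'M[k]_n), lin M -> (forall p q, M (p * q) = M p *m M q) -> M 1 = 1%:M ->
  exists chi : 'I_n -> K -> k^o, (forall i, [/\ lin (chi i),
     forall p q, chi i (p * q) = (chi i p : k) * chi i q & chi i 1 = 1]) /\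
     forall p, \tr (M p) = \sum_i chi i p.
Proof.
move=> KC; elim=> [|n IH] M linM MM M1.
  by exists (fun _ _ => 0); split=> [[]//|p]; rewrite big_ord0 /mxtrace big_ord0.
have MC p q : M p *m M q = M q *m M p by rewrite -!MM KC.
have [//|v v0 hv] := common_row_eigenvector _ MC.
(* The invertible [row_ebase] completes v to a basis: its first row is a nonzero multiple of v. *)
pose P : 'M[k]_(1 + n) := row_ebase v.
have uP : P \in unitmx by apply: row_ebase_unit.
pose e0 : 'rV[k]_(1 + n) := delta_mx 0 (lshift n ord0).
have vP : exists2 c : k, c != 0 & v = c *: (e0 *m P).
  have rv : \rank v = 1%N by rewrite rank_rV v0.
  have := mulmx_ebase v; rewrite rv -/P => E.
  exists (col_ebase v 0 0).
    by have := col_ebase_unit v; rewrite unitmxE det_mx11 unitfE.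
  have pidE : pid_mx 1 = e0 :> 'rV[k]_(1 + n).
    by apply/rowP => j; rewrite !mxE !ord1 -val_eqE /= eq_sym andbT -val_eqE.
  by rewrite -[LHS]E pidE {1}[col_ebase v]mx11_scalar mul_scalar_mx -scalemxAl.
have hP p : exists a, e0 *m P *m M p = a *: (e0 *m P).
  have [c c0 Ev] := vP; have [a Ea] := hv p; exists a.
  apply: (scalerI c0); transitivity (v *m M p); first by rewrite {1}Ev -scalemxAl.
  by rewrite Ea {1}Ev !scalerA mulrC.
clearbody P; clear v v0 hv vP.
pose N p : 'M[k]_(1 + n) := P *m M p *m invmx P.
have NM p q : N (p * q) = N p *m N q by rewrite /N MM !mulmxA mulmxKV.
have N1 : N 1 = 1%:M by rewrite /N M1 mulmx1 mulmxV.
have linN : lin N by move=> a p q; rewrite /N linM mulmxDr mulmxDl -scalemxAr -scalemxAl.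
have Nur p : ursubmx (N p) = 0.
  have [a Ea] := hP p; have E : e0 *m N p = a *: e0.
    by rewrite /N !mulmxA Ea -scalemxAl mulmxK.
  apply/rowP => j; have /rowP/(_ (rshift 1 j)) := E.
  by rewrite -rowE !mxE !ord1 /= => ->; rewrite mulr0.
pose chi0 p : k^o := N p (lshift n ord0) (lshift n ord0).
have NB p q : N (p * q) = block_mx (ulsubmx (N p)) 0 (dlsubmx (N p)) (drsubmx (N p)) *m
   block_mx (ulsubmx (N q)) 0 (dlsubmx (N q)) (drsubmx (N q)).
  by rewrite NM -{1}[N p]submxK -{1}[N q]submxK !Nur.
pose M' p := drsubmx (N p).
have [|p q||chi [chiP chiE]] := IH M'.
- by move=> a p q; rewrite /M' linN; apply/matrixP => i j; rewrite !mxE.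
- by rewrite /M' NB mulmx_block block_mxKdr mulmx0 add0r.
- by rewrite /M' N1 scalar_mx_block block_mxKdr.
exists (fun i : 'I_n.+1 => if unlift ord0 i is Some j then chi j else chi0); split=> [i|p].
  case: (unlift ord0 i) => [j|]; first exact: chiP.
  split=> [a p q|p q|]; first by rewrite /chi0 linN !mxE.
    rewrite /chi0 NM mxE big_split_ord /= big_ord1 [X in _ + X]big1 ?addr0 // => j _.
    by have /matrixP/(_ 0 j) := Nur p; rewrite !mxE => ->; rewrite mul0r.
  by rewrite /chi0 N1 mxE eqxx.
have -> : \tr (M p) = \tr (N p) by rewrite /N mxtrace_mulC mulKmx.
rewrite -[N p]submxK mxtrace_block -/(M' p) chiE big_ord_recl unlift_none; congr (_ + _).
  by rewrite /mxtrace big_ord1 !mxE /chi0 [RHS]mxE.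
by apply: eq_bigr => i _; rewrite liftK.
Qed.
End CommutingMatrices.

(** * Cocommutative Hopf algebras *)

Section InvolutiveAntipode.
Variables (k : fieldType) (H : falgType k) (S : hopf_structure H).
Local Notation sw := (sweedler S).
Local Notation A := (antipode S).
Local Notation eps := (counit S).
Hypothesis AK : forall h, A (A h) = h.

(* p(Lam) is the trace of y |-> p(y_1) y_2. *)
Definition trace_elt : H := \sum_i sw (fun y1 y2 => (cf i y2 : k) *: y1) (vb i).

Lemma sw_Sl' (X : lmodType k) (f : H -> X) h : lin f ->
  sw (fun x y => f (A y * x)) h = (eps h : k) *: f 1.
Proof.
move=> hf; rewrite -(antipode1 S) -(@sw_Sl _ _ _ _ (fun z => f (A z))); last by lin.
by apply: eq_sw => x y; rewrite antipodeM AK.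
Qed.

(** The counit turns the defining sum into the trace of the identity. In characteristic zero the
    value is nonzero, which allows Λ to be normalised as in Maschke's theorem. *)
Lemma counit_trace_elt : eps trace_elt = (\dim {:H})%:R.
Proof.
have le : lin eps by lin.
rewrite /trace_elt (linS le) -[in RHS](card_ord (\dim _)) -sumr_const.
apply: eq_bigr => i _; rewrite (sw_map _ _ _ le).
transitivity (sw (fun y1 y2 => (eps y1 : k) *: cf i y2) (vb i)).
  by apply: eq_sw => u v; rewrite linearZ /GRing.scale /= mulrC.
by rewrite sw_epsl ?cf_vb ?eqxx //; lin.
Qed.

(** The factor S(h_3) h_2 has its components in the order opposite to the antipode axiom; it cancels
    because S^2 is the identity here. *)
Lemma sw_mull (X : lmodType k) (b : H -> H -> X) h x : (forall y, lin (fun x => b x y)) ->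
  (forall x, lin (fun y => b x y)) ->
  sw (fun y1 y2 => b (h * y1) y2) x =
  sw (fun h' h3 => sw (fun z1 z2 => b z1 (A h3 * z2)) (h' * x)) h.
Proof.
move=> b1 b2.
transitivity (sw (fun h' h3 => sw (fun h1 h2 => sw (fun y1 y2 =>
  b (h1 * y1) (A h3 * h2 * y2)) x) h') h); last first.
  apply: eq_sw => h' h3; rewrite swM; [|by lin..].
  by apply: eq_sw => h1 h2; apply: eq_sw => y1 y2; rewrite mulrA.
rewrite -(@swA _ _ _ _ (fun h1 h2 h3 => sw (fun y1 y2 => b (h1 * y1) (A h3 * h2 * y2)) x)); [|by lin..].
rewrite -[LHS](@sw_epsr _ _ S _ (fun h => sw (fun y1 y2 => b (h * y1) y2) x)); last by lin.
apply: eq_sw => h1 h''.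
rewrite (@sw_Sl' _ (fun z => sw (fun y1 y2 => b (h1 * y1) (z * y2)) x)); last by lin.
by congr (_ *: _); apply: eq_sw => y1 y2; rewrite mul1r.
Qed.

(** Cyclicity of the trace carries h_1 through the dual bases next to S(h_2), and h_1 S(h_2) =
    ε(h). *)
Lemma trace_elt_integral h : h * trace_elt = (eps h : k) *: trace_elt.
Proof.
rewrite /trace_elt mulr_sumr.
transitivity (\sum_i sw (fun h' h3 => sw (fun z1 z2 => (cf i (A h3 * z2) : k) *: z1) (h' * vb i)) h).
  apply: eq_bigr => i _; rewrite -(@sw_mull _ (fun u v => (cf i v : k) *: u)); [|by lin..].
  rewrite (@sw_map _ _ _ _ _ (fun z => h * z)); last by lin.
  by apply: eq_sw => u v; rewrite -scalerAr.
transitivity (sw (fun h' h3 => \sum_j sw (fun z1 z2 => (cf j (h' * (A h3 * z2)) : k) *: z1) (vb j)) h).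
  rewrite -sw_sumb; apply: eq_sw => h' h3.
  transitivity (\sum_i \sum_j sw (fun z1 z2 => (cf j (h' * vb i) : k) *: ((cf i (A h3 * z2) : k) *: z1)) (vb j)).
    apply: eq_bigr => i _.
    rewrite -[LHS](dual_expand_lin _ (lin_swr S _)); apply: eq_bigr => j _.
    by rewrite (@sw_map _ _ _ _ _ (fun z => (cf j (h' * vb i) : k) *: z)) //; lin.
  rewrite exchange_big; apply: eq_bigr => j _; rewrite -sw_sumb; apply: eq_sw => z1 z2.
  rewrite -(@dual_expand_lin _ _ _ (fun z => (cf j (h' * z) : k) *: z1) (A h3 * z2)); last by lin.
  by apply: eq_bigr => i _; rewrite !scalerA mulrC.
rewrite sw_sumb scaler_sumr; apply: eq_bigr => j _; rewrite sw_swap.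
rewrite (@sw_map _ _ _ _ _ (fun z => (eps h : k) *: z)); last by lin.
apply: eq_sw => z1 z2.
transitivity (sw (fun h' h3 => (cf j (h' * A h3 * z2) : k) *: z1) h).
  by apply: eq_sw => u v; rewrite mulrA.
by rewrite (@sw_Sr _ _ _ _ (fun z => (cf j (z * z2) : k) *: z1)) ?mul1r //; lin.
Qed.

Lemma trace_elt_swap (X : lmodType k) (b : H -> H -> X) h : (forall y, lin (fun x => b x y)) ->
  (forall x, lin (fun y => b x y)) ->
  sw (fun x y => b (h * x) y) trace_elt = sw (fun x y => b x (A h * y)) trace_elt.
Proof.
move=> b1 b2; rewrite sw_mull; [|by lin..].
rewrite -[RHS](@sw_epsl _ _ S _ (fun h => sw (fun x y => b x (A h * y)) trace_elt)); last by lin.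
by apply: eq_sw => u v; rewrite trace_elt_integral (linZ (lin_swr _ _)).
Qed.

Lemma antipode_trace_elt h : A trace_elt * h = (eps h : k) *: A trace_elt.
Proof. by rewrite -{1}[h]AK -antipodeM trace_elt_integral linearZ /= counit_antipode. Qed.
End InvolutiveAntipode.

Section Bidual.
Variables (k : fieldType) (H : falgType k) (S : hopf_structure H).

Lemma dual_reflexive (f : dual S -> k^o) : lin f -> exists h, forall p, ev p h = f p.
Proof.
move=> /functional[f' Ef].
pose G h : 'Hom(dual S, k^o) := sval (functional (@lin_evl _ _ S h)).
have GE h p : G h p = ev p h by rewrite /G; case: functional.
have lG : lin G by move=> a x y; apply/lfunP => p; rewrite add_lfunE scale_lfunE !GE lin_ev.
have [||h Eh] := @inj_surj _ _ _ G lG _ _ f'.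
- by move=> h G0; apply: hom_sep => p; have := GE h (p : dual S); rewrite G0 zero_lfunE.
- exact: (etrans (dim_dual H) (dim_dual (dual S))).
by exists h => p; rewrite -Ef -Eh GE.
Qed.

Lemma dual_sep (U : {vspace (dual S)}) w : w \notin U ->
  exists h, (forall u, u \in U -> ev u h = 0) /\ ev w h = 1.
Proof.
move=> wU; pose f : 'Hom(dual S, dual S) := (\1 - projv U)%VF.
have fE u : f u = u - projv U u by rewrite /f add_lfunE opp_lfunE id_lfunE.
have fw : f w != 0.
  rewrite fE subr_eq0; apply: contra wU => /eqP ->; exact: memv_proj.
have [q qw] : exists q : 'Hom(dual S, k^o), q (f w) != 0.
  apply: boolp.contrapT => hn; move/eqP: fw; apply; apply: hom_sep => q.
  by apply/eqP/negPn/negP => h; apply: hn; exists q.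
have [|h hE] := @dual_reflexive (fun p => (q (f w))^-1 *: q (f p)); first by lin.
exists h; split=> [u uU|]; rewrite hE.
  have -> : f u = 0 by rewrite fE projv_id // subrr.
  by rewrite linear0 scaler0.
by rewrite /GRing.scale /= mulVf.
Qed.
End Bidual.

Section RegularRepresentation.
Variables (k : fieldType) (H : falgType k) (S : hopf_structure H).
Local Notation sw := (sweedler S).
Implicit Types p q : dual S.

(** The operator y -> p(y_1) y_2 on H, written with row vectors so that p -> [regmx p] preserves the
    order of products. *)
Definition regmx p : 'M[k]_(\dim {:H}) :=
  \matrix_(i, j) cf j (sw (fun x y => (ev p x : k) *: y) (vb i)).

Lemma regmxM p q : regmx (p * q) = regmx p *m regmx q.
Proof.
have e := @lin_ev _ _ S.
apply/matrixP => i j; rewrite !mxE.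
transitivity (cf j (sw (fun x y => (ev q x : k) *: y) (sw (fun x y => (ev p x : k) *: y) (vb i)))).
  congr (cf j _); rewrite (sw_map _ _ _ (lin_swr _ _)).
  transitivity (sw (fun x y' => sw (fun y z => (ev p x : k) *: ((ev q y : k) *: z)) y') (vb i)).
    rewrite swA; [|by lin..]; apply: eq_sw => x y; rewrite evM.
    rewrite (@sw_map _ _ _ _ _ (fun w : k^o => (w : k) *: y)); last by lin.
    by apply: eq_sw => u v; rewrite scalerA.
  apply: eq_sw => x y; rewrite (linZ (lin_swr _ _)).
  by rewrite (@sw_map _ _ _ _ _ (fun w => (ev p x : k) *: w)) //; lin.
rewrite -(@dual_expand_lin _ _ _ (fun v => cf j (sw (fun x y => (ev q x : k) *: y) v)) (sw (fun x y => (ev p x : k) *: y) (vb i))); last by lin.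
by apply: eq_bigr => l _; rewrite !mxE.
Qed.

Lemma regmx1 : regmx 1 = 1%:M.
Proof.
apply/matrixP => i j; rewrite !mxE.
under eq_sw do rewrite ev1.
by rewrite (sw_epsl _ _ (@lin_idf _ H)) cf_vb eq_sym.
Qed.

Lemma lin_regmx : lin regmx.
Proof.
move=> a p q; apply/matrixP => i j; rewrite !mxE.
have lp : lin (fun p : dual S => cf j (sw (fun x y => (ev p x : k) *: y) (vb i))).
  apply: (@lin_hom _ _ _ _ (cf j)); apply: lin_swl => x y.
  by apply: (@lin_scr _ _ _ _ (fun p => ev p x)); apply: lin_evl.
exact: (lp a p q).
Qed.

End RegularRepresentation.

Section Cocommutative.
Variables (k : closedFieldType) (char0 : [pchar k] =i pred0) (H : falgType k) (S : hopf_structure H).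
Local Notation sw := (sweedler S).
Local Notation A := (antipode S).
Local Notation eps := (counit S).
Hypothesis KC : forall p q : dual S, p * q = q * p.

Lemma sw_comm (X : lmodType k) (b : H -> H -> X) h : (forall y, lin (fun x => b x y)) ->
  (forall x, lin (fun y => b x y)) -> sw b h = sw (fun x y => b y x) h.
Proof.
move=> b1 b2.
have E i j : sw (fun x y => (cf i x : k) *: cf j y) h = sw (fun x y => (cf j x : k) *: cf i y) h.
  by have := congr1 (fun p => ev p h) (KC (cf i) (cf j)); rewrite !evM.
have expand c : (forall y, lin (fun x => c x y)) -> (forall x, lin (fun y => c x y)) ->
    sw c h = \sum_i \sum_j (sw (fun x y => (cf i x : k) *: cf j y) h : k) *: c (vb i) (vb j) :> X.
  move=> c1 c2.
  transitivity (sw (fun x y => \sum_i \sum_j (((cf i x : k) *: cf j y : k^o) : k) *: c (vb i) (vb j)) h).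
    apply: eq_sw => x y; rewrite -[LHS](dual_expand_lin x (c1 y)); apply: eq_bigr => i _.
    rewrite -(dual_expand_lin y (c2 (vb i))) scaler_sumr; apply: eq_bigr => j _; by rewrite scalerA.
  rewrite sw_sumb; apply: eq_bigr => i _; rewrite sw_sumb; apply: eq_bigr => j _.
  by rewrite (@sw_map _ _ _ _ _ (fun w : k^o => (w : k) *: c (vb i) (vb j))) //; lin.
rewrite (expand b) // (expand (fun x y => b y x)) // exchange_big.
by apply: eq_bigr => i _; apply: eq_bigr => j _; rewrite E.
Qed.

(** In S^2(x_1) S(x_2) x_3 the last two factors collapse to give S^2(h); the first two are S(x_2
    S(x_1)), which cocommutativity turns into a counit, leaving h. *)
Let AK h : A (A h) = h.
Proof.
transitivity (sw (fun x y => (eps y : k) *: A (A x)) h).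
  by rewrite sw_epsr //; lin.
transitivity (sw (fun x y => sw (fun y1 y2 => A (A x) * (A y1 * y2)) y) h).
  apply: eq_sw => x y; rewrite (@sw_Sl _ _ _ _ (fun z => A (A x) * z)) ?mulr1 //; lin.
rewrite swA; [|by lin..].
rewrite -[RHS](@sw_epsl _ _ S _ (fun x => x)); last by lin.
apply: eq_sw => x y.
transitivity (sw (fun x1 x2 => A (x1 * A x2) * y) x).
  rewrite sw_comm; [|by lin..].
  by apply: eq_sw => x1 x2; rewrite antipodeM mulrA.
by rewrite (@sw_Sr _ _ _ _ (fun z => A z * y)) ?antipode1 ?mul1r //; lin.
Qed.

Local Notation Lam := (trace_elt S).

Lemma dim_neq0 (V : falgType k) : (\dim {:V})%:R != 0 :> k.
Proof.
have d0 : (0 < \dim {:V})%N.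
  by rewrite lt0n dimv_eq0; apply/eqP => /vspaceP/(_ 1); rewrite memvf memv0 oner_eq0.
by rewrite ((GRing.pcharf0P k).1 char0) -lt0n.
Qed.

(** The hypothesis passes from p to p(h -), since Λ carries h to its other leg, so p(1) = 0
    suffices. There q(1) Λ = q(S(Λ_1) Λ_2) Λ_3, which by cocommutativity is assembled from sums of
    the form q(h Λ_1) Λ_2 = 0; the counit of Λ is dim H, nonzero in k. *)
Lemma trace_elt_nondeg (p : dual S) : sw (fun x y => (ev p x : k) *: y) Lam = 0 -> p = 0.
Proof.
have e := @lin_ev _ _ S.
have swp (q : dual S) h : sw (fun x y => (ev q (h * x) : k) *: y) Lam =
    A h * sw (fun x y => (ev q x : k) *: y) Lam.
  rewrite (@trace_elt_swap _ _ S AK _ (fun x y => (ev q x : k) *: y)); [|by lin..].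
  rewrite (@sw_map _ _ _ _ _ (fun z => A h * z)); last by lin.
  by apply: eq_sw => x y; rewrite scalerAr.
have L1 (q : dual S) : sw (fun x y => (ev q x : k) *: y) Lam = 0 -> ev q 1 = 0.
  move=> hq.
  have : (ev q 1 : k) *: Lam = 0.
    transitivity (sw (fun u x3 => sw (fun x1 x2 => (ev q (A x1 * x2) : k) *: x3) u) Lam).
      rewrite -[LHS](@sw_epsl _ _ S _ (fun x => (ev q 1 : k) *: x)); last by lin.
      by apply: eq_sw => u x3; rewrite (@sw_Sl _ _ _ _ (fun z => (ev q z : k) *: x3)) //; lin.
    rewrite -(@swA _ _ _ _ (fun x1 x2 x3 => (ev q (A x1 * x2) : k) *: x3)); [|by lin..].
    rewrite sw_comm; [|by lin..].
    rewrite -(@swA _ _ _ _ (fun x2 x3 x1 => (ev q (A x1 * x2) : k) *: x3)); [|by lin..].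
    transitivity (\sum_j sw (fun x3 x1 => (cf j (A x1) : k) *: x3) (sw (fun x2 w => (ev q (vb j * x2) : k) *: w) Lam)); last first.
      by rewrite big1 // => j _; rewrite swp hq mulr0 (lin0 (lin_swr _ _)).
    transitivity (\sum_j sw (fun x2 w => (ev q (vb j * x2) : k) *: sw (fun x3 x1 => (cf j (A x1) : k) *: x3) w) Lam); last first.
      apply: eq_bigr => j _; rewrite (sw_map _ _ _ (lin_swr _ _)); apply: eq_sw => u w.
      by rewrite (linZ (lin_swr _ _)).
    rewrite -sw_sumb; apply: eq_sw => x2 w.
    transitivity (\sum_j sw (fun x3 x1 => (ev q (vb j * x2) : k) *: ((cf j (A x1) : k) *: x3)) w); last first.
      by apply: eq_bigr => j _; rewrite (@sw_map _ _ _ _ _ (fun z => (ev q (vb j * x2) : k) *: z)) //; lin.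
    rewrite -sw_sumb; apply: eq_sw => x3 x1.
    rewrite -(@dual_expand_lin _ _ _ (fun z => (ev q (z * x2) : k) *: x3) (A x1)); last by lin.
    by apply: eq_bigr => j _; rewrite !scalerA mulrC.
  move/(congr1 eps); rewrite linear0 linearZ /= counit_trace_elt => /eqP.
  by rewrite mulf_eq0 (negPf (dim_neq0 H)) orbF => /eqP.
move=> hp; apply: ev_inj => h; rewrite ev0.
pose q : dual S := dual_of S (fun x => ev p (h * x)).
have qE x : ev q x = ev p (h * x) by rewrite dual_ofE //; lin.
rewrite -[h]mulr1 -qE; apply: L1; under eq_sw do rewrite qE.
by rewrite swp hp mulr0.
Qed.

Lemma comulE h i j : comul S h i j = sw (fun x y => (cf i x : k) *: cf j y) h.
Proof.
transitivity (tlift (fun x y => tens x y) (comul S h) i j); first by rewrite tlift_tensK.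
rewrite /sweedler /tlift summxE; apply: eq_bigr => i' _.
rewrite summxE; apply: eq_bigr => j' _.
by rewrite !mxE /GRing.scale /= !cfE.
Qed.

Definition grouplike (x : H) : Prop := forall p q : dual S, ev (p * q) x = (ev p x : k) * ev q x.

Lemma grouplike_comul x : grouplike x -> comul S x = tens x x.
Proof.
move=> gx; apply/matrixP => i j; rewrite comulE !mxE.
by have := gx (cf i) (cf j); rewrite evM /ev !cfE.
Qed.

Lemma sw_grouplike x (X : lmodType k) (b : H -> H -> X) : grouplike x ->
  (forall y, lin (fun x => b x y)) -> (forall x, lin (fun y => b x y)) -> sw b x = b x x.
Proof. by move=> /grouplike_comul gx b1 b2; rewrite /sweedler gx tlift_tens. Qed.

Lemma grouplikeM x y : grouplike x -> grouplike y -> grouplike (x * y).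
Proof.
move=> gx gy p q; have e := @lin_ev _ _ S.
rewrite evM swM; [|by lin..].
by rewrite (sw_grouplike gx) ?(sw_grouplike gy) //; lin.
Qed.

Lemma grouplike1 : grouplike 1.
Proof. by move=> p q; have e := @lin_ev _ _ S; rewrite evM sw1 //; lin. Qed.

Lemma grouplikeS x : grouplike x -> grouplike (A x).
Proof.
move=> gx p q; have e := @lin_ev _ _ S.
rewrite evM sw_antipode; [|by lin..].
by rewrite (sw_grouplike gx) //; lin.
Qed.

(** The trace of [regmx p] is p(Λ) and also a sum of characters of the commutative dual, each being
    evaluation at a group-like X_i. If p kills all X_i then (p q)(Λ) = Σ p(X_i) q(X_i) = 0 for every
    q, and nondegeneracy of Λ gives p = 0. So the group-likes span H. *)
Theorem cocommutative_group_algebra : is_group_algebra S.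
Proof.
have e := @lin_ev _ _ S.
pose d := \dim {:H}.
pose M : dual S -> 'M[k]_d := @regmx k H S.
have trM p : \tr (M p) = ev p Lam :> k^o.
  rewrite /mxtrace /trace_elt (linS (e p)); apply: eq_bigr => i _.
  rewrite mxE (sw_map _ _ _ (e p)) (@sw_map _ _ _ _ _ (cf i)); last by lin.
  by apply: eq_sw => x y; rewrite (linZ (e p)) linearZ /GRing.scale /= mulrC.
have [chi [chiP chiE]] := @trace_sum_characters k (dual S) KC d M (@lin_regmx _ _ S) (@regmxM _ _ S) (@regmx1 _ _ S).
have h i : exists x, forall p, ev p x = chi i p by apply: dual_reflexive; case: (chiP i).
have [X XE] := boolp.choice h.
have gX i : grouplike (X i) by move=> p q; rewrite !XE; case: (chiP i).
have eX i : eps (X i) = 1 by rewrite -ev1 XE; case: (chiP i).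
pose L := [seq X i | i : 'I_d].
have spanL : (<<L>> = {:H})%VS.
  apply/vspaceP => w; rewrite memvf; apply: contraT => wL.
  pose f : 'Hom(H, H) := (\1 - projv <<L>>)%VF.
  have fE u : f u = u - projv <<L>> u by rewrite /f add_lfunE opp_lfunE id_lfunE.
  have fw : f w != 0.
    rewrite fE subr_eq0; apply: contra wL => /eqP ->; exact: memv_proj.
  case/eqP: fw; apply: hom_sep => q.
  pose p : dual S := dual_of S (fun x => q (f x)).
  have pE x : ev p x = q (f x) by rewrite dual_ofE //; lin.
  have pX i : ev p (X i) = 0.
    have XL : X i \in <<L>>%VS by apply/memv_span/map_f; rewrite mem_enum.
    have -> : ev p (X i) = q (f (X i)) by rewrite pE.
    have -> : f (X i) = 0 by rewrite fE projv_id // subrr.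
    by rewrite linear0.
  rewrite -pE (_ : p = 0) ?ev0 //; apply: trace_elt_nondeg.
  apply: hom_sep => q'; rewrite (@sw_map _ _ _ _ _ q'); last by lin.
  transitivity (ev (p * (q' : dual S)) Lam).
    by rewrite evM; apply: eq_sw => x y; rewrite linearZ.
  rewrite -trM chiE big1 // => i _; case: (chiP i) => _ -> _.
  by rewrite -XE pX mul0r.
(* The trace has exactly dim H characters, so a spanning family of them is a basis; in particular
   the X_i are distinct, and the index set itself can carry the group law. *)
have sizeL : size L = d by rewrite size_map -cardE card_ord.
have bL : basis_of {:H} L by rewrite basisEdim spanL subvv sizeL leqnn.
have uL : uniq L := free_uniq (basis_free bL).
have injX : injective X.
  by apply/injectiveP.
have inL x : grouplike x -> eps x = 1 -> exists i, X i = x.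
  move=> gx ex.
  have : x \in L.
    have l1 (p : 'Hom(H, k^o)) : lin (fun x => p x) by lin.
    have l2 (p q : 'Hom(H, k^o)) : lin (fun x => ev ((p : dual S) * (q : dual S)) x) by apply: e.
    apply: (grouplike_in_span l1 (@hom_sep _ _) l2 (basis_free bL)).
    - by move=> y /mapP[i _ ->] p q; apply: gX.
    - by move=> p q; apply: gx.
    - by apply/eqP => x0; have := linear0 (counit S); rewrite -[X in _ X = _]x0 ex => /eqP; rewrite oner_eq0.
    - by rewrite spanL memvf.
  by case/mapP => i _ ->; exists i.
have [|m mE] := @boolp.choice ('I_d * 'I_d) 'I_d (fun ij l => X l = X ij.1 * X ij.2).
  by move=> [i j]; apply: inL; [exact: grouplikeM | rewrite counitM !eX mulr1].
have [|o oE] := inL 1 grouplike1; first exact: counit1.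
have [|v vE] := @boolp.choice 'I_d 'I_d (fun i l => X l = A (X i)).
  by move=> i; apply: inL; [exact: grouplikeS | rewrite counit_antipode].
pose mul i j := m (i, j).
have mulE i j : X (mul i j) = X i * X j by rewrite mE.
have mulA : associative mul by move=> i j l; apply: injX; rewrite !mulE mulrA.
have mul1 : left_id o mul by move=> i; apply: injX; rewrite mulE oE mul1r.
have mulV : left_inverse o v mul.
  move=> i; apply: injX; rewrite mulE vE oE.
  rewrite -(@sw_grouplike (X i) _ (fun x y => A x * y)) //; [|by lin..].
  by rewrite (sw_Sl _ _ (@lin_idf _ H)) eX scale1r.
pose gM := Finite_isGroup.Build 'I_d mulA mul1 mulV.
pose gT : finGroupType := HB.pack 'I_d gM.
exists gT, (X : gT -> H); split.
- exact: bL.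
- by split=> [|i j]; [exact: oE | exact: mulE].
- by move=> i; apply: grouplike_comul.
by move=> i; split; [exact: eX | rewrite -vE].
Qed.
End Cocommutative.

(** * Grouplike and skew primitive elements *)

Local Notation pZtoQ := (map_poly (intr : int -> rat)).

(** Transfer from complex numbers to any field of characteristic zero: an identity over the integers
    can be evaluated in k. The gcd of f and g over the rationals is separable, so it divides h once
    h vanishes at its complex roots; Bezout and clearing denominators do the rest. *)
Lemma poly_int_combination (f g h : {poly int}) : separable_poly (pZtoQ g) ->
  (forall z : algC, root (map_poly intr f) z -> root (map_poly intr g) z -> root (map_poly intr h) z) ->
  exists (c : int) (u w : {poly int}), c != 0 /\ c%:P * h = u * f + w * g.
Proof.
move=> sg hz; pose D := gcdp (pZtoQ f) (pZtoQ g).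
have QC (p : {poly int}) : map_poly ratr (pZtoQ p) = map_poly intr p :> {poly algC}.
  by rewrite -map_poly_comp; apply: eq_map_poly => x /=; rewrite ratr_int.
have Dh : D %| pZtoQ h.
  rewrite -(dvdp_map (ratr : {rmorphism rat -> algC})) QC.
  set E := map_poly _ D.
  have sE : separable_poly E.
    by rewrite separable_map (dvdp_separable (dvdp_gcdr _ _)).
  have E0 : lead_coef E != 0.
    by rewrite lead_coef_eq0; exact: separable_poly_neq0.
  have [r rE] := closed_field_poly_normal E.
  rewrite rE dvdpZl //; apply: uniq_roots_dvdp.
    apply/allP => z zr; have : root E z by rewrite rE rootZ // root_prod_XsubC.
    by rewrite /E gcdp_map root_gcd !QC => /andP[]; apply: hz.
  rewrite uniq_rootsE -separable_prod_XsubC.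
  by rewrite -(eqp_separable (eqp_scale _ E0)) -rE.
have [[u w] /= Euw] := Bezoutp (pZtoQ f) (pZtoQ g).
have /dvdpP[q Eq] : u * pZtoQ f + w * pZtoQ g %| pZtoQ h by rewrite (eqp_dvdl _ Euw).
have [u' [a a0 Eu]] := rat_poly_scale (q * u).
have [w' [b b0 Ew]] := rat_poly_scale (q * w).
exists (a * b), (b%:P * u'), (a%:P * w'); split; first by rewrite mulf_neq0.
apply: (map_inj_poly (@intr_inj rat) (erefl _)).
rewrite !(rmorphM, rmorphD) /= !map_polyC /= Eq.
have -> : pZtoQ u' = (a%:~R)%:P * (q * u) by rewrite Eu mul_polyC scalerA mulfV ?scale1r ?intr_eq0.
have -> : pZtoQ w' = (b%:~R)%:P * (q * w) by rewrite Ew mul_polyC scalerA mulfV ?scale1r ?intr_eq0.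
rewrite ?intrM ?polyCM /=; set A := _%:P; set B := _%:P.
by ring.
Qed.

Section RootsOfUnity.
Variables (k : closedFieldType) (char0 : [pchar k] =i pred0).

Lemma natr_neq0 n : (0 < n)%N -> n%:R != 0 :> k.
Proof. by rewrite ((GRing.pcharf0P k).1 char0) -lt0n. Qed.

Lemma intr_neq0 (c : int) : c != 0 -> c%:~R != 0 :> k.
Proof.
case: c => n c0; first by rewrite -pmulrn natr_neq0 // lt0n.
by rewrite NegzE mulrNz oppr_eq0 -pmulrn natr_neq0.
Qed.

Lemma prim_root_exists n : (0 < n)%N -> exists z : k, n.-primitive_root z.
Proof.
pose p : {poly k} := 'X^n - 1; have [r Dp] := closed_field_poly_normal p.
move=> n_gt0; rewrite (monicP _) ?monicXnsubC // scale1r in Dp.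
have rn1 : all n.-unity_root r by apply/allP => z; rewrite -root_prod_XsubC -Dp.
have sz_r : (n < (size r).+1)%N by rewrite -(size_prod_XsubC r id) -Dp size_XnsubC.
have [|z] := hasP (has_prim_root n_gt0 rn1 _ sz_r); last by exists z.
by rewrite -separable_prod_XsubC -Dp separable_Xn_sub_1 // natr_neq0.
Qed.

(** For complex numbers this is the equality case of the triangle inequality. As k has no absolute
    value, the statement is encoded by f = Σ X^(m_i) - N and g = X^n - 1 and carried over by
    [poly_int_combination], evaluated at a primitive n-th root of unity of k. *)
Lemma roots_of_unity_sum n N (mu : 'I_N -> k) : (0 < n)%N -> (forall i, mu i ^+ n = 1) ->
  \sum_i mu i = N%:R -> forall i, mu i = 1.
Proof.
move=> n0 mun mus i0; have [z zP] := prim_root_exists n0.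
have h i : exists m : 'I_n, mu i = z ^+ m by have [m ->] := prim_rootP zP (mun i); exists m.
have [m mE] := boolp.choice h.
pose f : {poly int} := \sum_i 'X^(m i) - N%:R.
pose g : {poly int} := 'X^n - 1.
have [||c [u [w [c0 E]]]] := @poly_int_combination f g ('X^(m i0) - 1).
- by rewrite rmorphB rmorph1 /= map_polyXn separable_Xn_sub_1 // pnatr_eq0 -lt0n.
- move=> x; rewrite !rmorphB !rmorph1 /= !map_polyXn rmorph_sum rmorph_nat /=.
  rewrite /root !hornerE /= !subr_eq0 horner_sum => /eqP fx /eqP xn.
  have nx : `|x| = 1.
    apply/eqP; rewrite -(@pexpr_eq1 _ _ n) // -normrX.
    by rewrite xn normr1.
  have nxm j : `|x ^+ j| = 1 by rewrite normrX nx expr1n.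
  have xm := @normC_sum_upper _ _ xpredT (fun i : 'I_N => x ^+ (m i)) (fun=> 1).
  apply/eqP; apply: xm => // [i _|]; first by rewrite nxm.
  rewrite sumr_const card_ord; move: fx.
  rewrite -[N%:R.[x]]/((N%:R : {poly algC}).[x]) -polyC_natr hornerC => <-.
  by apply: eq_bigr => i _; rewrite map_polyXn hornerXn.
pose ik := map_poly (intr : int -> k).
have hX j : (ik ('X^j - 1)).[z] = z ^+ j - 1.
  by rewrite /ik rmorphB rmorph1 /= map_polyXn !hornerE.
have hf : (ik f).[z] = 0.
  rewrite /ik rmorphB rmorph_sum rmorph_nat /= hornerD hornerN -polyC_natr hornerC horner_sum.
  by under eq_bigr do rewrite map_polyXn hornerXn -mE; rewrite mus subrr.
have hg : (ik g).[z] = 0 by rewrite hX (prim_expr_order zP) subrr.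
have hh : (ik ('X^(m i0) - 1)).[z] = mu i0 - 1 by rewrite hX -mE.
have := congr1 (fun p : {poly int} => (ik p).[z]) E.
move: ('X^_ - 1) hh => q hq; clearbody f g => /=.
rewrite /ik !(rmorphM, rmorphD) /= -/ik !hornerM hornerD !hornerM hf hg hq !mulr0 addr0.
rewrite /ik map_polyC hornerC => /eqP.
by rewrite mulf_eq0 (negPf (intr_neq0 c0)) /= subr_eq0 => /eqP.
Qed.

(** Since X^n - 1 is separable, B is diagonalisable and its eigenvalues are n-th roots of unity with
    sum d. The sequence [P] consists of the powers of B. *)
Lemma finite_order_trace n d (B : 'M[k]_d) (P : nat -> 'M[k]_d) : (0 < n)%N -> P 0 = 1%:M ->
  (forall i, P i.+1 = P i *m B) -> P n = 1%:M -> \tr B = d%:R -> B = 1%:M.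
Proof.
case: d B P => [|d] B P n0 P0 PS Pn trB; first by rewrite [B]flatmx0 [RHS]flatmx0.
have PE i : P i = B ^+ i by elim: i => [|i IH]; rewrite ?expr0 ?P0 // PS IH exprSr.
have dB : diagonalizable B.
  apply/diagonalizableP; have [r Dr] := closed_field_poly_normal ('X^n - 1 : {poly k}).
  rewrite (monicP _) ?monicXnsubC // scale1r in Dr.
  exists r; first by rewrite -separable_prod_XsubC -Dr separable_Xn_sub_1 // natr_neq0.
  rewrite -Dr; apply: mxminpoly_min.
  by rewrite rmorphB rmorph1 rmorphXn /= horner_mx_X -PE Pn subrr.
have [Q uQ /(similar_diagLR uQ)[D BE]] := dB.
rewrite conjVmx // in BE.
have BX i : B ^+ i = invmx Q *m diag_mx (\row_j (D 0 j ^+ i)) *m Q.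
  elim: i => [|i IH].
    have -> : \row_j D 0 j ^+ 0 = const_mx 1 :> 'rV[k]_d.+1 by apply/rowP => j; rewrite !mxE.
    by rewrite diag_const_mx mulmx1 mulVmx.
  rewrite exprSr IH {1}BE -mulmxE !mulmxA mulmxK // -(mulmxA (invmx Q) (diag_mx _) (diag_mx _)) mulmx_diag.
  by congr (_ *m diag_mx _ *m _); apply/rowP => j; rewrite !mxE exprSr.
have Dn j : D 0 j ^+ n = 1.
  have : diag_mx (\row_j (D 0 j ^+ n)) = 1%:M.
    have := congr1 (fun C => Q *m C *m invmx Q) (BX n).
    by rewrite -PE Pn mulmx1 mulmxV // !mulmxA mulmxV // mul1mx mulmxK.
  by move/matrixP/(_ j j); rewrite !mxE eqxx !mulr1n.
have D1 := @roots_of_unity_sum n d.+1 (D 0) n0 Dn.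
have {D1} D1 j : D 0 j = 1.
  apply: D1; rewrite -trB BE mxtrace_mulC mulmxA mulmxV // mul1mx mxtrace_diag.
  by [].
have := BX 1; rewrite expr1 => ->.
have -> : \row_j D 0 j ^+ 1 = const_mx 1 :> 'rV[k]_d.+1 by apply/rowP => j; rewrite !mxE D1.
by rewrite diag_const_mx mulmx1 mulVmx.
Qed.
End RootsOfUnity.

Section DualLemmas.
Variables (k : closedFieldType) (char0 : [pchar k] =i pred0) (H : falgType k) (S : hopf_structure H).
Local Notation sw := (sweedler S).
Local Notation A := (antipode S).
Local Notation eps := (counit S).
Implicit Types p q g c : dual S.

(** A commutator has trace zero in the regular representation, so g acts there with trace dim H;
    having finite order, it acts as the identity. *)
Lemma commutator_grouplike p q g : character g -> p * q - q * p = 1 - g -> g = 1.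
Proof.
move=> cg E; have e := @lin_ev _ _ S.
have [n [n0 gn]] := character_order cg.
have R1 : regmx g = 1%:M.
  apply: (@finite_order_trace k char0 n _ (regmx g) (fun i => regmx (g ^+ i))) => //.
  - exact: regmx1.
  - by move=> i; rewrite exprSr regmxM.
  - by rewrite gn regmx1.
  have := congr1 (fun p => \tr (regmx p)) E => /=.
  rewrite -!scaleN1r ![_ + _ *: _]addrC !lin_regmx regmx1 !regmxM !mxtraceD !mxtraceZ.
  rewrite mxtrace_mulC mulN1r addNr mxtrace1 mulN1r => /eqP.
  by rewrite addrC eq_sym subr_eq0 => /eqP.
apply: ev_inj => h; rewrite ev1.
have hE x : sw (fun x y => (ev g x : k) *: y) x = x.
  rewrite (dual_expand x) (linS (lin_swr _ _)); apply: eq_bigr => i _.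
  rewrite (linZ (lin_swr _ _)); congr (_ *: _); apply: cf_inj => j.
  by have /matrixP/(_ i j) := R1; rewrite !mxE cf_vb eq_sym.
rewrite -[in RHS](hE h) (@sw_map _ _ _ _ _ eps); last by lin.
transitivity (sw (fun x y => (eps y : k) *: ev g x) h); first by rewrite sw_epsr.
by apply: eq_sw => x y; rewrite linearZ /GRing.scale /= mulrC.
Qed.
End DualLemmas.

Section SkewPrimitive.
Variables (k : closedFieldType) (char0 : [pchar k] =i pred0) (H : falgType k) (S : hopf_structure H).
Local Notation sw := (sweedler S).
Local Notation A := (antipode S).
Local Notation eps := (counit S).
Implicit Types p q g c : dual S.

Variables g c : dual S.
Hypotheses (cg : character g) (gc : g * c = c * g).
Hypothesis cskew : forall x y, ev c (x * y) = (ev g x : k) * ev c y + (ev c x : k) * eps y.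

Lemma sw_scalel (X : lmodType k) (F : H -> H -> k^o) (w : X) x :
  sw (fun x1 x2 => (F x1 x2 : k) *: w) x = (sw F x : k) *: w.
Proof. by rewrite (@sw_map _ _ _ _ _ (fun z : k^o => (z : k) *: w)) //; lin. Qed.

(** Binomial theorem for Δ(c) = g ⊗ c + c ⊗ 1; ordinary binomial coefficients appear because c
    commutes with g. *)
Lemma skew_binomial j l x y : ev (c ^+ j * g ^+ l) (x * y) =
  \sum_(s < j.+1) 'C(j, s)%:R * ((ev (c ^+ (j - s) * g ^+ (s + l)) x : k) * ev (c ^+ s * g ^+ l) y).
Proof.
have e := @lin_ev _ _ S.
elim: j x y => [|j IH] x y.
  rewrite big_ord1 bin0 subnn add0n !expr0 !mul1r.
  by have [_ ->] := characterX l cg.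
rewrite exprS -mulrA evM swM; [|by lin..].
transitivity (\sum_(s < j.+1) ('C(j, s)%:R * ((ev (g * (c ^+ (j - s) * g ^+ (s + l))) x : k) * ev (c * (c ^+ s * g ^+ l)) y)
   + 'C(j, s)%:R * ((ev (c * (c ^+ (j - s) * g ^+ (s + l))) x : k) * ev (c ^+ s * g ^+ l) y))).
  pose b (s : 'I_j.+1) x1 x2 y1 y2 : k^o :=
    ('C(j, s)%:R : k) *: ((ev g x1 * ev (c ^+ (j - s) * g ^+ (s + l)) x2 : k) *: (ev c y1 * ev (c ^+ s * g ^+ l) y2 : k^o))
   + ('C(j, s)%:R : k) *: ((ev c x1 * ev (c ^+ (j - s) * g ^+ (s + l)) x2 : k) *: (eps y1 * ev (c ^+ s * g ^+ l) y2 : k^o)).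
  transitivity (sw (fun x1 x2 => sw (fun y1 y2 => \sum_s b s x1 x2 y1 y2) y) x).
    apply: eq_sw => x1 x2; apply: eq_sw => y1 y2.
    rewrite IH cskew scaler_sumr; apply: eq_bigr => s _.
    by rewrite /b /GRing.scale /=; ring.
  under eq_sw do rewrite sw_sumb.
  rewrite sw_sumb; apply: eq_bigr => s _.
  have swD (b1 b2 : H -> H -> k^o) h : sw (fun u v => b1 u v + b2 u v) h = sw b1 h + sw b2 h.
    rewrite /sweedler /tlift -big_split; apply: eq_bigr => i _; rewrite -big_split.
    by apply: eq_bigr => i' _; rewrite scalerDr.
  have swZ (a : k) (b1 : H -> H -> k^o) h : sw (fun u v => a *: b1 u v) h = a *: sw b1 h.
    by rewrite (@sw_map _ _ _ _ _ (fun z : k^o => a *: z)) //; lin.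
  rewrite /b; under eq_sw do rewrite swD !swZ.
  rewrite swD !swZ.
  rewrite !(@sw_scalel _ (fun x1 x2 => ev _ x1 * ev _ x2)).
  by rewrite (evM g) !(evM c) /= sw_epsl //; apply: e.
pose P s : k := (ev (c ^+ (j.+1 - s) * g ^+ (s + l)) x : k) * ev (c ^+ s * g ^+ l) y.
transitivity (\sum_(s < j.+1) 'C(j, s)%:R * P s.+1 + \sum_(s < j.+1) 'C(j, s)%:R * P s).
  rewrite big_split; congr (_ + _); apply: eq_bigr => s _; rewrite /P.
    have -> : g * (c ^+ (j - s) * g ^+ (s + l)) = c ^+ (j - s) * g ^+ (s.+1 + l).
      by rewrite mulrA (commrX _ gc) -mulrA addSn exprS.
    by rewrite subSS [c ^+ s.+1]exprS -mulrA.
  have sj : (s <= j)%N by rewrite -ltnS.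
  by rewrite subSn // [c ^+ _.+1]exprS -mulrA.
rewrite big_ord_recr /= [RHS]big_ord_recl /= bin0 -/(P 0).
rewrite [X in _ + X = _]big_ord_recl /= bin0 binn.
rewrite [X in _ = _ + X]big_ord_recr /= binn.
have -> : \sum_(i < j) 'C(j.+1, bump 0 i)%:R * P (bump 0 i)
   = \sum_(i < j) 'C(j, i)%:R * P i.+1 + \sum_(i < j) 'C(j, bump 0 i)%:R * P (bump 0 i).
  rewrite -big_split; apply: eq_bigr => i _; rewrite /= -mulrDl -natrD.
  by rewrite /bump /= add1n binS addnC.
by rewrite -/(P _); ring.
Qed.

(** If c lies in the span of the powers of g then c(xy) = c(yx), and the skew Leibniz rule gives (g
    - ε)(x) c(y) = (g - ε)(y) c(x), so c is proportional to g - 1. Otherwise all powers of c would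
    be linearly independent in a finite dimensional space. *)
Lemma skew_primitive_group_span : exists kap : k, c = kap *: (g - 1).
Proof.
have e := @lin_ev _ _ S.
have [n [n0 gn]] := character_order cg.
pose gs := [seq g ^+ i | i <- iota 0 n].
pose U : {vspace (dual S)} := <<gs>>%VS.
have gU l : g ^+ l \in U.
  apply/memv_span/mapP; exists (l %% n)%N; first by rewrite mem_iota add0n ltn_pmod.
  by rewrite {1}(divn_eq l n) exprD mulnC exprM gn expr1n mul1r.
have Uexp u : u \in U -> exists (N : nat) (a : 'I_N -> k) (m : 'I_N -> nat), u = \sum_i a i *: g ^+ (m i).
  move=> uU; exists (size gs), (fun i => coord (in_tuple gs) i u), (fun i => i : nat).
  rewrite {1}(coord_span (X := in_tuple gs) uU); apply: eq_bigr => i _; congr (_ *: _).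
  have i_n : (i < n)%N by apply: leq_trans (ltn_ord i) _; rewrite size_map size_iota.
  by rewrite (nth_map 0%N) ?nth_iota // size_iota.
have evU N (a : 'I_N -> k) (m : 'I_N -> nat) h : ev (\sum_i a i *: g ^+ (m i)) h = \sum_i a i * ev (g ^+ m i) h.
  by etransitivity; [exact: (linS (lin_evl h)) | apply: eq_bigr => i _; rewrite evZ].
have c1 : ev c 1 = 0.
  have := cskew 1 1; have [-> _] := cg; rewrite counit1 !mul1r !mulr1 => /eqP.
  by rewrite -subr_eq0 opprD addrA subrr sub0r oppr_eq0 => /eqP.
have [cU|cU] := boolP (c \in U).
  have [N [a [m Ec]]] := Uexp c cU.
  have [g1|g1] := eqVneq g 1.
    exists 0; rewrite scale0r; apply: ev_inj => h; rewrite ev0.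
    transitivity (ev c 1 * eps h); last by rewrite c1 mul0r.
    rewrite Ec !evU mulr_suml; apply: eq_bigr => i _.
    by rewrite g1 expr1n !ev1 counit1 mulr1.
  have [y gy] : exists y, ev g y != eps y.
    apply: boolp.contrapT => hn; move/eqP: g1; apply; apply: ev_inj => y; rewrite ev1.
    by apply/eqP/negPn/negP => h; apply: hn; exists y.
  exists (ev c y / (ev g y - eps y)); apply: ev_inj => x.
  rewrite evZ evD evN ev1 mulrAC; apply: (canRL (mulfK _)); first by rewrite subr_eq0.
  have : ev c (x * y) = ev c (y * x).
    rewrite Ec !evU; apply: eq_bigr => i _; congr (_ * _).
    by have [_ gM] := characterX (m i) cg; rewrite !gM mulrC.
  rewrite !cskew => E; apply/eqP; rewrite -subr_eq0.
  move/eqP: E; rewrite -subr_eq0 => /eqP E; rewrite -[X in _ == X]oppr0 -E.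
  by apply/eqP; ring.
exfalso.
have cgU l : c * g ^+ l \notin U.
  apply: contra cU => /Uexp[N [a [m E]]].
  have gl : g ^+ l * g ^+ (l * n.-1) = 1.
    by rewrite -exprD -mulnS prednK // mulnC exprM gn expr1n.
  rewrite -[c]mulr1 -gl mulrA E mulr_suml; apply: memv_suml => i _.
  by rewrite -scalerAl -exprD memvZ.
have sep l : exists h, (forall u, u \in U -> ev u h = 0) /\ ev (c * g ^+ l) h = 1 by apply: dual_sep.
(* The product x h isolates one binomial term: s = 0 dies on h, which annihilates the span of the
   powers of g, and s > 1 dies on x. The term s = 1 survives with coefficient i + 1, nonzero in
   characteristic zero. *)
have main i l : exists x, (forall j m, (j < i)%N -> ev (c ^+ j * g ^+ m) x = 0) /\ ev (c ^+ i * g ^+ l) x != 0.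
  elim: i l => [|i IH] l.
    exists 1; split=> //; rewrite expr0 mul1r; have [-> _] := characterX l cg; exact: oner_neq0.
  have [x [x0 x1]] := IH l.+1; have [h [hU h1]] := sep l.
  have z0 m : ev (c ^+ 0 * g ^+ m) h = 0 by rewrite expr0 mul1r hU.
  exists (x * h); split=> [j m ji|].
    rewrite skew_binomial big1 // => s _; have := ltn_ord s.
    case: (s : nat) => [|s'] sj; first by rewrite z0 !mulr0.
    by rewrite x0 ?mul0r ?mulr0 //; lia.
  rewrite skew_binomial (bigD1 (Ordinal (isT : (1 < i.+2)%N))) //= big1 => [|s s1].
    by rewrite addr0 bin1 subn1 /= expr1 h1 mulr1 add1n mulf_neq0 // natr_neq0.
  have := ltn_ord s; move: s1; rewrite -val_eqE /=.
  case: (s : nat) => [|[|s']] // s1 si; first by rewrite z0 !mulr0.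
  by rewrite x0 ?mul0r ?mulr0 //; lia.
pose X n := rev (mkseq (fun i => c ^+ i) n).
have XS m : X m.+1 = c ^+ m :: X m by rewrite /X /mkseq -addn1 iotaD map_cat rev_cat.
have fX m : free (X m).
  elim: m => [|m IH]; first by rewrite nil_free.
  rewrite XS free_cons IH andbT; apply/negP => cX.
  have [x [x0]] := main m 0%N; rewrite expr0 mulr1.
  rewrite (coord_span (X := in_tuple (X m)) cX).
  have -> : ev (\sum_i coord (in_tuple (X m)) i (c ^+ m) *: (in_tuple (X m))`_i) x = 0; last by rewrite eqxx.
  etransitivity; first exact: (linS (lin_evl x)).
  rewrite big1 // => i _; rewrite (linZ (lin_evl x)).
  have : (in_tuple (X m))`_i \in X m by apply: mem_nth.
  rewrite mem_rev => /mapP[j]; rewrite mem_iota add0n => jm ->.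
  by have := x0 j 0%N jm; rewrite expr0 mulr1 => ->; rewrite scaler0.
have := fX (\dim {:dual S}).+1; rewrite /free => /eqP E.
by have := dimvS (subvf <<X (\dim {:dual S}).+1>>%VS); rewrite E size_rev size_mkseq ltnn.
Qed.
End SkewPrimitive.

Section Primitive.
Variables (k : closedFieldType) (char0 : [pchar k] =i pred0) (H : falgType k) (S : hopf_structure H).

Lemma primitive_eq0 (c : dual S) :
  (forall x y, ev c (x * y) = (counit S x : k) * ev c y + (ev c x : k) * counit S y) -> c = 0.
Proof.
move=> cP; have [||x y|kap ->] := @skew_primitive_group_span k char0 H S 1 c.
- exact: character1.
- by rewrite mul1r mulr1.
- by rewrite cP ev1.
by rewrite subrr scaler0.
Qed.
End Primitive.

(** * Inner-faithful module algebras *)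

(** A subspace inside U of maximal dimension: stage n either reaches dimension n or already exhausts
    U, and n above dim V is impossible. *)
Lemma subspace_vspace (k : fieldType) (V : vectType k) (U : V -> Prop) : subspace U ->
  exists W : {vspace V}, forall x, x \in W <-> U x.
Proof.
case=> U0 UL.
have h n : exists W : {vspace V}, (forall x, x \in W -> U x) /\
    ((n <= \dim W)%N \/ forall x, U x -> x \in W).
  elim: n => [|n [W [WU [nW|UW]]]].
  - by exists 0%VS; split; [move=> x; rewrite memv0 => /eqP -> | left].
  - have [UW|/boolp.existsNP[x /boolp.not_implyP[Ux xW]]] := boolp.EM (forall x, U x -> x \in W).
      by exists W; split=> //; right.
    exists (W + <[x]>)%VS; split.
      move=> _ /memv_addP[w wW [_ /vlineP[a ->] ->]].
      by rewrite addrC; apply: UL => //; apply: WU.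
    left; apply: leq_ltn_trans nW _.
    rewrite ltnNge (geq_leqif (dimv_leqif_sup (addvSl W <[x]>))) subv_add subvv /=.
    by apply/negP => /subvP/(_ x (memv_line x)).
  - by exists W; split=> //; right.
have [W [WU [dW|UW]]] := h (\dim {:V}).+1.
  by have := leq_trans dW (dimvS (subvf W)); rewrite ltnn.
by exists W => x; split; [apply: WU | apply: UW].
Qed.

Section TensorSpan.
Variables (k : fieldType) (V W : vectType k).

Lemma tens_tensv (U1 : {vspace V}) (U2 : {vspace W}) x y :
  x \in U1 -> y \in U2 -> tens x y \in tensv U1 U2.
Proof.
move=> xU yU; rewrite (coord_vbasis xU) (linS (lin_tensl y)); apply: memv_suml => i _.
rewrite (linZ (lin_tensl y)) memvZ // (coord_vbasis yU) (linS (lin_tensr _)); apply: memv_suml => j _.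
rewrite (linZ (lin_tensr _)) memvZ // memv_span //; apply/allpairsP.
exists ((vbasis U1)`_i, (vbasis U2)`_j); split=> //; apply: mem_nth; rewrite size_tuple //.
Qed.

Lemma tlift_tensv0 (X : lmodType k) (b : V -> W -> X) (U1 : {vspace V}) (U2 : {vspace W}) t :
  (forall y, lin (fun x => b x y)) -> (forall x, lin (b x)) ->
  (forall x y, x \in U1 -> y \in U2 -> b x y = 0) -> t \in tensv U1 U2 -> tlift b t = 0.
Proof.
move=> b1 b2 b0 /(@coord_span _ _ _ (in_tuple _)) ->.
rewrite (linS (lin_tliftr b)) big1 // => i _; rewrite (linZ (lin_tliftr b)).
have : (in_tuple [seq tens x y | x <- vbasis U1, y <- vbasis U2])`_i \in
  [seq tens x y | x <- vbasis U1, y <- vbasis U2] by apply: mem_nth.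
case/allpairsP => -[x y] /= [xU yU ->].
by rewrite tlift_tens // b0 ?scaler0 // vbasis_mem.
Qed.
End TensorSpan.

Section InnerFaithful.
Variables (k : fieldType) (H : falgType k) (S : hopf_structure H).
Local Notation sw := (sweedler S).
Local Notation A := (antipode S).
Local Notation eps := (counit S).
Variables (R : algType k) (act : H -> R -> R).
Hypothesis MA : module_algebra S act.

Lemma lin_actl x : lin (fun h => act h x).
Proof. by move=> a g h; case: MA => [[_ E] _ _ _]; apply: E. Qed.
Lemma lin_actr h : lin (act h).
Proof. by move=> a x y; case: MA => [[E _] _ _ _]; apply: E. Qed.
Lemma mact1 x : act 1 x = x. Proof. by case: MA => _ []. Qed.
Lemma mactM g h x : act (g * h) x = act g (act h x). Proof. by case: MA => _ []. Qed.
Lemma mact_one h : act h 1 = (eps h : k)%:A. Proof. by case: MA. Qed.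
Lemma mact_mul h x y : act h (x * y) = sw (fun h1 h2 => act h1 x * act h2 y) h.
Proof. by case: MA. Qed.

Hypothesis IF : inner_faithful S act.

(** Generation as an algebra, phrased as induction on words that grow by one generator on the
    right. *)
Definition generates (B : R -> Prop) : Prop := forall P : R -> Prop, P 1 ->
  (forall a x y, P x -> P y -> P (a *: x + y)) -> (forall x b, P x -> B b -> P (x * b)) -> forall x, P x.

Variable B : R -> Prop.
Hypothesis genB : generates B.

(** The common kernel I of the functionals in P is a Hopf ideal: each closure property of P dualises
    to one clause. Elements of I kill the generators, hence all of R, so inner-faithfulness forces I
    = 0, and by duality P is everything. *)
Lemma dual_generated (P : dual S -> Prop) : P 1 -> (forall a p q, P p -> P q -> P (a *: p + q)) ->
  (forall p q, P p -> P q -> P (p * q)) -> (forall p, P p -> P (SK p)) ->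
  (forall h, (forall p, P p -> ev p h = 0) -> forall b, B b -> act h b = 0) ->
  (forall p, P p -> forall h, P (dual_of S (fun x => ev p (h * x))) /\ P (dual_of S (fun x => ev p (x * h)))) ->
  forall p, P p.
Proof.
move=> P1 PL PM PS PB PH.
have e := @lin_ev _ _ S.
have P0 : P 0 by rewrite -(addNr (1 : dual S)) -scaleN1r; apply: PL.
have [GV GVE] := @subspace_vspace _ (dual S) P (conj P0 PL).
have [I IE] : exists I : {vspace H}, forall h, h \in I <-> forall p, P p -> ev p h = 0.
  apply: subspace_vspace; split=> [p _|a x y hx hy p Pp]; first exact: lin0 (e p).
  by rewrite (e p) hx // hy // scaler0 addr0.
have dualI p : (forall h, h \in I -> ev p h = 0) -> P p.
  move=> hp; apply/GVE; apply: contraT => /dual_sep[h [hU h1]].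
  have hI : h \in I by apply/IE => q /GVE; apply: hU.
  by move: h1; rewrite hp // => /esym/eqP; rewrite oner_eq0.
(* Projections onto I and onto a complement. Modulo I ⊗ H + H ⊗ I the coproduct of x equals its
   image under π ⊗ π, whose coordinates are products of functionals vanishing on I; such products
   lie in P, so they vanish at x. *)
pose kap := daddv_pi I I^C; pose pi := daddv_pi I^C I.
have kI x : kap x \in I by apply: memv_pi.
have kpE x : x = pi x + kap x.
  rewrite [RHS]addrC /kap /pi daddv_pi_add ?capv_compl //; first by rewrite addv_complf memvf.
have pi0 x : x \in I -> pi x = 0.
  move=> xI; have := kpE x; rewrite /kap daddv_pi_id ?capv_compl // => E.
  by apply: (@addIr _ x); rewrite add0r -E.
have tens_dec y z : tens y z = tens (pi y) (pi z) + (tens (kap y) z + tens (pi y) (kap z)) :> tensor H H.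
  rewrite {1}(kpE y) (linD (lin_tensl z)) {1}(kpE z) (linD (lin_tensr _)).
  by rewrite -addrA [X in _ + X]addrC.
have IC x : x \in I -> comul S x \in (tensv I {:H} + tensv {:H} I)%VS.
  move=> /IE xI.
  have -> : comul S x = sw (fun y z => tens (kap y) z + tens (pi y) (kap z)) x.
    rewrite -{1}[comul S x]tlift_tensK -[LHS]/(sw (fun y z => tens y z) x).
    have -> : sw (fun y z => tens y z) x = sw (fun y z => tens (pi y) (pi z) : tensor H H) x
      + sw (fun y z => tens (kap y) z + tens (pi y) (kap z)) x.
      rewrite /sweedler /tlift -big_split; apply: eq_bigr => i _; rewrite -big_split.
      by apply: eq_bigr => j _; rewrite {1}tens_dec scalerDr.
    rewrite [X in X + _](_ : _ = 0) ?add0r //; apply/matrixP => i j; rewrite [RHS]mxE.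
    pose p i : dual S := dual_of S (fun x => cf i (pi x)).
    have pE i' y : ev (p i') y = cf i' (pi y) by rewrite dual_ofE //; lin.
    have Pp i' : P (p i') by apply: dualI => h hI; rewrite pE pi0 ?linear0.
    transitivity (ev (p i * p j) x); last by apply: xI; apply: PM.
    rewrite evM /sweedler /tlift summxE; apply: eq_bigr => i' _; rewrite summxE; apply: eq_bigr => j' _.
    by rewrite !mxE !pE !cfE.
  rewrite /sweedler /tlift; apply: memv_suml => i _; apply: memv_suml => j _; apply: memvZ.
  by apply: memv_add; apply: tens_tensv; rewrite ?memvf.
have HI : hopf_ideal S I.
  split=> [x h xI|x xI|x xI|x xI].
  - split; apply/IE => p Pp; have [P1' P2'] := PH p Pp h.
      by move/IE: xI => /(_ _ P1'); rewrite dual_ofE //; lin.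
    by move/IE: xI => /(_ _ P2'); rewrite dual_ofE //; lin.
  - exact: IC.
  - by rewrite -ev1; move/IE: xI; apply.
  by apply/IE => p Pp; rewrite -SKE; move/IE: xI; apply; apply: PS.
have act0 : forall x h, h \in I -> act h x = 0.
  move=> x; pattern x; apply: genB => {x} [h hI|a x y hx hy h hI|x b hx Bb h hI].
  - by rewrite mact_one -ev1; move/IE: hI => ->; rewrite ?scale0r.
  - by rewrite lin_actr hx // hy // scaler0 addr0.
  have hb g : g \in I -> act g b = 0 by move/IE => gI; apply: PB.
  have l1 g : lin (fun h => act h x * act g b) by apply: lin_mulr; apply: lin_actl.
  have l2 g : lin (fun h => act g x * act h b) by apply: lin_mull; apply: lin_actl.
  rewrite mact_mul; have /memv_addP[t1 t1I [t2 t2I E]] := IC h hI.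
  rewrite /sweedler E (linD (lin_tliftr _)).
  rewrite (tlift_tensv0 l1 l2 _ t1I) ?(tlift_tensv0 l1 l2 _ t2I) ?addr0 // => g g' gI g'I.
    by rewrite hb // mulr0.
  by rewrite hx // mul0r.
have I0 : I == 0%VS.
  apply: contraT => In0; have [h [x [hI]]] := IF HI In0; by rewrite act0.
move=> p; apply: dualI => h; rewrite (eqP I0) memv0 => /eqP ->; exact: lin0 (e p).
Qed.
End InnerFaithful.

(** * Actions on algebras with one quadratic relation *)

Lemma eq_of_subr (V : zmodType) (x y z w : V) : x = y -> z - w = x - y -> z = w.
Proof. by move=> ->; rewrite subrr => /subr0_eq. Qed.

Opaque conv dual1 dual_of ev.

(* Generalizing products keeps unification from unfolding the convolution product. *)
Ltac gen_mul S := repeat match goal with |- context [?x * ?y] =>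
  lazymatch type of x with dual S => generalize (x * y); intro end end.

Section Coproducts.
Variables (k : closedFieldType) (H : falgType k) (S : hopf_structure H).
Local Notation sw := (sweedler S).
Local Notation A := (antipode S).
Local Notation eps := (counit S).
Implicit Types p q : dual S.

Lemma antipode_coef p p1 p1' p2 p2' p3 p3' :
  (forall x y, ev p (x * y) = (ev p1 x : k) * ev p1' y + (ev p2 x : k) * ev p2' y + (ev p3 x : k) * ev p3' y) ->
  SK p1 * p1' + SK p2 * p2' + SK p3 * p3' = (ev p 1 : k) *: 1 /\
  p1 * SK p1' + p2 * SK p2' + p3 * SK p3' = (ev p 1 : k) *: 1.
Proof.
move=> hp; have e := @lin_ev _ _ S.
have swD (b1 b2 : H -> H -> k^o) h : sw b1 h + sw b2 h = sw (fun x y => b1 x y + b2 x y) h.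
  rewrite /sweedler /tlift -big_split; apply: eq_bigr => i _; rewrite -big_split.
  by apply: eq_bigr => j _; rewrite scalerDr.
split; apply: ev_inj => h; rewrite 2!evD evZ ev1 3!evM !swD.
  transitivity (sw (fun x y => ev p (A x * y)) h).
    by apply: eq_sw => x y; rewrite hp !SKE.
  by rewrite (@sw_Sl _ _ _ _ (ev p)) // mulrC.
transitivity (sw (fun x y => ev p (x * A y)) h).
  by apply: eq_sw => x y; rewrite hp !SKE.
by rewrite (@sw_Sr _ _ _ _ (ev p)) // mulrC.
Qed.

Lemma ev_mul_mul p p1 p1' p2 p2' q q1 q1' q2 q2' x y :
  (forall x y, ev p (x * y) = (ev p1 x : k) * ev p1' y + (ev p2 x : k) * ev p2' y) ->
  (forall x y, ev q (x * y) = (ev q1 x : k) * ev q1' y + (ev q2 x : k) * ev q2' y) ->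
  ev (p * q) (x * y) = (ev (p1 * q1) x : k) * ev (p1' * q1') y + (ev (p1 * q2) x : k) * ev (p1' * q2') y
    + (ev (p2 * q1) x : k) * ev (p2' * q1') y + (ev (p2 * q2) x : k) * ev (p2' * q2') y.
Proof.
move=> hp hq; have e := @lin_ev _ _ S.
have swD (b1 b2 : H -> H -> k^o) h : sw b1 h + sw b2 h = sw (fun x y => b1 x y + b2 x y) h.
  rewrite /sweedler /tlift -big_split; apply: eq_bigr => i _; rewrite -big_split.
  by apply: eq_bigr => j _; rewrite scalerDr.
have swP (r r' s s' : dual S) : (ev (r * s) x : k) * ev (r' * s') y =
    sw (fun x1 x2 => sw (fun y1 y2 => (ev r x1 * ev s x2) * (ev r' y1 * ev s' y2) : k^o) y) x :> k^o.
  rewrite !evM; set Y := sw _ y.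
  rewrite -[LHS]/((sw (fun x1 x2 => ev r x1 *: ev s x2 : k^o) x : k) *: (Y : k^o)).
  rewrite (@sw_map _ _ _ _ _ (fun z : k^o => (z : k) *: Y)); last by lin.
  apply: eq_sw => x1 x2; rewrite /Y (@sw_map _ _ _ _ _ (fun z : k^o => ((ev r x1 *: ev s x2 : k^o) : k) *: z)) //; lin.
rewrite !swP !swD evM swM; [|by lin..].
apply: eq_sw => x1 x2; rewrite !swD; apply: eq_sw => y1 y2.
by rewrite hp hq /GRing.scale /=; ring.
Qed.
End Coproducts.

(** * Coefficients of the action and the identities between them *)

Section Core.
Variables (k : closedFieldType) (char0 : [pchar k] =i pred0) (H : falgType k) (S : hopf_structure H).
Local Notation sw := (sweedler S).
Local Notation A := (antipode S).
Local Notation eps := (counit S).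
Variables (R : algType k) (act : H -> R -> R) (MA : module_algebra S act) (IF : inner_faithful S act).
Variables (u v : R) (q t al be ga : k).
Hypothesis q0 : q != 0.
Hypothesis rel : v * u = q *: (u * v) + t *: (u * u) + al *: u + be *: v + ga%:A.

(** Normally ordered expressions of degree at most two. By [rel] every product of two generators has
    this shape, and [ind] makes the shape unique. *)
Definition comb (c1 c2 c3 c4 c5 c6 : k) : R :=
  c1 *: (u * u) + c2 *: (u * v) + c3 *: (v * v) + c4 *: u + c5 *: v + c6%:A.

Hypothesis ind : forall c1 c2 c3 c4 c5 c6, comb c1 c2 c3 c4 c5 c6 = 0 ->
  [/\ c1 = 0, c2 = 0, c3 = 0, c4 = 0 & c5 = 0 /\ c6 = 0].
Hypothesis gen : generates (fun x => x = u \/ x = v).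

Variables a b c d e f : dual S.
Hypothesis actu : forall h, act h u = (ev a h : k) *: u + (ev b h : k) *: v + (ev e h : k)%:A.
Hypothesis actv : forall h, act h v = (ev c h : k) *: u + (ev d h : k) *: v + (ev f h : k)%:A.

Lemma combD c1 c2 c3 c4 c5 c6 d1 d2 d3 d4 d5 d6 :
  comb c1 c2 c3 c4 c5 c6 + comb d1 d2 d3 d4 d5 d6 =
  comb (c1 + d1) (c2 + d2) (c3 + d3) (c4 + d4) (c5 + d5) (c6 + d6).
Proof. by rewrite /comb !scalerDl; do 5 (rewrite addrACA; congr (_ + _)). Qed.
Lemma combZ x c1 c2 c3 c4 c5 c6 :
  x *: comb c1 c2 c3 c4 c5 c6 = comb (x * c1) (x * c2) (x * c3) (x * c4) (x * c5) (x * c6).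
Proof. by rewrite /comb !scalerDr !scalerA. Qed.
Lemma comb_inj c1 c2 c3 c4 c5 c6 d1 d2 d3 d4 d5 d6 :
  comb c1 c2 c3 c4 c5 c6 = comb d1 d2 d3 d4 d5 d6 ->
  [/\ c1 = d1, c2 = d2, c3 = d3, c4 = d4 & c5 = d5 /\ c6 = d6].
Proof.
move=> E; have : comb (c1 - d1) (c2 - d2) (c3 - d3) (c4 - d4) (c5 - d5) (c6 - d6) = 0.
  rewrite -[RHS](subrr (comb d1 d2 d3 d4 d5 d6)) -{1}E -scaleN1r combZ combD.
  by rewrite !mulN1r.
by move/ind => [/subr0_eq -> /subr0_eq -> /subr0_eq -> /subr0_eq -> [/subr0_eq -> /subr0_eq ->]].
Qed.

Let combE : [/\ forall x, x *: (u * u) = comb x 0 0 0 0 0, forall x, x *: (u * v) = comb 0 x 0 0 0 0,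
  forall x, x *: (v * v) = comb 0 0 x 0 0 0 & [/\ forall x, x *: (v * u) = comb (x * t) (x * q) 0 (x * al) (x * be) (x * ga),
  forall x, x *: u = comb 0 0 0 x 0 0, forall x, x *: v = comb 0 0 0 0 x 0 & forall x, x%:A = comb 0 0 0 0 0 x]].
Proof.
by split; last split; move=> x; rewrite /comb ?scale0r ?add0r ?addr0 // rel !scalerDr !scalerA
  [X in X + _ + _ + _ = _]addrC.
Qed.

Lemma act_prod x y (p1 p2 p3 q1 q2 q3 : dual S) h :
  (forall h, act h x = (ev p1 h : k) *: u + (ev p2 h : k) *: v + (ev p3 h : k)%:A) ->
  (forall h, act h y = (ev q1 h : k) *: u + (ev q2 h : k) *: v + (ev q3 h : k)%:A) ->
  act h (x * y) = (ev (p1 * q1) h : k) *: (u * u) + (ev (p1 * q2) h : k) *: (u * v)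
    + (ev (p2 * q1) h : k) *: (v * u) + (ev (p2 * q2) h : k) *: (v * v)
    + (ev (p1 * q3 + p3 * q1) h : k) *: u + (ev (p2 * q3 + p3 * q2) h : k) *: v + (ev (p3 * q3) h : k)%:A.
Proof.
move=> hx hy; rewrite (mact_mul MA).
have sws (p p' : dual S) (w : R) : (ev (p * p') h : k) *: w = sw (fun h1 h2 => (ev p h1 * ev p' h2 : k) *: w) h.
  by rewrite evM (@sw_map _ _ _ _ _ (fun z : k^o => (z : k) *: w)) //; lin.
have swD (b1 b2 : H -> H -> R) : sw b1 h + sw b2 h = sw (fun x y => b1 x y + b2 x y) h.
  rewrite /sweedler /tlift -big_split; apply: eq_bigr => i _; rewrite -big_split.
  by apply: eq_bigr => j _; rewrite scalerDr.
rewrite !evD !scalerDl !sws !swD; apply: eq_sw => h1 h2; rewrite hx hy.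
rewrite !mulrDl !mulrDr -!scalerAl -!scalerAr !mul1r ?mulr1 !scalerA.
by rewrite [LHS](+%R.[AC (3*3*3) (1*2*4*5*(3*7)*(6*8)*9)]).
Qed.

Lemma lin3_inj x1 x2 x3 y1 y2 y3 : x1 *: u + x2 *: v + x3%:A = y1 *: u + y2 *: v + y3%:A ->
  [/\ x1 = y1, x2 = y2 & x3 = y3].
Proof.
have [_ _ _ [_ cu cv c1]] := combE.
rewrite !cu !cv !c1 !combD !add0r !addr0 => /comb_inj[_ _ _ -> [-> ->]] //.
Qed.

Let coef_mul x y :
  [/\ ev a (x * y) = (ev a x : k) * ev a y + (ev c x : k) * ev b y,
      ev b (x * y) = (ev b x : k) * ev a y + (ev d x : k) * ev b y &
      ev e (x * y) = (ev e x : k) * ev a y + (ev f x : k) * ev b y + (eps x : k) * ev e y] /\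
  [/\ ev c (x * y) = (ev a x : k) * ev c y + (ev c x : k) * ev d y,
      ev d (x * y) = (ev b x : k) * ev c y + (ev d x : k) * ev d y &
      ev f (x * y) = (ev e x : k) * ev c y + (ev f x : k) * ev d y + (eps x : k) * ev f y].
Proof.
have E w y1 y2 y3 : act x (y1 *: u + y2 *: v + y3%:A) = w ->
    w = ((ev a x : k) * y1 + (ev c x : k) * y2) *: u + ((ev b x : k) * y1 + (ev d x : k) * y2) *: v
      + ((ev e x : k) * y1 + (ev f x : k) * y2 + (eps x : k) * y3)%:A.
  move=> <-; have la := @lin_actr _ _ _ _ _ MA x.
  rewrite !(linD la) !(linZ la) actu actv (mact_one MA) !scalerDr !scalerA !scalerDl.
  rewrite [LHS](+%R.[AC (3*3*1) ((1*4)*(2*5)*(3*6*7))]) !addrA.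
  by rewrite ![y1 * _]mulrC ![y2 * _]mulrC ![y3 * _]mulrC.
split.
  have := actu (x * y); rewrite (mactM MA) actu => /E/lin3_inj[-> -> ->] //.
have := actv (x * y); rewrite (mactM MA) actv => /E/lin3_inj[-> -> ->] //.
Qed.

Lemma a_mul x y : ev a (x * y) = (ev a x : k) * ev a y + (ev c x : k) * ev b y.
Proof. by case: (coef_mul x y) => [[]]. Qed.
Lemma b_mul x y : ev b (x * y) = (ev b x : k) * ev a y + (ev d x : k) * ev b y.
Proof. by case: (coef_mul x y) => [[]]. Qed.
Lemma c_mul x y : ev c (x * y) = (ev a x : k) * ev c y + (ev c x : k) * ev d y.
Proof. by case: (coef_mul x y) => _ []. Qed.
Lemma d_mul x y : ev d (x * y) = (ev b x : k) * ev c y + (ev d x : k) * ev d y.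
Proof. by case: (coef_mul x y) => _ []. Qed.
Lemma e_mul x y : ev e (x * y) = (ev e x : k) * ev a y + (ev f x : k) * ev b y + (eps x : k) * ev e y.
Proof. by case: (coef_mul x y) => [[]]. Qed.
Lemma f_mul x y : ev f (x * y) = (ev e x : k) * ev c y + (ev f x : k) * ev d y + (eps x : k) * ev f y.
Proof. by case: (coef_mul x y) => _ []. Qed.

Lemma coefs_at_one : [/\ ev a 1 = 1, ev b 1 = 0 & ev e 1 = 0] /\ [/\ ev c 1 = 0, ev d 1 = 1 & ev f 1 = 0].
Proof.
split.
  have := actu 1; rewrite (mact1 MA) -[X in X = _](_ : 1 *: u + 0 *: v + 0%:A = u).
    by move/lin3_inj => [<- <- <-].
  by rewrite scale1r !scale0r !addr0.
have := actv 1; rewrite (mact1 MA) -[X in X = _](_ : 0 *: u + 1 *: v + 0%:A = v).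
  by move/lin3_inj => [<- <- <-].
by rewrite scale1r !scale0r add0r addr0.
Qed.

(* The relation r spans an H-stable line in the free algebra; g is the character by which H acts on it. *)
Definition hdet : dual S := d * a - q *: (b * c) - t *: (b * a).
Local Notation g := hdet.

(** Comparison of coefficients with all functionals replaced by scalars, so that [ring] applies. The
    coefficient of vu does not yield an identity: it serves to define z, the value of [hdet]. *)
Let relation_coefs (ca cb da db U V W ac ad bc bd U' V' W' aa ab ba bb U'' V'' W'' ea eb ee ec ed ef ep : k) :
  ca *: (u * u) + cb *: (u * v) + da *: (v * u) + db *: (v * v) + U *: u + V *: v + W%:A =
  q *: (ac *: (u * u) + ad *: (u * v) + bc *: (v * u) + bd *: (v * v) + U' *: u + V' *: v + W'%:A)
  + t *: (aa *: (u * u) + ab *: (u * v) + ba *: (v * u) + bb *: (v * v) + U'' *: u + V'' *: v + W''%:A)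
  + al *: (ea *: u + eb *: v + ee%:A) + be *: (ec *: u + ed *: v + ef%:A) + ga *: ep%:A ->
  let z := da - q * bc - t * ba in
  [/\ ca = q * ac + t * aa - t * z, cb = q * ad + t * ab - q * z, db = q * bd + t * bb,
      U = q * U' + t * U'' + al * ea + be * ec - al * z &
      V = q * V' + t * V'' + al * eb + be * ed - be * z /\
      W = q * W' + t * W'' + al * ee + be * ef + ga * ep - ga * z].
Proof.
have [cuu cuv cvv [cvu cu cv c1]] := combE.
rewrite !cuu !cuv !cvv !cvu !cu !cv !c1 !combD !combZ !combD => /comb_inj[E1 E2 E3 E4 [E5 E6]] z.
by split; last split; [apply: (eq_of_subr E1)|apply: (eq_of_subr E2)|apply: (eq_of_subr E3)
  |apply: (eq_of_subr E4)|apply: (eq_of_subr E5)|apply: (eq_of_subr E6)]; rewrite /z; ring.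
Qed.

Lemma relations :
  [/\ c * a = q *: (a * c) + t *: (a * a) - t *: g,
      c * b = q *: (a * d) + t *: (a * b) - q *: g &
      d * b = q *: (b * d) + t *: (b * b)] /\
  [/\ c * e + f * a = q *: (a * f + e * c) + t *: (a * e + e * a) + al *: a + be *: c - al *: g,
      d * e + f * b = q *: (b * f + e * d) + t *: (b * e + e * b) + al *: b + be *: d - be *: g &
      f * e = q *: (e * f) + t *: (e * e) + al *: e + be *: f + ga *: 1 - ga *: g].
Proof.
have E h : [/\ [/\ ev (c * a) h = ev (q *: (a * c) + t *: (a * a) - t *: g) h,
      ev (c * b) h = ev (q *: (a * d) + t *: (a * b) - q *: g) h &
      ev (d * b) h = ev (q *: (b * d) + t *: (b * b)) h],
      ev (c * e + f * a) h = ev (q *: (a * f + e * c) + t *: (a * e + e * a) + al *: a + be *: c - al *: g) h,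
      ev (d * e + f * b) h = ev (q *: (b * f + e * d) + t *: (b * e + e * b) + al *: b + be *: d - be *: g) h &
      ev (f * e) h = ev (q *: (e * f) + t *: (e * e) + al *: e + be *: f + ga *: 1 - ga *: g) h].
  have la := @lin_actr _ _ _ _ _ MA h.
  have := congr1 (act h) rel.
  rewrite !(linD la) !(linZ la) (mact_one MA) actu actv.
  rewrite (act_prod h actv actu) (act_prod h actu actv) (act_prod h actu actu).
  move/relation_coefs => /=.
  rewrite /g; gen_mul S; rewrite !(evD, evN, evZ, ev1) => -[E1 E2 E3 E4 [E5 E6]].
  by split; [split|..].
split; split; apply: ev_inj => h; by case: (E h) => -[].
Qed.

(** Sort the coproduct of g by its first factor, one of ba, bc, da, dc. The matching second factors
    are -tg, -qg, g and 0 by the first three relations, and together they make up g ⊗ g. *)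
Lemma hdet_character : character g.
Proof.
have [[a1 b1 e1] [c1 d1 f1]] := coefs_at_one.
have e2 : forall p, lin (ev p) := @lin_ev _ _ S.
split=> [|x y].
  by rewrite /g !(evD, evN, evZ) !evM !sw1 ?a1 ?b1 ?d1 ?c1 ?/GRing.scale /= ?mul1r ?mul0r ?mulr0 ?subr0 //; lin.
have [[E1 E2 E3] _] := relations.
have E1' := congr1 (fun p => ev p y) E1.
have E2' := congr1 (fun p => ev p y) E2.
have E3' := congr1 (fun p => ev p y) E3.
have Ey : ev g y = ev (d * a) y - q * ev (b * c) y - t * ev (b * a) y by rewrite /g !(evD, evN, evZ).
have Ex : ev g x = ev (d * a) x - q * ev (b * c) x - t * ev (b * a) x by rewrite /g !(evD, evN, evZ).
transitivity (ev (d * a) (x * y) - q * ev (b * c) (x * y) - t * ev (b * a) (x * y) : k).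
  by rewrite {1}/g !(evD, evN, evZ).
rewrite (ev_mul_mul x y d_mul a_mul) (ev_mul_mul x y b_mul c_mul) (ev_mul_mul x y b_mul a_mul).
rewrite Ex; move: E1' E2' E3' Ey; clear E1 E2 E3 Ex.
move: g; move=> g'; gen_mul S; rewrite !(evD, evN, evZ) => -> -> -> Ey; rewrite Ey; ring.
Qed.
End Core.

(** * The Hopf subalgebra of the dual generated by a set of functionals *)

Section Closure.
Variables (k : fieldType) (H : falgType k) (S : hopf_structure H).
Local Notation sw := (sweedler S).
Local Notation A := (antipode S).
Local Notation eps := (counit S).
Variable X : dual S -> Prop.

Inductive hopf_closure : dual S -> Prop :=
| closure_base p : X p -> hopf_closure p
| closure_1 : hopf_closure 1
| closure_lin a p q : hopf_closure p -> hopf_closure q -> hopf_closure (a *: p + q)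
| closure_mul p q : hopf_closure p -> hopf_closure q -> hopf_closure (p * q)
| closure_antipode p : hopf_closure p -> hopf_closure (SK p).

Lemma closure_0 : hopf_closure 0.
Proof. by rewrite -(addNr (1 : dual S)) -scaleN1r; apply: closure_lin; apply: closure_1. Qed.
Lemma closure_Z a p : hopf_closure p -> hopf_closure (a *: p).
Proof. by move=> hp; rewrite -[a *: p]addr0; apply: closure_lin => //; apply: closure_0. Qed.
Lemma closure_D p q : hopf_closure p -> hopf_closure q -> hopf_closure (p + q).
Proof. by move=> hp hq; rewrite -[p]scale1r; apply: closure_lin. Qed.

Hypothesis hitX : forall p h, X p ->
  (exists2 q, hopf_closure q & forall x, ev p (h * x) = ev q x) /\
  (exists2 q, hopf_closure q & forall x, ev p (x * h) = ev q x).

Lemma closure_sw (F : H -> H -> dual S) h : (forall x y, hopf_closure (F x y)) -> hopf_closure (sw F h).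
Proof.
move=> hF; rewrite /sweedler /tlift; apply: (big_ind hopf_closure closure_0 closure_D) => i _.
by apply: (big_ind hopf_closure closure_0 closure_D) => j _; apply: closure_Z.
Qed.

(** Translates pass through the constructors: on a product they split along the coproduct of h, and
    on an antipode left and right translation change places. Hence it is enough to know the
    translates of the generators. *)
Lemma closure_hit p : hopf_closure p -> forall h,
  hopf_closure (dual_of S (fun x => ev p (h * x))) /\ hopf_closure (dual_of S (fun x => ev p (x * h))).
Proof.
have e := @lin_ev _ _ S.
have X1 (p0 p1 : dual S) h : hopf_closure p1 -> (forall x, ev p0 (h * x) = ev p1 x) -> hopf_closure (dual_of S (fun x => ev p0 (h * x))).
  by move=> h1 E; rewrite (_ : dual_of S _ = p1) //; apply: ev_inj => x; rewrite dual_ofE //; lin.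
have X2 (p0 p1 : dual S) h : hopf_closure p1 -> (forall x, ev p0 (x * h) = ev p1 x) -> hopf_closure (dual_of S (fun x => ev p0 (x * h))).
  by move=> h1 E; rewrite (_ : dual_of S _ = p1) //; apply: ev_inj => x; rewrite dual_ofE //; lin.
elim=> {p} [p Xp h||a p q _ IHp _ IHq h|p q _ IHp _ IHq h|p _ IHp h].
- by have [[q1 h1 E1] [q2 h2 E2]] := hitX h Xp; split; [exact: (X1 _ _ _ h1 E1)|exact: (X2 _ _ _ h2 E2)].
- by move=> h; split; [apply: (X1 _ _ _ (closure_Z (eps h) closure_1)) => x; rewrite evZ !ev1 counitM
    |apply: (X2 _ _ _ (closure_Z (eps h) closure_1)) => x; rewrite evZ !ev1 counitM mulrC].
- have [p1 p2] := IHp h; have [q1 q2] := IHq h; split.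
    by apply: (X1 _ _ _ (closure_lin a p1 q1)) => x; rewrite !evD !evZ !dual_ofE //; lin.
  by apply: (X2 _ _ _ (closure_lin a p2 q2)) => x; rewrite !evD !evZ !dual_ofE //; lin.
- split.
    apply: (X1 _ (sw (fun h1 h2 => dual_of S (fun x => ev p (h1 * x)) * dual_of S (fun x => ev q (h2 * x))) h)).
      by apply: closure_sw => x y; apply: closure_mul; [case: (IHp x)|case: (IHq y)].
    move=> x; rewrite evM swM; [|by lin..].
    rewrite (@sw_map _ _ _ _ _ (fun r => ev r x)) ; last exact: lin_evl.
    apply: eq_sw => h1 h2; rewrite evM; apply: eq_sw => x1 x2; rewrite !dual_ofE //; lin.
  apply: (X2 _ (sw (fun h1 h2 => dual_of S (fun x => ev p (x * h1)) * dual_of S (fun x => ev q (x * h2))) h)).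
    by apply: closure_sw => x y; apply: closure_mul; [case: (IHp x)|case: (IHq y)].
  move=> x; rewrite evM swM; [|by lin..].
  rewrite sw_swap.
  rewrite (@sw_map _ _ _ _ _ (fun r => ev r x)) ; last exact: lin_evl.
  apply: eq_sw => h1 h2; rewrite evM; apply: eq_sw => x1 x2; rewrite !dual_ofE //; lin.
- have [p1 p2] := IHp (A h); split.
    by apply: (X1 _ _ _ (closure_antipode p2)) => x; rewrite !SKE antipodeM dual_ofE //; lin.
  by apply: (X2 _ _ _ (closure_antipode p1)) => x; rewrite !SKE antipodeM dual_ofE //; lin.
Qed.

Variables (R : algType k) (act : H -> R -> R) (MA : module_algebra S act) (IF : inner_faithful S act).
Variables (B : R -> Prop) (genB : generates B).

Lemma hopf_closure_total : (forall h, (forall p, X p -> ev p h = 0) -> forall b, B b -> act h b = 0) ->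
  forall p, hopf_closure p.
Proof.
move=> hB; apply: (dual_generated MA IF genB closure_1 closure_lin closure_mul closure_antipode).
  by move=> h hh; apply: hB => p Xp; apply: hh; apply: closure_base.
exact: closure_hit.
Qed.
End Closure.

(** * Operators of finite order and the twisted square of the antipode *)

Section FiniteOrder.
Variables (k : fieldType) (char0 : [pchar k] =i pred0) (V : lmodType k).

Definition finite_order (T : V -> V) := lin T /\ exists n, (0 < n)%N /\ forall x, iter n T x = x.

Lemma finite_order_unipotent T x w : finite_order T -> T x = x + w -> T w = w -> w = 0.
Proof.
case=> lT [n [n0 Tn]] Tx Tw.
have E m : iter m T x = x + m%:R *: w.
  elim: m => [|m IH]; first by rewrite scale0r addr0.
  by rewrite iterS IH (linD lT) (linZ lT) Tx Tw -natr1 scalerDl scale1r -addrA [w + _]addrC.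
have /eqP := Tn x; rewrite E -subr_eq0 addrC addrA addNr add0r scaler_eq0.
by rewrite ((GRing.pcharf0P k).1 char0) -[n == 0]/(n == 0%N) eqn0Ngt n0 => /eqP.
Qed.

Lemma finite_order_scale T x s : finite_order T -> (forall n, (0 < n)%N -> s ^+ n != 1) -> T x = s *: x -> x = 0.
Proof.
case=> lT [n [n0 Tn]] hs Tx.
have E m : iter m T x = s ^+ m *: x.
  elim: m => [|m IH]; first by rewrite expr0 scale1r.
  by rewrite iterS IH (linZ lT) Tx scalerA exprSr.
have /eqP := Tn x; rewrite E -{2}[x]scale1r -subr_eq0 -scalerBl scaler_eq0 subr_eq0 (negPf (hs n n0)).
by move/eqP.
Qed.
End FiniteOrder.

Section DualConj.
Variables (k : closedFieldType) (H : falgType k) (S : hopf_structure H).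
Implicit Types p q : dual S.

Lemma conj_finite_order (a : dual S) : character a -> finite_order (fun p => SK a * p * a).
Proof.
move=> ca; have [aV Va] := characterV ca; split; first by lin.
have [n [n0 an]] := character_order ca; exists n; split=> // p.
have E m : iter m (fun p => SK a * p * a) p = SK a ^+ m * p * a ^+ m.
  elim: m => [|m IH]; first by rewrite mul1r mulr1.
  by rewrite iterS IH !mulrA -exprS -!mulrA -exprSr.
suff Vn : SK a ^+ n = 1 by rewrite E an Vn mul1r mulr1.
have cc : GRing.comm (SK a) a by rewrite /GRing.comm aV.
by rewrite -[LHS]mulr1 -an -exprMn_comm // Va expr1n.
Qed.

(** This is g^-1 S^2(p) g when g is group-like. It has finite order because S and g do and S^2 fixes
    g, and it undoes the factor g^-1 in the adjugate formula for the antipode. *)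
Definition twist (g p : dual S) := SK g * SK (SK p) * g.

Lemma SK_SK (g : dual S) : character g -> SK (SK g) = g.
Proof.
move=> cg; have [gV Vg] := characterV cg.
by rewrite -[LHS]mulr1 -Vg mulrA -SKM gV SK1 mul1r.
Qed.

Lemma twist_finite_order (g : dual S) : character g -> finite_order (twist g).
Proof.
move=> cg; have [gV Vg] := characterV cg.
have [n [n0 hn]] := SK_order S; have [m [m0 gm]] := character_order cg.
have l : lin (@SK k H S) by apply: SK_is_lin.
split; first by rewrite /twist; lin.
exists (n * m)%N; split=> [|p]; first by rewrite muln_gt0 n0.
have E i : iter i (twist g) p = SK g ^+ i * iter i.*2 (@SK k H S) p * g ^+ i.
  elim: i => [|i IH]; first by rewrite mul1r mulr1.
  have gX : SK (SK (g ^+ i)) = g ^+ i by elim: i {IH} => [|i IH]; rewrite ?expr0 ?SK1 ?SK1 // exprSr !SKM IH ?(SK_SK cg) -?exprSr -?exprS.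
  have VX : SK (SK (SK g ^+ i)) = SK g ^+ i by elim: i {IH gX} => [|i IH]; rewrite ?expr0 ?SK1 ?SK1 // exprSr !SKM IH ?(SK_SK cg) -?exprSr -?exprS.
  by rewrite iterS IH /twist !SKM gX VX doubleS !iterS !mulrA -exprS -!mulrA -exprSr.
have Em : iter (n * m).*2 (@SK k H S) p = p.
  rewrite -muln2 mulnAC muln2; elim: m {m0 gm} => [|m IH]; first by rewrite muln0.
  by rewrite mulnS iterD IH hn.
suff VN : SK g ^+ (n * m) = 1 by rewrite E Em VN mulnC exprM gm expr1n mul1r mulr1.
have gN : g ^+ (n * m) = 1 by rewrite mulnC exprM gm expr1n.
have cc : GRing.comm (SK g) g by rewrite /GRing.comm gV.
by rewrite -[LHS]mulr1 -gN -exprMn_comm // Vg expr1n.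
Qed.
End DualConj.

Section QuantumAdjugate.
Variables (k : fieldType) (K : algType k) (T : Type) (ev : K -> T -> k).
Hypotheses (evD : forall p q x, ev (p + q) x = ev p x + ev q x) (evN : forall p x, ev (- p) x = - ev p x)
  (ev0 : forall x, ev 0 x = 0) (evZ : forall s p x, ev (s *: p) x = s * ev p x) (ev_inj : forall p q, (forall x, ev p x = ev q x) -> p = q).

Ltac nc_expand := rewrite ?(mulrDl, mulrDr, mulNr, mulrN, opprD, opprK, scalerDr, scalerN, mul1r, mulr1, mulrA);
  rewrite -?(scalerAl, scalerAr); rewrite ?(mulrDl, mulrDr, mulNr, mulrN, opprD, opprK, scalerDr, scalerN, mul1r, mulr1, mulrA).
Ltac gen_ev := repeat match goal with |- context [ev ?p ?x] => move: (ev p x) => ? end.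

Variables (a b c d g : K) (q t : k).
Hypothesis q0 : q != 0.
Hypotheses (Dg : g = d * a - q *: (b * c) - t *: (b * a))
  (Ra : c * a = q *: (a * c) + t *: (a * a) - t *: g)
  (Rb : c * b = q *: (a * d) + t *: (a * b) - q *: g)
  (Rd : d * b = q *: (b * d) + t *: (b * b)).

(** The right adjugate of the matrix (a c; b d), with determinant g. After the products ca, cb, db
    have been put in normal order, evaluation turns each remaining monomial into an atom of k, and
    the noncommutative identity becomes one for [field]. *)
Lemma quantum_adjugate :
  [/\ a * (d + (t / q) *: b) + c * - (q^-1 *: b) = g, b * (d + (t / q) *: b) + d * - (q^-1 *: b) = 0,
   a * (- (t *: a) - q *: c + (t ^+ 2 / q) *: b + t *: d) + c * (a - (t / q) *: b) = 0
   & b * (- (t *: a) - q *: c + (t ^+ 2 / q) *: b + t *: d) + d * (a - (t / q) *: b) = g].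
Proof.

split; nc_expand; rewrite ?Ra ?Rb ?Rd; nc_expand; apply: ev_inj => x;
  by rewrite ?Dg ?(ev0, evD, evN, evZ); gen_ev; field.
Qed.
End QuantumAdjugate.

Section Translations.
Variables (k : fieldType) (K : algType k) (a b c d e f g gi : K) (al : k).
Hypotheses (gV : g * gi = 1) (Vg : gi * g = 1).
Hypotheses (A1 : a * gi * d - b * gi * c = 1) (A2 : a * gi * b = b * gi * a)
  (A3 : c * gi * d = d * gi * c) (A4 : d * gi * a - c * gi * b = 1).
Hypotheses (Re : c * e + f * a = a * f + e * c + al *: a - al *: g)
  (Rf : d * e + f * b = b * f + e * d + al *: b).

(** The left-hand sides are what [twist] produces from e and f when q = 1, t = 0 and be = 0. The
    relations move e and f to the right of the matrix entries, after which the adjugate identities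
    cancel everything except the terms with al. *)
Lemma antipode_translation_square :
  a * gi * (e * d - f * b) - b * gi * (e * c - f * a) = e - al *: b /\
  c * gi * (e * d - f * b) - d * gi * (e * c - f * a) = f + al *: (1 - d).
Proof.
have E1 : e * d - f * b = d * e - b * f - al *: b.
  apply: (eq_of_subr (esym Rf)); rewrite !opprD !opprK !addrA.
  by rewrite [RHS](+%R.[AC 5 (2*5*4*1*3)]).
have E2 : e * c - f * a = c * e - a * f - al *: a + al *: g.
  apply: (eq_of_subr (esym Re)); rewrite !opprD !opprK !addrA.
  by rewrite [RHS](+%R.[AC 6 (2*6*5*1*3*4)]).
have gp x : x * gi * g = x by rewrite -mulrA Vg mulr1.
rewrite E1 E2 !(mulrDr, mulrN) -!scalerAr !mulrA !gp A2 A3; split.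
  have -> : a * gi * d = 1 + b * gi * c by rewrite -A1 subrK.
  rewrite mulrDl mul1r; set r := _ * e; set p := _ * f; set w := al *: (_ * _ * _).
  have -> : e + r - p - w = e + (r - p - w) by rewrite !addrA.
  by rewrite opprD addrA addrK.
have -> : d * gi * a = 1 + c * gi * b by rewrite -A4 subrK.
rewrite mulrDl mul1r (scalerDr al 1) (scalerBr al 1).
set p := _ * f; set w := al *: (_ * _ * _); set s := _ * e.
have -> : s - (f + p) - (al *: 1 + w) + al *: d = (s - p - w) - (f + (al *: 1 - al *: d)).
  by rewrite !opprD opprK !addrA [LHS](+%R.[AC 6 (1*3*5*2*4*6)]).
by rewrite opprD opprK addrA subrr add0r.
Qed.
End Translations.

Lemma six_commute (T : pzRingType) (a b c d e f : T) :
  [/\ a * b = b * a, a * c = c * a, a * d = d * a, a * e = e * a & a * f = f * a] ->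
  [/\ b * c = c * b, b * d = d * b, b * e = e * b & b * f = f * b] ->
  [/\ c * d = d * c, c * e = e * c & c * f = f * c] ->
  [/\ d * e = e * d, d * f = f * d & e * f = f * e] ->
  forall p q, p = a \/ p = b \/ p = c \/ p = d \/ p = e \/ p = f ->
    q = a \/ q = b \/ q = c \/ q = d \/ q = e \/ q = f -> p * q = q * p.
Proof.
move=> [? ? ? ? ?] [? ? ? ?] [? ? ?] [? ? ?] p q.
by move=> [->|[->|[->|[->|[->|->]]]]] [->|[->|[->|[->|[->|->]]]]].
Qed.

(** One entry of R q (X Y) = (R X) q Y for a 2 x 2 matrix X whose entries commute with q. With R and
    Y taken from the inverse of X, it shows that q commutes with the entries of the inverse. *)
Lemma mul_comm_columns (T : pzRingType) (a b c d q r s x y : T) :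
  q * a = a * q -> q * b = b * q -> q * c = c * q -> q * d = d * q ->
  r * q * (a * x + c * y) + s * q * (b * x + d * y) = (r * a + s * b) * q * x + (r * c + s * d) * q * y.
Proof.
move=> qa qb qc qd; rewrite !mulrDr !mulrDl !mulrA -!(mulrA r q) -!(mulrA s q) qa qb qc qd !mulrA.
by rewrite addrACA.
Qed.

Lemma sandwich_cancel (T : pzRingType) (a b g gi P Q : T) : gi * g = 1 ->
  (a * gi * (P * gi) - b * gi * (Q * gi)) * g = a * gi * P - b * gi * Q.
Proof. by move=> Vg; rewrite mulrBl -!mulrA Vg !mulr1. Qed.

Section Coefficients.
Variables (k : closedFieldType) (char0 : [pchar k] =i pred0) (H : falgType k) (S : hopf_structure H).
Local Notation A := (antipode S).
Local Notation eps := (counit S).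
Variables (a b c d e f : dual S).
Hypothesis a_mul : forall x y, ev a (x * y) = (ev a x : k) * ev a y + (ev c x : k) * ev b y.
Hypothesis b_mul : forall x y, ev b (x * y) = (ev b x : k) * ev a y + (ev d x : k) * ev b y.
Hypothesis c_mul : forall x y, ev c (x * y) = (ev a x : k) * ev c y + (ev c x : k) * ev d y.
Hypothesis d_mul : forall x y, ev d (x * y) = (ev b x : k) * ev c y + (ev d x : k) * ev d y.
Hypothesis e_mul : forall x y, ev e (x * y) = (ev e x : k) * ev a y + (ev f x : k) * ev b y + (eps x : k) * ev e y.
Hypothesis f_mul : forall x y, ev f (x * y) = (ev e x : k) * ev c y + (ev f x : k) * ev d y + (eps x : k) * ev f y.
Hypotheses (a1 : ev a 1 = 1) (b1 : ev b 1 = 0) (c1 : ev c 1 = 0) (d1 : ev d 1 = 1)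
  (e1 : ev e 1 = 0) (f1 : ev f 1 = 0).

Definition entry (p : dual S) := p = a \/ p = b \/ p = c \/ p = d \/ p = e \/ p = f.
Hypothesis total : forall p, hopf_closure entry p.

Lemma antipode_entries :
  [/\ SK a * a + SK c * b = 1, SK b * a + SK d * b = 0, SK a * c + SK c * d = 0 & SK b * c + SK d * d = 1] /\
  [/\ a * SK a + c * SK b = 1, b * SK a + d * SK b = 0, a * SK c + c * SK d = 0 & b * SK c + d * SK d = 1].
Proof.
have P (p p1 p1' p2 p2' : dual S) :
  (forall x y, ev p (x * y) = (ev p1 x : k) * ev p1' y + (ev p2 x : k) * ev p2' y) ->
  SK p1 * p1' + SK p2 * p2' = (ev p 1 : k) *: 1 /\ p1 * SK p1' + p2 * SK p2' = (ev p 1 : k) *: 1.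
  move=> h; have [|E1 E2] := @antipode_coef _ _ S p p1 p1' p2 p2' 0 0.
    by move=> x y; rewrite h ev0 mul0r addr0.
  by split; [rewrite -E1|rewrite -E2]; rewrite !linear0 !mulr0 !addr0.
have [A1 A2] := P _ _ _ _ _ a_mul; have [B1 B2] := P _ _ _ _ _ b_mul.
have [C1 C2] := P _ _ _ _ _ c_mul; have [D1 D2] := P _ _ _ _ _ d_mul.
by rewrite A1 A2 B1 B2 C1 C2 D1 D2 a1 b1 c1 d1 scale1r scale0r.
Qed.

Lemma antipode_translations :
  [/\ SK e * a + SK f * b + e = 0, SK e * c + SK f * d + f = 0,
   e * SK a + f * SK b + SK e = 0 & e * SK c + f * SK d + SK f = 0].
Proof.
have [|E1 E2] := @antipode_coef _ _ S e e a f b 1 e.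
  by move=> x y; rewrite e_mul ev1.
have [|F1 F2] := @antipode_coef _ _ S f e c f d 1 f.
  by move=> x y; rewrite f_mul ev1.
by move: E1 E2 F1 F2; rewrite SK1 !mul1r e1 f1 scale0r.
Qed.

(* If the matrix Y of all entries has entries in a commutative ring, then so has its inverse SK Y,
   and applying the antipode to SK Y * Y = 1 gives SK (SK Y) = Y. *)
Lemma commuting_entries : (forall p q, entry p -> entry q -> p * q = q * p) -> is_group_algebra S.
Proof.
move=> com; apply: cocommutative_group_algebra => //.
have [[sl1 sl2 sl3 sl4] [sr1 sr2 sr3 sr4]] := antipode_entries.
have [t1 t2 t3 t4] := antipode_translations.
(* [cent] is the commutant of the entries and [Z] its commutant. As the entries commute, Z lies in
   [cent] and is therefore commutative, and it contains the entries of the inverse matrix. *)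
pose cent p := forall q, entry q -> p * q = q * p.
pose Z p := forall q, cent q -> p * q = q * p.
have entZ p : entry p -> Z p by move=> ep q; move/(_ _ ep).
have ZC p : Z p -> cent p by move=> Zp q eq; apply: Zp => r er; apply: com.
have ZZ p q : Z p -> Z q -> p * q = q * p by move=> Zp Zq; apply: Zp; apply: ZC.
have [ea eb ec] : [/\ entry a, entry b & entry c] by rewrite /entry; split; tauto.
have [ed ee ef] : [/\ entry d, entry e & entry f] by rewrite /entry; split; tauto.
have ZL x p q : Z p -> Z q -> Z (x *: p + q).
  by move=> Zp Zq r cr; rewrite mulrDl mulrDr -scalerAl -scalerAr Zp // Zq.
have ZM p q : Z p -> Z q -> Z (p * q).
  by move=> Zp Zq r cr; rewrite -mulrA Zq // mulrA Zp // mulrA.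
have Z1 : Z 1 by move=> q _; rewrite mul1r mulr1.
have ZD p q : Z p -> Z q -> Z (p + q) by move=> Zp Zq; rewrite -[p]scale1r; apply: ZL.
have ZN p : Z p -> Z (- p) by move=> Zp r cr; rewrite mulNr mulrN Zp.
have swap q r s x y : cent q -> r * q * (a * x + c * y) + s * q * (b * x + d * y)
    = (r * a + s * b) * q * x + (r * c + s * d) * q * y.
  by move=> cq; apply: mul_comm_columns; apply: cq.
have ZA : Z (SK a).
  by move=> q cq; have := swap q (SK a) (SK c) (SK a) (SK b) cq;
    rewrite sl1 sl3 sr1 sr2 !mul0r !mulr0 !addr0 mulr1 mul1r.
have ZB : Z (SK b).
  by move=> q cq; have := swap q (SK b) (SK d) (SK a) (SK b) cq;
    rewrite sl2 sl4 sr1 sr2 !mul0r !mulr0 !addr0 add0r mulr1 mul1r.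
have ZCc : Z (SK c).
  by move=> q cq; have := swap q (SK a) (SK c) (SK c) (SK d) cq;
    rewrite sl1 sl3 sr3 sr4 !mul0r !mulr0 add0r !addr0 mulr1 mul1r.
have ZDd : Z (SK d).
  by move=> q cq; have := swap q (SK b) (SK d) (SK c) (SK d) cq;
    rewrite sl2 sl4 sr3 sr4 !mul0r !mulr0 !add0r mulr1 mul1r.
have ZE : Z (SK e) by rewrite -(addr0_eq t3); apply/ZN/ZD; apply: ZM => //; apply: entZ.
have ZF : Z (SK f) by rewrite -(addr0_eq t4); apply/ZN/ZD; apply: ZM => //; apply: entZ.
have solve2 x y m n : SK a * x + SK b * y = m -> SK c * x + SK d * y = n ->
    x = a * m + b * n /\ y = c * m + d * n.
  move=> <- <-; rewrite !mulrDr !mulrA.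
  rewrite !(ZZ _ (SK _) (entZ _ _)) //.
  split.
    by rewrite addrACA -!mulrDl sl1 sl2 mul1r mul0r addr0.
  by rewrite addrACA -!mulrDl sl3 sl4 mul1r mul0r add0r.
have S1 : SK a * SK (SK a) + SK b * SK (SK c) = 1 by rewrite -[RHS](SK1 S) -sl1 linearD /= !SKM.
have S2 : SK c * SK (SK a) + SK d * SK (SK c) = 0 by rewrite -[RHS](linear0 (@SK k H S)) -sl3 linearD /= !SKM.
have S3 : SK a * SK (SK b) + SK b * SK (SK d) = 0 by rewrite -[RHS](linear0 (@SK k H S)) -sl2 linearD /= !SKM.
have S4 : SK c * SK (SK b) + SK d * SK (SK d) = 1 by rewrite -[RHS](SK1 S) -sl4 linearD /= !SKM.
have [SSa SSc] := solve2 _ _ _ _ S1 S2; have [SSb SSd] := solve2 _ _ _ _ S3 S4.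
move: SSa SSb SSc SSd; rewrite !mulr1 !mulr0 !addr0 !add0r => SSa SSb SSc SSd.
have SSe : SK (SK e) = e.
  rewrite -[in LHS](addr0_eq t3) linearN linearD /= !SKM SSa SSb.
  rewrite -(ZZ _ _ ZE (entZ _ ea)) -(ZZ _ _ ZF (entZ _ eb)); apply/eqP.
  by rewrite eq_sym -addr_eq0 addrC t1.
have SSf : SK (SK f) = f.
  rewrite -[in LHS](addr0_eq t4) linearN linearD /= !SKM SSc SSd.
  rewrite -(ZZ _ _ ZE (entZ _ ec)) -(ZZ _ _ ZF (entZ _ ed)); apply/eqP.
  by rewrite eq_sym -addr_eq0 addrC t2.
(* The clause S^2(p) = p is carried along so that the antipode constructor closes: the second clause
   for S(p) is then the first one for p. *)
have main p : hopf_closure entry p -> [/\ Z p, Z (SK p) & SK (SK p) = p].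
  elim=> {p} [p [->|[->|[->|[->|[->|->]]]]]||x p q _ [Zp Zp' Sp] _ [Zq Zq' Sq]|p q _ [Zp Zp' Sp] _ [Zq Zq' Sq]|p _ [Zp Zp' Sp]].
  - by split; [exact: entZ| |].
  - by split; [exact: entZ| |].
  - by split; [exact: entZ| |].
  - by split; [exact: entZ| |].
  - by split; [exact: entZ| |].
  - by split; [exact: entZ| |].
  - by rewrite !SK1.
  - by rewrite !linearP /= Sp Sq; split; [exact: ZL|exact: ZL|].
  - by rewrite !SKM Sp Sq; split; [exact: ZM|exact: ZM|].
  - by rewrite Sp; split.
by move=> p q; apply: ZZ; [case: (main p (total p))|case: (main q (total q))].
Qed.
End Coefficients.

(** * The four normal forms *)

Section Cases.
Variables (k : closedFieldType) (char0 : [pchar k] =i pred0) (H : falgType k) (S : hopf_structure H).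
Local Notation A := (antipode S).
Local Notation eps := (counit S).
Variables (a b c d e f : dual S).
Hypothesis a_mul : forall x y, ev a (x * y) = (ev a x : k) * ev a y + (ev c x : k) * ev b y.
Hypothesis b_mul : forall x y, ev b (x * y) = (ev b x : k) * ev a y + (ev d x : k) * ev b y.
Hypothesis c_mul : forall x y, ev c (x * y) = (ev a x : k) * ev c y + (ev c x : k) * ev d y.
Hypothesis d_mul : forall x y, ev d (x * y) = (ev b x : k) * ev c y + (ev d x : k) * ev d y.
Hypothesis e_mul : forall x y, ev e (x * y) = (ev e x : k) * ev a y + (ev f x : k) * ev b y + (eps x : k) * ev e y.
Hypothesis f_mul : forall x y, ev f (x * y) = (ev e x : k) * ev c y + (ev f x : k) * ev d y + (eps x : k) * ev f y.
Hypotheses (a1 : ev a 1 = 1) (b1 : ev b 1 = 0) (c1 : ev c 1 = 0) (d1 : ev d 1 = 1)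
  (e1 : ev e 1 = 0) (f1 : ev f 1 = 0).

Hypothesis total : forall p, hopf_closure (entry a b c d e f) p.

Let ent := antipode_entries a_mul b_mul c_mul d_mul a1 b1 c1 d1.
Let trans := antipode_translations e_mul f_mul e1 f1.
Let commuting := commuting_entries char0 a_mul b_mul c_mul d_mul e_mul f_mul a1 b1 c1 d1 e1 f1 total.

Variables (q t al be ga : k).
Hypothesis q0 : q != 0.
Variable g : dual S.
Hypothesis Dg : g = d * a - q *: (b * c) - t *: (b * a).
Hypothesis cg : character g.
Hypotheses (Ra : c * a = q *: (a * c) + t *: (a * a) - t *: g)
  (Rb : c * b = q *: (a * d) + t *: (a * b) - q *: g)
  (Rd : d * b = q *: (b * d) + t *: (b * b))
  (Re : c * e + f * a = q *: (a * f + e * c) + t *: (a * e + e * a) + al *: a + be *: c - al *: g)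
  (Rf : d * e + f * b = q *: (b * f + e * d) + t *: (b * e + e * b) + al *: b + be *: d - be *: g)
  (Rg : f * e = q *: (e * f) + t *: (e * e) + al *: e + be *: f + ga *: 1 - ga *: g).

(* SK X * X = 1 for X = (a c; b d), and the adjugate is the inverse of X up to g. *)
Lemma antipode_adjugate :
  [/\ SK a = (d + (t / q) *: b) * SK g, SK b = - (q^-1 *: b) * SK g,
   SK c = (- (t *: a) - q *: c + (t ^+ 2 / q) *: b + t *: d) * SK g & SK d = (a - (t / q) *: b) * SK g].
Proof.
have [gV Vg] := characterV cg; have [[sl1 sl2 sl3 sl4] _] := ent.
have [] := @quantum_adjugate k (dual S) H (@ev _ _ S) (@evD _ _ S) (@evN _ _ S) (@ev0 _ _ S) (@evZ _ _ S)
  (@ev_inj _ _ S) a b c d g q t q0 Dg Ra Rb Rd.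
clear Dg cg Ra Rb Rd Re Rf Rg; move: (d + _) (- _) (_ + t *: d) (a - _) => z1 z2 z3 z4 x1 x2 x3 x4.
have Z r s x y m n m' n' : r * a + s * b = m -> r * c + s * d = n -> a * x + c * y = m' -> b * x + d * y = n' ->
    m * x + n * y = r * m' + s * n'.
  by move=> <- <- <- <-; rewrite !mulrDl !mulrDr !mulrA addrACA.
have Y p z : z = p * g -> p = z * SK g by move=> ->; rewrite -mulrA gV mulr1.
have := (Z _ _ _ _ _ _ _ _ sl1 sl3 x1 x2, Z _ _ _ _ _ _ _ _ sl1 sl3 x3 x4,
  Z _ _ _ _ _ _ _ _ sl2 sl4 x1 x2, Z _ _ _ _ _ _ _ _ sl2 sl4 x3 x4).
rewrite !mul0r !mul1r !mulr0 ?addr0 ?add0r => -[[[/Y -> /Y ->] /Y ->] /Y ->].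
by [].
Qed.

Lemma twistE (x y : dual S) : SK x = y * SK g -> twist g x = SK y * g.
Proof.
have [gV Vg] := characterV cg.
by rewrite /twist => ->; rewrite SKM (SK_SK cg) mulrA Vg mul1r.
Qed.

(** [twist g] scales c by q^2 and b by q^-2, so both vanish. Then a and d are group-like, and
    conjugation by d scales e by q^-1 while conjugation by a scales f by q, which kills e and f as
    well. *)
Lemma quantum_plane_case : t = 0 -> al = 0 -> be = 0 -> (forall n, (0 < n)%N -> q ^+ n != 1) -> is_group_algebra S.
Proof.
move=> t0 al0 be0 qn; have [gV Vg] := characterV cg; have [Sa Sb Sc Sd] := antipode_adjugate.
have fo := twist_finite_order cg.
have c0 : c = 0.
  apply: (finite_order_scale fo (s := q ^+ 2)) => [n n0|].
    by rewrite -exprM qn // muln_gt0.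
  move: Sc; rewrite t0 expr0n mul0r !scale0r oppr0 add0r !addr0 => Sc.
  rewrite (twistE Sc) linearN linearZ /= Sc mulNr -!scalerAl -mulrA Vg mulr1.
  by rewrite scalerN opprK scalerA.
have b0 : b = 0.
  apply: (finite_order_scale fo (s := q^-1 ^+ 2)) => [n n0|].
    by rewrite -exprM exprVn invr_eq1 qn // muln_gt0.
  rewrite (twistE Sb) linearN linearZ /= Sb mulNr -!scalerAl -mulrA Vg mulr1.
  by rewrite scalerN opprK scalerA.
have gE : g = d * a by rewrite Dg b0 t0 !mul0r !scaler0 !subr0.
have ca : character a by split=> // x y; rewrite a_mul c0 ev0 mul0r addr0.
have cd : character d by split=> // x y; rewrite d_mul b0 ev0 mul0r add0r.
have ad : a * d = d * a.
  move: Rb; rewrite gE b0 t0 mulr0 scale0r addr0 => /esym/eqP.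
  by rewrite -scalerBr scaler_eq0 (negPf q0) subr_eq0 => /eqP.
have e0 : e = 0.
  have [dV Vd] := characterV cd.
  apply: (finite_order_scale (conj_finite_order cd) (s := q^-1)) => [n n0|].
    by rewrite exprVn invr_eq1 qn.
  move: Rf; rewrite b0 t0 al0 be0 !scale0r !mulr0 !mul0r !addr0 !add0r subr0 => E.
  rewrite -mulrA; have -> : e * d = q^-1 *: (d * e) by rewrite E scalerA mulVf // scale1r.
  by rewrite -scalerAr mulrA Vd mul1r.
have f0 : f = 0.
  have [aV Va] := characterV ca.
  apply: (finite_order_scale (conj_finite_order ca) (s := q)) => [n n0|]; first exact: qn.
  move: Re; rewrite c0 t0 al0 be0 e0 !scale0r ?mulr0 ?mul0r !addr0 !add0r subr0 => E.
  by rewrite -mulrA E -scalerAr mulrA Va mul1r.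
apply: commuting => x y; rewrite /entry b0 c0 e0 f0.
by move=> [->|[->|[->|[->|[->|->]]]]] [->|[->|[->|[->|[->|->]]]]]; rewrite ?mulr0 ?mul0r.
Qed.

(** [twist g] fixes b and sends d to d + 2b, so b = 0; then it sends c to c + 2(a - d), so a = d.
    Conjugation by a moves e by a multiple of 1 - a and f by 2e + al(1 - a); both increments commute
    with a, so finite order kills them, and e becomes a multiple of a - 1. *)
Lemma jordan_plane_case : q = 1 -> t = 1 -> is_group_algebra S.
Proof.
move=> q1 t1; have [gV Vg] := characterV cg; have [Sa Sb Sc Sd] := antipode_adjugate.
have fo := twist_finite_order cg.
move: Sa Sb Sc Sd; rewrite q1 t1 expr1n divr1 invr1 !scale1r => Sa Sb Sc Sd.
have Vm x : x * SK g * g = x by rewrite -mulrA Vg mulr1.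
have Tb : twist g b = b by rewrite (twistE Sb) linearN /= Sb !mulNr opprK Vm.
have Ta : twist g a = a - (b + b).
  by rewrite (twistE Sa) linearD /= Sd Sb mulrDl !Vm opprD addrA.
have Td : twist g d = d + (b + b).
  by rewrite (twistE Sd) linearB /= Sa Sb mulrBl !Vm opprK addrA.
have char2 : (2%:R : k) != 0 by rewrite natr_neq0.
have double0 (x : dual S) : x + x = 0 -> x = 0.
  by move=> /eqP; rewrite -mulr2n -scaler_nat scaler_eq0 (negPf char2) => /eqP.
have lT := fo.1.
have b0 : b = 0.
  apply: double0; apply: (finite_order_unipotent char0 fo (x := d)); first exact: Td.
  by rewrite (linD lT) Tb.
have da : d = a.
  move: Ta Td; rewrite b0 addr0 subr0 addr0 => Ta Td.
  apply/esym/eqP; rewrite -subr_eq0; apply/eqP; apply: double0.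
  apply: (finite_order_unipotent char0 fo (x := c)); last by rewrite (linD lT) (linD lT) -!scaleN1r (linZ lT) Ta Td.
  rewrite (twistE Sc) !linearD !linearN /= Sa Sb Sc Sd b0 !subr0 !addr0 oppr0 mul0r addr0 !(mulrDl, mulNr).
  rewrite !opprD ?opprK ?(mulrDl, mulNr, opprD, opprK) !Vm.
  by rewrite !addrA [LHS](+%R.[AC 5 (3*2*1*5*4)]).
have ca : character a by split=> // x y; rewrite a_mul b0 ev0 mulr0 addr0.
have [aV Va] := characterV ca.
have gE : g = a * a by rewrite Dg b0 da !mul0r ?scaler0 ?subr0.
have cC : c * a = a * c by move: Ra; rewrite gE q1 t1 !scale1r addrK.
have cV : character (SK a).
  split=> [|x y]; first by rewrite SKE antipode1 a1.
  by rewrite !SKE antipodeM ca.2 mulrC.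
(* With d = a group-like, c S(a) is primitive, and primitive elements vanish in characteristic
   zero. *)
have c0 : c = 0.
  suff E : c * SK a = 0 by rewrite -[c]mulr1 -Va mulrA E mul0r.
  apply: (primitive_eq0 char0) => x y.
  have h (p : dual S) (hp : character p) : forall x y, ev p (x * y) = (ev p x : k) * ev p y + (ev (0 : dual S) x : k) * ev (0 : dual S) y.
    by case: hp => _ hp x1 y1; rewrite hp ev0 mul0r addr0.
  rewrite (ev_mul_mul x y c_mul (h _ cV)) ?mulr0 ?ev0 ?mul0r ?mulr0 !addr0 da aV !ev1.
  by [].
have twist_eq p w : p * a = a * (p + w) -> w * a = a * w -> w = 0.
  move=> E Ew; apply: (finite_order_unipotent char0 (conj_finite_order ca) (x := p)).
    by rewrite -mulrA E mulrA Va mul1r.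
  by rewrite -mulrA Ew mulrA Va mul1r.
have ae : a * e = e * a.
  move: Rf; rewrite gE b0 da q1 t1 !scale1r !mul0r !mulr0 scaler0 !addr0 add0r => E.
  suff W : be *: (1 - a) = 0.
    rewrite E -addrA -scalerBr; suff -> : a - a * a = (1 - a) * a by rewrite scalerAl W mul0r addr0.
    by rewrite mulrBl mul1r.
  apply: oppr_inj; rewrite oppr0; apply: (twist_eq e).
    by rewrite mulrDr mulrN E -scalerAr mulrBr mulr1 scalerBr -(addrA (e * a)) addrK.
  by rewrite mulNr mulrN -scalerAl -scalerAr mulrBl mulrBr mul1r mulr1.
have ew : e + e + al *: (1 - a) = 0.
  apply: (twist_eq f).
    move: Re; rewrite gE c0 q1 t1 !scale1r mul0r mulr0 scaler0 add0r !addr0 => ->.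
    by rewrite !mulrDr -ae -scalerAr mulrBr mulr1 scalerBr !addrA.
  by rewrite !(mulrDl, mulrDr) ae -scalerAl -scalerAr mulrBl mulrBr mul1r mulr1.
have fa : f * a = a * f.
  move: Re; rewrite gE c0 q1 t1 !scale1r mul0r mulr0 scaler0 add0r !addr0 => ->.
  rewrite -[RHS]addr0 -(mulr0 a) -ew !mulrDr -ae -scalerAr mulrBr mulr1 scalerBr !addrA.
  by [].
have eE : e = (al / 2%:R) *: (a - 1).
  have : 2%:R *: e = al *: (a - 1).
    by rewrite scaler_nat mulr2n; apply/eqP; rewrite -subr_eq0 -scalerN opprB ew.
  by move=> /(congr1 (fun x => 2%:R^-1 *: x)); rewrite !scalerA mulVf // scale1r mulrC.
have ef : e * f = f * e.
  by rewrite eE -scalerAl -scalerAr mulrBl mulrBr fa mul1r mulr1.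
by apply: commuting; apply: six_commute; split; rewrite ?b0 ?c0 ?da ?mulr0 ?mul0r.
Qed.

(** With q = 1 and t = 0 the adjugate is the classical one and applying it twice returns the matrix,
    so only the translation parts e and f can move. *)
Lemma classical_twist : q = 1 -> t = 0 -> be = 0 ->
  [/\ twist g a = a, twist g b = b, twist g c = c & twist g d = d] /\
  [/\ twist g e = e - al *: b, twist g f = f + al *: (1 - d),
      a * SK g * d - b * SK g * c = 1, a * SK g * b = b * SK g * a & c * SK g * d = d * SK g * c].
Proof.
move=> q1 t0 be0; have [gV Vg] := characterV cg; have [Sa Sb Sc Sd] := antipode_adjugate.
have [[sl1 sl2 sl3 sl4] _] := ent; have [_ _ t3 t4] := trans.
move: Sa Sb Sc Sd; rewrite q1 t0 expr2 !mul0r !scale0r invr1 !scale1r oppr0 add0r !addr0 => Sa Sb Sc Sd.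
have Sd' := Sd.
have Vm x : x * SK g * g = x by rewrite -mulrA Vg mulr1.
move: sl1 sl2 sl3 sl4; rewrite Sa Sb Sc Sd' !mulNr => A4 A2 A3 A1.
have {}A1 : a * SK g * d - b * SK g * c = 1 by rewrite addrC.
have {}A2 : a * SK g * b = b * SK g * a by apply/eqP; rewrite -subr_eq0 addrC A2.
have {}A3 : c * SK g * d = d * SK g * c by apply/esym/eqP; rewrite -subr_eq0 A3.
have Se : SK e = - (e * d - f * b) * SK g.
  by rewrite -(addr0_eq t3) Sa Sb !mulNr mulrN mulrBl !mulrA.
have Sf : SK f = (e * c - f * a) * SK g.
  by rewrite -(addr0_eq t4) Sc Sd' !mulNr mulrN mulrBl !mulrA opprD opprK.
have [T1 T2] : a * SK g * (e * d - f * b) - b * SK g * (e * c - f * a) = e - al *: b /\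
    c * SK g * (e * d - f * b) - d * SK g * (e * c - f * a) = f + al *: (1 - d).
  apply: (@antipode_translation_square _ _ a b c d e f g (SK g) al) => //.
    by rewrite Re q1 t0 be0 !scale0r !scale1r !addr0.
  by rewrite Rf q1 t0 be0 !scale0r !scale1r !addr0 subr0.
split; first split.
- by rewrite (twistE Sa) Sd' Vm.
- by rewrite (twistE Sb) linearN /= Sb !mulNr Vm opprK.
- by rewrite (twistE Sc) linearN /= Sc !mulNr Vm opprK.
- by rewrite (twistE Sd') Sa Vm.
split=> //.
- rewrite (twistE Se) linearN linearB /= !SKM Sd' Sb Se Sf -T1; move: (_ - f * b) (_ - f * a) => P Q.
  rewrite -(sandwich_cancel _ _ P Q Vg); congr (_ * g).
  by rewrite !mulNr mulrN opprK opprD opprK.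
- rewrite (twistE Sf) linearB /= !SKM Sc Sa Se Sf -T2; move: (_ - f * b) (_ - f * a) => P Q.
  by rewrite !mulNr mulrN opprK; apply: sandwich_cancel.
Qed.

(** Unipotency of [twist g] on e and f gives b = 0 and d = 1, so g = a and c is skew primitive,
    hence kap (a - 1). Then f - kap e is primitive, so f = kap e, and the relation for fe leaves e =
    0. *)
Lemma affine_case : q = 1 -> t = 0 -> al = 1 -> be = 0 -> ga = 0 -> is_group_algebra S.
Proof.
move=> q1 t0 al1 be0 ga0; have [[Ta Tb Tc Td] [Te Tf _ _ _]] := classical_twist q1 t0 be0.
have fo := twist_finite_order cg; have lT := fo.1.
have [gV Vg] := characterV cg.
have T1 : twist g 1 = 1 by rewrite /twist !SK1 mulr1 Vg.
have b0 : b = 0.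
  apply: oppr_inj; rewrite oppr0; apply: (finite_order_unipotent char0 fo (x := e)).
    by rewrite Te al1 scale1r.
  by rewrite -scaleN1r (linZ lT) Tb.
have d1' : d = 1.
  apply/esym/eqP; rewrite -subr_eq0; apply/eqP; apply: (finite_order_unipotent char0 fo (x := f)).
    by rewrite Tf al1 scale1r.
  by rewrite -scaleN1r (linD lT) (linZ lT) T1 Td.
have ga' : g = a by rewrite Dg t0 b0 d1' mul1r !mul0r !scaler0 !subr0.
have cga : character a by rewrite -ga'.
have ac : a * c = c * a by rewrite Ra q1 t0 !scale0r scale1r addr0 subr0.
have [|kap ck] := @skew_primitive_group_span k char0 H S a c cga ac.
  by move=> x y; rewrite c_mul d1' ev1.
have fe : f = kap *: e.
  apply/eqP; rewrite -subr_eq0; apply/eqP; apply: (primitive_eq0 char0) => x y.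
  rewrite !(evD, evN, evZ) f_mul e_mul b0 d1' ev0 ck !(evZ, evD, evN, ev1); ring.
have e0 : e = 0.
  move: Rg; rewrite q1 t0 al1 be0 ga0 fe !scale0r !scale1r !addr0 subr0 -scalerAl -scalerAr.
  by move/eqP; rewrite -subr_eq0 opprD addrA subrr add0r oppr_eq0 => /eqP.
apply: commuting => x y; rewrite /entry b0 d1' fe e0 scaler0.
by move=> [->|[->|[->|[->|[->|->]]]]] [->|[->|[->|[->|[->|->]]]]]; rewrite ?mulr0 ?mul0r ?mul1r ?mulr1.
Qed.

(** The relation fe - ef = 1 - g forces g = 1 by a trace, so S^2 fixes the generators and is the
    identity. An integral of nonzero counit then removes the translations: e and f lie in the span
    of 1 and the matrix entries, which commute with each other. *)
Lemma weyl_case : q = 1 -> t = 0 -> al = 0 -> be = 0 -> ga = 1 -> is_group_algebra S.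
Proof.
move=> q1 t0 al0 be0 ga1; have [[Ta Tb Tc Td] [Te Tf _ _ _]] := classical_twist q1 t0 be0.
have g1 : g = 1.
  apply: (commutator_grouplike char0 cg (p := f) (q := e)).
  rewrite Rg q1 t0 al0 be0 ga1 !scale0r !scale1r !addr0.
  by rewrite addrAC [e * f + 1]addrC addrK.
have E (x : dual S) : twist g x = SK (SK x) by rewrite /twist g1 SK1 mul1r mulr1.
have SS (x : dual S) : SK (SK x) = x.
  elim: (total x) => {x} [x|//|z x y _ Sx _ Sy|x y _ Sx _ Sy|x _ Sx].
  - move: Ta Tb Tc Td Te Tf; rewrite !E al0 !scale0r subr0 addr0 => ? ? ? ? ? ?.
    by move=> [->|[->|[->|[->|[->|->]]]]].
  - by rewrite !SK1.
  - by rewrite !linearP /= Sx Sy.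
  - by rewrite !SKM Sx Sy.
  - by rewrite Sx.
have AK h : A (A h) = h.
  apply/eqP; rewrite -subr_eq0; apply/eqP; apply: hom_sep => p; rewrite linearB /=.
  by have := SKE (SK (p : dual S)) h; rewrite SS SKE -[LHS]/(p h) -[X in _ = X]/(p (A (A h))) => ->; rewrite subrr.
(* L h = ε(h) L and ε(L) = dim H. Evaluating e and f at L h therefore solves for e and f: averaging
   gives a fixed point of the affine action on u and v. *)
pose L := A (trace_elt S).
have Lint h := antipode_trace_elt AK h.
have epsL : (eps L : k) != 0 by rewrite /L counit_antipode counit_trace_elt dim_neq0.
have [ee ff] : e = (eps L : k)^-1 *: ((ev e L : k) *: 1 - (ev e L : k) *: a - (ev f L : k) *: b) /\
    f = (eps L : k)^-1 *: ((ev f L : k) *: 1 - (ev e L : k) *: c - (ev f L : k) *: d).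
  by split; apply: ev_inj => h; rewrite evZ !(evD, evN, evZ) ev1;
    [have := e_mul L h | have := f_mul L h]; rewrite Lint (linZ (@lin_ev _ _ S _)) /GRing.scale /= => E';
    apply: (mulfI epsL); rewrite mulVKf //; apply/esym/(eq_of_subr E'); ring.
have Cac : a * c = c * a by rewrite Ra q1 t0 !scale0r scale1r addr0 subr0.
have Cbd : b * d = d * b by rewrite Rd q1 t0 !scale0r scale1r addr0.
have [A1 A2 A3] : [/\ a * d - b * c = 1, a * b = b * a & c * d = d * c].
  by case: (classical_twist q1 t0 be0) => _ [_ _]; rewrite g1 SK1 !mulr1.
have Rb' : c * b = a * d - 1 by rewrite Rb q1 t0 g1 !scale0r !scale1r addr0.
have Dg' : d * a - b * c = 1 by rewrite -g1 Dg q1 t0 !scale0r !scale1r subr0.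
have Cbc : b * c = c * b by rewrite Rb' -A1 opprB addrCA subrr addr0.
have Cad : a * d = d * a by apply: (@addIr _ (- (b * c))); rewrite A1 Dg'.
pose cm (p : dual S) := [/\ p * a = a * p, p * b = b * p, p * c = c * p & p * d = d * p].
have cmL z p r : cm p -> cm r -> cm (z *: p + r).
  by move=> [p1 p2 p3 p4] [r1 r2 r3 r4]; split; rewrite mulrDl mulrDr -scalerAl -scalerAr ?(p1, p2, p3, p4) ?(r1, r2, r3, r4).
have cm1 : cm 1 by split; rewrite mul1r mulr1.
have cma : cm a by split.
have cmb : cm b by split.
have cmc : cm c by split.
have cmd : cm d by split.
have cmZ (z : k) (p : dual S) : cm p -> cm (z *: p).
  by move=> hp; rewrite -[z *: p]addr0; apply: cmL => //; split; rewrite mulr0 mul0r.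
have cmB (p r : dual S) : cm p -> cm r -> cm (p - r).
  by move=> hp hr; rewrite addrC -scaleN1r; apply: cmL.
have cme : cm e by rewrite ee; exact: cmZ (cmB _ _ (cmB _ _ (cmZ _ _ _) (cmZ _ _ _)) (cmZ _ _ _)).
have cmf : cm f by rewrite ff; exact: cmZ (cmB _ _ (cmB _ _ (cmZ _ _ _) (cmZ _ _ _)) (cmZ _ _ _)).
have ef : e * f = f * e.
  by rewrite Rg q1 t0 al0 be0 ga1 g1 !scale0r !scale1r !addr0 addrK.
move: cma cmb cmc cmd cme cmf => [_ a2 a3 a4] [_ _ b3 b4] [_ _ _ c4] _ [e1' e2' e3' e4'] [f1' f2' f3' f4'].
apply: commuting; exact: (six_commute (And5 a2 a3 a4 (esym e1') (esym f1'))
  (And4 b3 b4 (esym e2') (esym f2')) (And3 c4 (esym e3') (esym f3')) (And3 (esym e4') (esym f4') ef)).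
Qed.
End Cases.

Definition normal_form (k : closedFieldType) (q t al be ga : k) : Prop :=
  [\/ [/\ t = 0, al = 0, be = 0 & forall n, (0 < n)%N -> q ^+ n != 1],
      q = 1 /\ t = 1,
      [/\ q = 1, t = 0, al = 1, be = 0 & ga = 0]
    | [/\ q = 1, t = 0, al = 0, be = 0 & ga = 1]].

Theorem normal_form_group_algebra (k : closedFieldType) (char0 : [pchar k] =i pred0) (H : falgType k)
    (S : hopf_structure H) (R : algType k) (act : H -> R -> R) (u v : R) (q t al be ga : k) :
  module_algebra S act -> inner_faithful S act ->
  v * u = q *: (u * v) + t *: (u * u) + al *: u + be *: v + ga%:A ->
  (forall c1 c2 c3 c4 c5 c6, comb u v c1 c2 c3 c4 c5 c6 = 0 ->
     [/\ c1 = 0, c2 = 0, c3 = 0, c4 = 0 & c5 = 0 /\ c6 = 0]) ->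
  generates (fun x => x = u \/ x = v) ->
  (forall h x, x = u \/ x = v -> exists c1 c2 c3 : k, act h x = c1 *: u + c2 *: v + c3%:A) ->
  q != 0 -> normal_form q t al be ga -> is_group_algebra S.
Proof.
move=> MA IF rel ind gen pres q0 nf.
have coef x : x = u \/ x = v -> exists a b e : dual S,
    forall h, act h x = (ev a h : k) *: u + (ev b h : k) *: v + (ev e h : k)%:A.
  move=> hx; have /boolp.choice[F FE] : forall h, exists c : k * k * k, act h x = c.1.1 *: u + c.1.2 *: v + c.2%:A.
    by move=> h; have [c1 [c2 [c3 E]]] := pres h x hx; exists (c1, c2, c3).
  (* Independence of u, v and 1 makes the chosen coefficients unique, hence linear in h. *)
  have FL z g h : [/\ (F (z *: g + h)).1.1 = z * (F g).1.1 + (F h).1.1,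
      (F (z *: g + h)).1.2 = z * (F g).1.2 + (F h).1.2 & (F (z *: g + h)).2 = z * (F g).2 + (F h).2].
    apply: (lin3_inj rel ind); rewrite -FE (lin_actl MA) !FE !scalerDr !scalerA !scalerDl.
    by rewrite [LHS](+%R.[AC (3*3) ((1*4)*(2*5)*(3*6))]).
  exists (dual_of S (fun h => (F h).1.1)), (dual_of S (fun h => (F h).1.2)), (dual_of S (fun h => (F h).2)) => h.
  by rewrite !dual_ofE // => z g1 g2; case: (FL z g1 g2).
have [a [b [e actu]]] := coef u (or_introl erefl); have [c [d [f actv]]] := coef v (or_intror erefl).
have am := a_mul MA rel ind actu actv; have bm := b_mul MA rel ind actu actv.
have cm := c_mul MA rel ind actu actv; have dm := d_mul MA rel ind actu actv.
have em := e_mul MA rel ind actu actv; have fm := f_mul MA rel ind actu actv.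
have [[a1 b1 e1] [c1 d1 f1]] := coefs_at_one MA rel ind actu actv.
have [[Ra Rb Rd] [Re Rf Rg]] := relations MA rel ind actu actv.
have cg := hdet_character MA rel ind actu actv.
have total : forall p, hopf_closure (entry a b c d e f) p.
  have [ea eb ec] : [/\ entry a b c d e f a, entry a b c d e f b & entry a b c d e f c]
    by rewrite /entry; split; tauto.
  have [ed ee ef] : [/\ entry a b c d e f d, entry a b c d e f e & entry a b c d e f f]
    by rewrite /entry; split; tauto.
  apply: (hopf_closure_total _ MA IF gen) => [p h|h h0 x].
    have H2 (x y : k) p1 p2 : entry a b c d e f p1 -> entry a b c d e f p2 ->
        hopf_closure (entry a b c d e f) (x *: p1 + y *: p2).
      by move=> h1 h2; apply: closure_D; apply: closure_Z; apply: closure_base.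
    have H3 (x y z : k) p1 p2 p3 : entry a b c d e f p1 -> entry a b c d e f p2 -> hopf_closure (entry a b c d e f) p3 ->
        hopf_closure (entry a b c d e f) (x *: p1 + y *: p2 + z *: p3).
      by move=> h1 h2 h3; apply: closure_D; [apply: H2 | apply: closure_Z].
    have cl1 := closure_1 (entry a b c d e f).
    have cle := closure_base ee; have clf := closure_base ef.
    move=> [->|[->|[->|[->|[->|->]]]]]; split.
    - by exists ((ev a h : k) *: a + (ev c h : k) *: b) => [|x]; [exact: H2|rewrite evD !evZ am].
    - by exists ((ev a h : k) *: a + (ev b h : k) *: c) => [|x]; [exact: H2|rewrite evD !evZ am mulrC [in RHS]mulrC; congr (_ + _); rewrite mulrC].
    - by exists ((ev b h : k) *: a + (ev d h : k) *: b) => [|x]; [exact: H2|rewrite evD !evZ bm].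
    - by exists ((ev a h : k) *: b + (ev b h : k) *: d) => [|x]; [exact: H2|rewrite evD !evZ bm mulrC; congr (_ + _); rewrite mulrC].
    - by exists ((ev a h : k) *: c + (ev c h : k) *: d) => [|x]; [exact: H2|rewrite evD !evZ cm].
    - by exists ((ev c h : k) *: a + (ev d h : k) *: c) => [|x]; [exact: H2|rewrite evD !evZ cm mulrC; congr (_ + _); rewrite mulrC].
    - by exists ((ev b h : k) *: c + (ev d h : k) *: d) => [|x]; [exact: H2|rewrite evD !evZ dm].
    - by exists ((ev c h : k) *: b + (ev d h : k) *: d) => [|x]; [exact: H2|rewrite evD !evZ dm mulrC; congr (_ + _); rewrite mulrC].
    - by exists ((ev e h : k) *: a + (ev f h : k) *: b + (counit S h : k) *: e) => [|x]; [exact: H3|rewrite !evD !evZ em].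
    - exists ((ev a h : k) *: e + (ev b h : k) *: f + (ev e h : k) *: 1) => [|x]; [exact: H3|rewrite !evD !evZ em ev1].
      by rewrite mulrC; congr (_ + _ + _); rewrite mulrC.
    - by exists ((ev e h : k) *: c + (ev f h : k) *: d + (counit S h : k) *: f) => [|x]; [exact: H3|rewrite !evD !evZ fm].
    - exists ((ev c h : k) *: e + (ev d h : k) *: f + (ev f h : k) *: 1) => [|x]; [exact: H3|rewrite !evD !evZ fm ev1].
      by rewrite mulrC; congr (_ + _ + _); rewrite mulrC.
  by move=> [->|->]; rewrite ?actu ?actv !h0 // !scale0r !addr0.
case: nf => [[t0 al0 be0 qn]|[q1 t1]|[q1 t0 al1 be0 ga0]|[q1 t0 al0 be0 ga1]].
- exact: (@quantum_plane_case _ char0 _ _ _ _ _ _ _ _ am bm cm dm em fm a1 b1 c1 d1 e1 f1 total _ _ _ _ q0 _ erefl cg Ra Rb Rd Re Rf).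
- exact: (@jordan_plane_case _ char0 _ _ _ _ _ _ _ _ am bm cm dm em fm a1 b1 c1 d1 e1 f1 total _ _ _ _ q0 _ erefl cg Ra Rb Rd Re Rf).
- exact: (@affine_case _ char0 _ _ _ _ _ _ _ _ am bm cm dm em fm a1 b1 c1 d1 e1 f1 total _ _ _ _ _ q0 _ erefl cg Ra Rb Rd Re Rf Rg).
exact: (@weyl_case _ char0 _ _ _ _ _ _ _ _ am bm cm dm em fm a1 b1 c1 d1 e1 f1 total _ _ _ _ _ q0 _ erefl cg Ra Rb Rd Re Rf Rg).
Qed.

(** * Normal forms of quadratic relations *)

Section Independence.
Variables (k : fieldType) (V : lmodType k).

Definition independent n (x : 'I_n -> V) := forall c : 'I_n -> k, \sum_i c i *: x i = 0 -> forall i, c i = 0.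

(** The matrix expressing the x_i in the y_j has trivial left kernel, so it is invertible and a
    relation among the y_j pulls back to one among the x_i. *)
Lemma exchange_independent n (x y : 'I_n -> V) : independent x ->
  (forall i, exists c : 'I_n -> k, x i = \sum_j c j *: y j) -> independent y.
Proof.
move=> ix /boolp.choice[c xE] d dy j.
pose M := \matrix_(i, j) c i j.
have xM (w : 'rV_n) : \sum_i w 0 i *: x i = \sum_j (w *m M) 0 j *: y j.
  under eq_bigr do rewrite xE scaler_sumr.
  rewrite exchange_big; apply: eq_bigr => l _; rewrite mxE scaler_suml.
  by apply: eq_bigr => i _; rewrite scalerA !mxE.
have Mu : M \in unitmx.
  rewrite -row_free_unit -kermx_eq0; apply/eqP/row_matrixP => i; rewrite row0.
  have := sub_kermxP (row_sub i (kermx M)); set w := row i _ => wM.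
  have := xM w; rewrite wM [RHS]big1 => [/ix w0|l _]; last by rewrite mxE scale0r.
  by apply/rowP => l; rewrite w0 mxE.
have := xM ((\row_j d j) *m invmx M); rewrite mulmxKV //.
rewrite [X in _ = X](_ : _ = 0) => [/ix w0|]; last first.
  by rewrite -[RHS]dy; apply: eq_bigr => l _; rewrite mxE.
have : (\row_j d j) *m invmx M = 0 by apply/rowP => l; rewrite w0 mxE.
move/(congr1 (mulmx^~ M)); rewrite mulmxKV // mul0mx => /rowP/(_ j).
by rewrite !mxE.
Qed.
End Independence.

Section QuadraticRelations.
Variables (k : closedFieldType) (char0 : [pchar k] =i pred0) (R : algType k).
Implicit Types (u v : R).

Definition lin3 u v (p1 p2 p3 : k) : R := p1 *: u + p2 *: v + p3%:A.
Definition comb7 u v (c1 c2 c3 c4 c5 c6 c7 : k) : R :=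
  c1 *: (u * u) + c2 *: (u * v) + c3 *: (v * u) + c4 *: (v * v) + c5 *: u + c6 *: v + c7%:A.

Lemma comb7D u v c1 c2 c3 c4 c5 c6 c7 d1 d2 d3 d4 d5 d6 d7 :
  comb7 u v c1 c2 c3 c4 c5 c6 c7 + comb7 u v d1 d2 d3 d4 d5 d6 d7 =
  comb7 u v (c1 + d1) (c2 + d2) (c3 + d3) (c4 + d4) (c5 + d5) (c6 + d6) (c7 + d7).
Proof. by rewrite /comb7 !scalerDl; do 6 (rewrite addrACA; congr (_ + _)). Qed.
Lemma comb7Z u v x c1 c2 c3 c4 c5 c6 c7 :
  x *: comb7 u v c1 c2 c3 c4 c5 c6 c7 = comb7 u v (x * c1) (x * c2) (x * c3) (x * c4) (x * c5) (x * c6) (x * c7).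
Proof. by rewrite /comb7 !scalerDr !scalerA. Qed.
Lemma lin3D u v c1 c2 c3 d1 d2 d3 : lin3 u v c1 c2 c3 + lin3 u v d1 d2 d3 = lin3 u v (c1 + d1) (c2 + d2) (c3 + d3).
Proof. by rewrite /lin3 !scalerDl; do 2 (rewrite addrACA; congr (_ + _)). Qed.
Lemma lin3Z u v x c1 c2 c3 : x *: lin3 u v c1 c2 c3 = lin3 u v (x * c1) (x * c2) (x * c3).
Proof. by rewrite /lin3 !scalerDr !scalerA. Qed.
Lemma lin3_comb7 u v c1 c2 c3 : lin3 u v c1 c2 c3 = comb7 u v 0 0 0 0 c1 c2 c3.
Proof. by rewrite /comb7 !scale0r !add0r. Qed.
Lemma lin3M u v p1 p2 p3 r1 r2 r3 : lin3 u v p1 p2 p3 * lin3 u v r1 r2 r3 =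
  comb7 u v (p1 * r1) (p1 * r2) (p2 * r1) (p2 * r2) (p1 * r3 + p3 * r1) (p2 * r3 + p3 * r2) (p3 * r3).
Proof.
rewrite /lin3 /comb7 !mulrDl !mulrDr -!scalerAl -!scalerAr !mul1r ?mulr1 !scalerA !scalerDl.
by rewrite [LHS](+%R.[AC (3*3*3) (1*2*4*5*(3*7)*(6*8)*9)]).
Qed.
Lemma lin3_1 u v c : lin3 u v 0 0 c = c%:A.
Proof. by rewrite /lin3 !scale0r !add0r. Qed.

Variable V : R -> Prop.
Definition spans3 u v := forall x, V x <-> exists c1 c2 c3, x = lin3 u v c1 c2 c3.

Definition qrel u v q t al be ga := v * u = q *: (u * v) + t *: (u * u) + al *: u + be *: v + ga%:A.

Definition quadratic q t al be ga := exists u v, spans3 u v /\ qrel u v q t al be ga.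

Lemma qrelE u v q t al be ga : qrel u v q t al be ga <-> comb7 u v (- t) (- q) 1 0 (- al) (- be) (- ga) = 0.
Proof.
have -> : comb7 u v (- t) (- q) 1 0 (- al) (- be) (- ga) =
    v * u - (q *: (u * v) + t *: (u * u) + al *: u + be *: v + ga%:A).
  rewrite /comb7 scale1r scale0r addr0 !scaleNr !opprD !addrA.
  by rewrite [LHS](+%R.[AC 6 (3*2*1*4*5*6)]).
by rewrite /qrel; split=> [->|/subr0_eq]; rewrite ?subrr.
Qed.

(** The new variables are p1 u + p2 v + p3 and r1 u + r2 v + r3. The seven equations say that the
    target relation, expanded in u and v, is [lam] times the given one. *)
Lemma change_basis p1 p2 p3 r1 r2 r3 x1 x2 x3 x4 l1 l2 l3 q t al be ga lam u v :
  spans3 u v -> comb7 u v x1 x2 x3 x4 l1 l2 l3 = 0 -> p1 * r2 - p2 * r1 != 0 ->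
  [/\ r1 * p1 - q * (p1 * r1) - t * (p1 * p1) = lam * x1,
      r1 * p2 - q * (p1 * r2) - t * (p1 * p2) = lam * x2,
      r2 * p1 - q * (p2 * r1) - t * (p2 * p1) = lam * x3 &
      r2 * p2 - q * (p2 * r2) - t * (p2 * p2) = lam * x4] ->
  [/\ r1 * p3 + r3 * p1 - q * (p1 * r3 + p3 * r1) - t * (p1 * p3 + p3 * p1) - al * p1 - be * r1 = lam * l1,
      r2 * p3 + r3 * p2 - q * (p2 * r3 + p3 * r2) - t * (p2 * p3 + p3 * p2) - al * p2 - be * r2 = lam * l2 &
      r3 * p3 - q * (p3 * r3) - t * (p3 * p3) - al * p3 - be * r3 - ga = lam * l3] ->
  quadratic q t al be ga.
Proof.
move=> sp rel D [E1 E2 E3 E4] [E5 E6 E7].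
exists (lin3 u v p1 p2 p3), (lin3 u v r1 r2 r3); split.
  move=> x; rewrite (sp x); split=> -[c1 [c2 [c3 ->]]].
    exists ((c1 * r2 - c2 * r1) / (p1 * r2 - p2 * r1)), ((c2 * p1 - c1 * p2) / (p1 * r2 - p2 * r1)),
      (c3 - (c1 * r2 - c2 * r1) / (p1 * r2 - p2 * r1) * p3 - (c2 * p1 - c1 * p2) / (p1 * r2 - p2 * r1) * r3).
    rewrite [RHS]/lin3 !lin3Z -(lin3_1 u v) !lin3D; congr lin3; field; exact: D.
  exists (c1 * p1 + c2 * r1), (c1 * p2 + c2 * r2), (c1 * p3 + c2 * r3 + c3).
  by rewrite [LHS]/lin3 !lin3Z -(lin3_1 u v) !lin3D !addr0.
rewrite /qrel !lin3M -(lin3_1 u v) !lin3Z !lin3_comb7 !comb7Z !comb7D.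
rewrite -[LHS]subr0 -(scaler0 _ lam) -rel -scaleNr comb7Z comb7D.
by congr comb7; apply/esym; [apply: (eq_of_subr (esym E1))|apply: (eq_of_subr (esym E2))|apply: (eq_of_subr (esym E3))
  |apply: (eq_of_subr (esym E4))|apply: (eq_of_subr (esym E5))|apply: (eq_of_subr (esym E6))|apply: (eq_of_subr (esym E7))]; ring.
Qed.

(** The quadratic part is a bilinear form, and over an algebraically closed field it has an
    isotropic vector; a basis adapted to it removes one square. Nondegeneracy keeps both mixed
    coefficients nonzero, so the relation can be solved for vu with q nonzero. *)
Lemma isotropic_basis u v x1 x2 x3 x4 l1 l2 l3 : spans3 u v -> comb7 u v x1 x2 x3 x4 l1 l2 l3 = 0 ->
  x1 * x4 - x2 * x3 != 0 -> exists q t al be ga, q != 0 /\ quadratic q t al be ga.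
Proof.
move=> sp rel D; have [x10|x10] := eqVneq x1 0.
  have [x20 x30] : x2 != 0 /\ x3 != 0.
    by move: D; rewrite x10 mul0r sub0r oppr_eq0 mulf_eq0 negb_or => /andP.
  exists (- x3 / x2), (- x4 / x2), (- l2 / x2), (- l1 / x2), (- l3 / x2).
  split; first by rewrite mulf_neq0 ?oppr_eq0 ?invr_eq0.
  apply: (@change_basis 0 1 0 1 0 0 _ _ _ _ _ _ _ _ _ _ _ _ x2^-1 _ _ sp rel).
  - by rewrite mul0r mul1r sub0r oppr_eq0 oner_eq0.
  - by rewrite x10; split; field.
  - by split; field.
(* s is a root of x1 s^2 - (x2 + x3) s + x4, the coefficient of vv once u is replaced by u' - s
   v. *)
have [s sE] := @solve_monicpoly k 2 (fun i => if i is 0 then - x4 / x1 else (x2 + x3) / x1) isT.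
have {}sE : x4 = (x2 + x3) * s - x1 * s ^+ 2.
  by rewrite sE !big_ord_recr big_ord0 /=; field.
have [x20 x30] : x2 - s * x1 != 0 /\ x3 - s * x1 != 0.
  apply/andP; rewrite -negb_or -mulf_eq0; apply: contra D => /eqP E.
  by rewrite sE -oppr_eq0; apply/eqP; rewrite -[RHS]E; ring.
pose z := (x3 - s * x1)^-1.
exists (- (x2 - s * x1) * z), (- x1 * z), (- l1 * z), (- (l2 - s * l1) * z), (- l3 * z).
split; first by rewrite mulf_neq0 ?oppr_eq0 ?invr_eq0.
apply: (@change_basis 1 s 0 0 1 0 _ _ _ _ _ _ _ _ _ _ _ _ z _ _ sp rel).
- by rewrite mulr0 mul1r subr0 oner_eq0.
- by rewrite sE /z; split; field.
by rewrite /z; split; field.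
Qed.

Definition normal_form_PI (q t al be ga : k) : Prop :=
  exists n, [/\ (0 < n)%N, q ^+ n = 1, q != 1 \/ ga = 0 & [/\ t = 0, al = 0 & be = 0]].

(** For q different from 1, adding (t / (q - 1)) u to v removes the square, and translations remove
    the linear terms. For q = 1 the first nonzero parameter among t, al, be, ga decides the form; if
    all vanish, u and v commute. *)
Lemma normal_form_exists q t al be ga : q != 0 -> quadratic q t al be ga ->
  exists q' t' al' be' ga', [/\ q' != 0, quadratic q' t' al' be' ga' &
    normal_form q' t' al' be' ga' \/ normal_form_PI q' t' al' be' ga'].
Proof.
move=> q0 [u [v [sp /qrelE rel]]].
have oner0 : (1 : k) != 0 by apply: oner_neq0.
have [q1|q1] := eqVneq q 1; last first.
  have q10 : q - 1 != 0 by rewrite subr_eq0.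
  have : quadratic q 0 (al - be * (t / (q - 1))) be ga.
    apply: (@change_basis 1 0 0 (t / (q - 1)) 1 0 _ _ _ _ _ _ _ _ _ _ _ _ 1 _ _ sp rel).
    - by rewrite mul0r mul1r subr0.
    - by split; field.
    - by split; field.
  move: (al - _) => al1 [u1 [v1 [sp1 /qrelE rel1]]].
  exists q, 0, 0, 0, (ga + (1 - q) * (be / (q - 1)) * (al1 / (q - 1))); split=> //.
    apply: (@change_basis 1 0 (be / (q - 1)) 0 1 (al1 / (q - 1)) _ _ _ _ _ _ _ _ _ _ _ _ 1 _ _ sp1 rel1).
    - by rewrite mul0r mul1r subr0.
    - by split; field.
    - by split; field.
  have [[n [n0 qn]]|nroot] := boolp.EM (exists n, (0 < n)%N /\ q ^+ n = 1).
    by right; exists n; split=> //; left.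
  by left; constructor 1; split=> // n n0; apply/eqP => qn; apply: nroot; exists n.
rewrite q1 in rel; have [t0|t0] := eqVneq t 0; last first.
  exists 1, 1, al, (t * be), (t * ga); split=> //; last by left; constructor 2.
  apply: (@change_basis t 0 0 0 1 0 _ _ _ _ _ _ _ _ _ _ _ _ t _ _ sp rel).
  - by rewrite mul0r mulr1 subr0.
  - by split; ring.
  - by split; ring.
rewrite t0 in rel; have [al0|al0] := eqVneq al 0; last first.
  exists 1, 0, 1, 0, 0; split=> //; last by left; constructor 3.
  apply: (@change_basis 1 (be / al) (ga / al) 0 al^-1 0 _ _ _ _ _ _ _ _ _ _ _ _ al^-1 _ _ sp rel).
  - by rewrite mulr0 mul1r subr0 invr_eq0.
  - by split; field.
  - by split; field.
rewrite al0 in rel; have [be0|be0] := eqVneq be 0; last first.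
  exists 1, 0, 1, 0, 0; split=> //; last by left; constructor 3.
  apply: (@change_basis 0 1 (ga / be) (- be^-1) 0 0 _ _ _ _ _ _ _ _ _ _ _ _ be^-1 _ _ sp rel).
  - by rewrite mul0r mul1r sub0r opprK invr_eq0.
  - by split; field.
  - by split; field.
rewrite be0 in rel; have [ga0|ga0] := eqVneq ga 0; last first.
  exists 1, 0, 0, 0, 1; split=> //; last by left; constructor 4.
  apply: (@change_basis 1 0 0 0 ga^-1 0 _ _ _ _ _ _ _ _ _ _ _ _ ga^-1 _ _ sp rel).
  - by rewrite mul0r mul1r subr0 invr_eq0.
  - by split; field.
  - by split; field.
exists 1, 0, 0, 0, 0; split=> //; last by right; exists 1%N; split=> //; right.
by exists u, v; split=> //; apply/qrelE; move: rel; rewrite ga0.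
Qed.

(** A lower bound for the dimension of F_2 that names no basis and so survives changes of variables.
    In any variables satisfying a solved relation it makes the six normally ordered monomials
    independent. *)
Definition dim6 : Prop := exists x : 'I_6 -> R, independent x /\
  forall i, exists y z, [/\ V y, V z & x i = y * z].

Lemma dim6_comb u v q t al be ga : dim6 -> spans3 u v -> qrel u v q t al be ga ->
  forall c1 c2 c3 c4 c5 c6, comb u v c1 c2 c3 c4 c5 c6 = 0 ->
  [/\ c1 = 0, c2 = 0, c3 = 0, c4 = 0 & c5 = 0 /\ c6 = 0].
Proof.
move=> [x [ix xP]] sp rel.
pose y (i : 'I_6) : R := nth 0 [:: u * u; u * v; v * v; u; v; 1] i.
pose cf6 (c1 c2 c3 c4 c5 c6 : k) (i : 'I_6) : k := nth 0 [:: c1; c2; c3; c4; c5; c6] i.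
have yE c1 c2 c3 c4 c5 c6 : \sum_i cf6 c1 c2 c3 c4 c5 c6 i *: y i = comb u v c1 c2 c3 c4 c5 c6.
  by rewrite !big_ord_recr big_ord0 /= add0r.
have iy : independent y.
  apply: (exchange_independent ix) => i; have [_ [_ [/sp[p1 [p2 [p3 ->]]] /sp[r1 [r2 [r3 ->]]] ->]]] := xP i.
  have : exists c1 c2 c3 c4 c5 c6, lin3 u v p1 p2 p3 * lin3 u v r1 r2 r3 = comb u v c1 c2 c3 c4 c5 c6.
    have := lin3M u v p1 p2 p3 r1 r2 r3; have /qrelE rel' := rel.
    rewrite -[X in _ = X -> _]subr0 -(scaler0 _ (p2 * r1)) -rel' -scaleNr comb7Z comb7D => ->.
    move: (_ + _ * - t) (_ + _ * - q) (_ + _ * 0) (_ + _ * - al) (_ + _ * - be) (_ + _ * - ga) => d1 d2 d4 d5 d6 d7.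
    exists d1, d2, d4, d5, d6, d7; rewrite /comb7 /comb mulr1 addrN scale0r addr0 //.
  by move=> [c1 [c2 [c3 [c4 [c5 [c6 ->]]]]]]; exists (cf6 c1 c2 c3 c4 c5 c6).
move=> c1 c2 c3 c4 c5 c6; rewrite -yE => /iy h.
by split; last split; [exact: h (@Ordinal 6 0 isT)|exact: h (@Ordinal 6 1 isT)|exact: h (@Ordinal 6 2 isT)
  |exact: h (@Ordinal 6 3 isT)|exact: h (@Ordinal 6 4 isT)|exact: h (@Ordinal 6 5 isT)].
Qed.
End QuadraticRelations.

(** * Polynomial identities *)

Section MalgMap.
Variables (B : nzRingType) (K : choiceType) (V : lmodType B) (F : K -> V).
Implicit Types f : {malg B[K]}.

Definition malg_map f : V := \sum_(w <- msupp f) mcoeff w f *: F w.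

Lemma malg_mapEw (d : {fset K}) f : fsubset (msupp f) d -> malg_map f = \sum_(w <- d) mcoeff w f *: F w.
Proof.
by move=> le; rewrite [LHS](big_fset_incl _ le) => //= x xd /mcoeff_outdom ->; rewrite scale0r.
Qed.

Lemma malg_map_linear a f g : malg_map (a *: f + g) = a *: malg_map f + malg_map g.
Proof.
pose d := fsetU (msupp (a *: f + g)) (fsetU (msupp f) (msupp g)).
rewrite !(@malg_mapEw d) ?fsubsetUl //; last 2 first.
- by rewrite fsubsetU // fsubsetUr orbT.
- by rewrite fsubsetU // fsubsetUl orbT.
rewrite scaler_sumr -big_split; apply: eq_bigr => w _.
by rewrite mcoeffD mcoeffZ scalerDl scalerA.
Qed.

Lemma malg_mapU w c : malg_map (mkmalgU w c) = c *: F w.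
Proof. by rewrite (malg_mapEw msuppU_le) big_seq_fset1 mcoeffUU. Qed.
End MalgMap.

Section WordMap.
Variables (k : fieldType) (I : choiceType) (V : lmodType k) (F : {fmonom I} -> V).

Definition word_map (f : free_alg k I) : V := malg_map F f.

Lemma word_map_lin : lin word_map. Proof. exact: malg_map_linear. Qed.
Lemma word_mapU w c : word_map (mkmalgU w c) = c *: F w. Proof. exact: malg_mapU. Qed.
End WordMap.

Section StandardIdentity.
Variables (k : closedFieldType) (char0 : [pchar k] =i pred0) (R : algType k).

Section Standard.
Variable N : nat.
Implicit Type x : 'I_N -> R.

Definition standard x : R := \sum_(s : 'S_N) (-1) ^+ s *: \prod_(i : 'I_N) x (s i).

Lemma standard_alternating x i j : i != j -> x i = x j -> standard x = 0.
Proof.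
move=> ij xij; have E : standard x = - standard x.
  rewrite {1}/standard (reindex_inj (mulIg (tperm i j))) /= /standard -sumrN.
  apply: eq_bigr => s _; rewrite odd_permM odd_tperm ij signr_addb mulrN1 scaleNr; congr (- (_ *: _)).
  by apply: eq_bigr => l _; rewrite permM; case: tpermP => [->|->|].
have /eqP : standard x + standard x = 0 by rewrite {2}E addrN.
by rewrite -mulr2n -scaler_nat scaler_eq0 (negPf (natr_neq0 char0 _)) // => /eqP.
Qed.

Definition slot x i (r : R) : 'I_N -> R := fun j => if j == i then r else x j.

Lemma standard_slot x i z r r' : (forall y, z * y = y * z) ->
  standard (slot x i (z * r + r')) = z * standard (slot x i r) + standard (slot x i r').
Proof.
move=> zc; rewrite /standard mulr_sumr -big_split; apply: eq_bigr => s _ /=.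
rewrite -scalerAr -scalerDr; congr (_ *: _).
rewrite -!(big_map s predT (fun j => slot x i _ j)) /=.
have : uniq [seq s j | j <- index_enum 'I_N] by rewrite map_inj_uniq ?index_enum_uniq //; apply: perm_inj.
have : i \in [seq s j | j <- index_enum 'I_N].
  by apply/mapP; exists (s^-1%g i); rewrite ?mem_index_enum // permKV.
move/splitPr => [p1 p2]; rewrite cat_uniq => /= /and4P[_ /norP[ip1 _] ip2 _].
have E r0 p : i \notin p -> \prod_(j <- p) slot x i r0 j = \prod_(j <- p) x j.
  move=> ip; apply: eq_big_seq => j jp; rewrite /slot; case: eqP => // ji.
  by rewrite -ji jp in ip.
rewrite !big_cat /= !big_cons !(E _ p1) // !(E _ p2) // /slot eqxx.
by rewrite mulrDl mulrDr !mulrA -zc.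
Qed.

Definition standard_poly : free_alg k 'I_N :=
  \sum_(s : 'S_N) mkmalgU (FMonom [seq s i | i <- index_enum 'I_N]) ((-1) ^+ s).

Lemma standard_poly_neq0 : standard_poly <> 0.
Proof.
move=> /(congr1 (mcoeff (FMonom [seq (1%g : 'S_N) i | i <- index_enum 'I_N]))).
rewrite mcoeff0 /standard_poly raddf_sum /= (bigD1 1%g) //= mcoeffUU odd_perm1 expr0 big1 ?addr0.
  by move/eqP; rewrite oner_eq0.
move=> s s1; rewrite mcoeffU; case: eqP => // -[/eq_in_map E].
by case/eqP: s1; apply/permP => i; rewrite E ?mem_index_enum.
Qed.

Lemma free_eval_standard x : free_eval x standard_poly = standard x.
Proof.
rewrite -[LHS]/(word_map (fun w => \prod_(i <- fmonom_val w) x i) _).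
rewrite /standard_poly (linS (word_map_lin _)); apply: eq_bigr => s _.
by rewrite word_mapU big_map.
Qed.
End Standard.

(** The standard polynomial of degree n + 1 is multilinear over the centre and alternating; with
    arguments among n module generators two of them coincide. *)
Lemma finite_over_center_PI n (m : 'I_n -> R) :
  (forall P : R -> Prop, (forall i, P (m i)) ->
    (forall z r r', (forall y, z * y = y * z) -> P r -> P r' -> P (z * r + r')) -> forall r, P r) -> PI R.
Proof.
move=> gen; exists n.+1, (standard_poly n.+1); split; first exact: standard_poly_neq0.
move=> x; rewrite free_eval_standard.
(* [l] counts the slots that may still hold arbitrary elements; all slots from [l] on hold
   generators. Each step expands one slot over the centre. *)
suff h l : (l <= n.+1)%N -> forall x : 'I_n.+1 -> R,
    (forall i : 'I_n.+1, (l <= i)%N -> exists j, x i = m j) -> standard x = 0.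
  by apply: (h n.+1 _ x) => // i; rewrite leqNgt ltn_ord.
elim: l => [_|l IH ln] {}x xm.
  have /boolp.choice[j jP] : forall i, exists j, x i = m j by move=> i; apply: xm.
  have /injectivePn[i1 [i2 i12 E]] : ~~ injectiveb j.
    by apply/negP => /injectiveP/leq_card; rewrite !card_ord ltnn.
  by apply: (standard_alternating i12); rewrite !jP E.
have [r rE] : exists r, r = x (Ordinal ln) by exists (x (Ordinal ln)).
have -> : x = slot x (Ordinal ln) r.
  by apply: boolp.funext => j; rewrite /slot; case: eqP => [->|].
move: r {rE}; apply: gen => [j|z r r' zc hr hr'].
  apply: IH => [|i li]; first exact: ltnW.
  rewrite /slot; case: eqP => [_|ni]; first by exists j.
  apply: xm; rewrite ltn_neqAle li andbT; apply/eqP => E; apply: ni; exact: val_inj.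
by rewrite standard_slot // hr hr' mulr0 addr0.
Qed.
End StandardIdentity.

Section QuantumWeylPI.
Variables (k : closedFieldType) (char0 : [pchar k] =i pred0) (R : algType k) (u v : R) (q ga : k).
Hypothesis rel : v * u = q *: (u * v) + ga%:A.
Hypothesis gen : generates (fun x => x = u \/ x = v).

(** The q-integer of m. It vanishes at m = n when q is different from 1 and q^n = 1. *)
Let qn m : k := \sum_(i < m) q ^+ i.

Lemma qn_recr m : qn m.+1 = qn m + q ^+ m.
Proof. by rewrite /qn big_ord_recr. Qed.

Lemma comm_powl m : v * u ^+ m = q ^+ m *: (u ^+ m * v) + (ga * qn m) *: u ^+ m.-1.
Proof.
elim: m => [|m IH]; first by rewrite /qn big_ord0 mulr0 scale0r addr0 expr0 scale1r mulr1 mul1r.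
rewrite exprSr mulrA IH mulrDl -!scalerAl -(mulrA (u ^+ m) v u) rel mulrDr -scalerAr -scalerAr mulr1 !mulrA -!exprSr.
rewrite scalerDr !scalerA -addrA -exprSr; congr (_ + _).
have -> : (ga * qn m) *: (u ^+ m.-1.+1) = (ga * qn m) *: u ^+ m.
  by case: m {IH} => [|m] //; rewrite /qn big_ord0 mulr0 !scale0r.
by rewrite -scalerDl qn_recr mulrDr [q ^+ m * ga]mulrC addrC.
Qed.

Lemma comm_powr m : v ^+ m * u = q ^+ m *: (u * v ^+ m) + (ga * qn m) *: v ^+ m.-1.
Proof.
elim: m => [|m IH]; first by rewrite /qn big_ord0 mulr0 scale0r addr0 expr0 scale1r mulr1 mul1r.
rewrite exprS -mulrA IH mulrDr -!scalerAr (mulrA v u) rel mulrDl -!scalerAl mul1r -(mulrA u) -!exprS.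
rewrite scalerDr !scalerA -addrA -exprSr; congr (_ + _).
have -> : (ga * qn m) *: (v ^+ m.-1.+1) = (ga * qn m) *: v ^+ m.
  by case: m {IH} => [|m]; rewrite -?exprS // /qn big_ord0 mulr0 !scale0r.
by rewrite -scalerDl qn_recr mulrDr [q ^+ m * ga]mulrC addrC.
Qed.

Lemma ordered_monomials_span (P : R -> Prop) : (forall i j, P (u ^+ i * v ^+ j)) ->
  (forall a x y, P x -> P y -> P (a *: x + y)) -> forall x, P x.
Proof.
move=> P0 PL x.
(* Q is the span of the ordered monomials, given by its elimination principle; [comm_powr] shows
   that it absorbs right multiplication by u. *)
pose Q x := forall P : R -> Prop, (forall i j, P (u ^+ i * v ^+ j)) ->
  (forall a x y, P x -> P y -> P (a *: x + y)) -> P x.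
have QL a y z : Q y -> Q z -> Q (a *: y + z) by move=> Qy Qz P' h1 h2; apply: (h2); [apply: Qy|apply: Qz].
have Qm i j : Q (u ^+ i * v ^+ j) by move=> P' h1 _; apply: h1.
have Q0 : Q 0 by rewrite -(addNr (u ^+ 0 * v ^+ 0)) -scaleN1r; apply: QL; apply: Qm.
suff : Q x by apply.
apply: gen; [by have := Qm 0%N 0%N; rewrite mulr1 | exact: QL |].
move=> {}x b Qx hb; apply: (Qx (fun x => Q (x * b))) => [i j|a y z hy hz]; last by rewrite mulrDl -scalerAl; apply: QL.
case: hb => ->; last by rewrite -mulrA -exprSr.
rewrite -mulrA comm_powr mulrDr -!scalerAr mulrA -exprSr.
by apply: (QL) => //; rewrite -[(ga * _) *: _]addr0; apply: QL.
Qed.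

(** u^n and v^n are central: the correction term in the power commutation rule carries the factor ga
    [n]_q, which is zero under either alternative. So R is spanned over its centre by n^2
    monomials. *)
Lemma quantum_weyl_PI n : (0 < n)%N -> q ^+ n = 1 -> q != 1 \/ ga = 0 -> PI R.
Proof.
move=> n0 qn1 hq.
have gaq : ga * qn n = 0.
  case: hq => [q1|->]; last by rewrite mul0r.
  suff -> : qn n = 0 by rewrite mulr0.
  apply: (@mulfI _ (q - 1)); first by rewrite subr_eq0.
  by rewrite /qn -subrX1 qn1 subrr mulr0.
have cU y : u ^+ n * y = y * u ^+ n.
  apply: (@gen (fun y => u ^+ n * y = y * u ^+ n)) => [|a x1 x2 hx hy|x b hx hb]; first by rewrite mulr1 mul1r.
    by rewrite mulrDl mulrDr -scalerAl -scalerAr hx hy.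
  rewrite mulrA hx -!mulrA; congr (_ * _); case: hb => ->; first by rewrite -exprS -exprSr.
  by rewrite comm_powl qn1 gaq scale1r scale0r addr0.
have cV y : v ^+ n * y = y * v ^+ n.
  apply: (@gen (fun y => v ^+ n * y = y * v ^+ n)) => [|a x1 x2 hx hy|x b hx hb]; first by rewrite mulr1 mul1r.
    by rewrite mulrDl mulrDr -scalerAl -scalerAr hx hy.
  rewrite mulrA hx -!mulrA; congr (_ * _); case: hb => ->; last by rewrite -exprS -exprSr.
  by rewrite comm_powr qn1 gaq scale1r scale0r addr0.
have cX z m : (forall y, z * y = y * z) -> forall y : R, z ^+ m * y = y * z ^+ m.
  move=> zc y; elim: m => [|m IH]; first by rewrite mul1r mulr1.
  by rewrite exprS -mulrA IH mulrA zc mulrA.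
(* The monomials u^i v^j with i, j < n, coded by the single index l = i n + j. *)
apply: (@finite_over_center_PI _ char0 _ (n * n) (fun l => u ^+ (l %/ n) * v ^+ (l %% n))) => P Pm PL.
have nn0 : (0 < n * n)%N by rewrite muln_gt0 n0.
have P0 : P 0.
  have := PL (- 1) _ _ _ (Pm (Ordinal nn0)) (Pm (Ordinal nn0)); rewrite mulN1r addNr; apply.
  by move=> y; rewrite mulN1r mulrN1.
have PZ z r : (forall y, z * y = y * z) -> P r -> P (z * r).
  by move=> zc Pr; rewrite -[z * r]addr0; apply: PL.
apply: ordered_monomials_span => [i j|a x y Px Py]; last first.
  by rewrite -mulr_algl; apply: PL => // z; rewrite mulr_algl mulr_algr.
rewrite (divn_eq i n) (divn_eq j n) !exprD !(mulnC _ n) !exprM -!mulrA.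
apply: (PZ); first exact: cX.
rewrite mulrA -(cX _ _ cV) -mulrA; apply: (PZ); first exact: cX.
have ij : ((i %% n) * n + j %% n < n * n)%N.
  have := ltn_pmod i n0; have := ltn_pmod j n0; nia.
have := Pm (Ordinal ij); rewrite /= divnMDl // modnMDl modn_mod.
by rewrite (divn_small (ltn_pmod j n0)) addn0.
Qed.
End QuantumWeylPI.

Theorem quadratic_action (k : closedFieldType) (char0 : [pchar k] =i pred0) (H : falgType k)
    (S : hopf_structure H) (R : algType k) (act : H -> R -> R) (V : R -> Prop) u v x1 x2 x3 x4 l1 l2 l3 :
  module_algebra S act -> inner_faithful S act -> (forall h x, V x -> V (act h x)) ->
  generates V -> ~ PI R -> spans3 V u v -> dim6 V ->
  comb7 u v x1 x2 x3 x4 l1 l2 l3 = 0 -> x1 * x4 - x2 * x3 != 0 -> is_group_algebra S.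
Proof.
move=> MA IF pres gen nPI sp d6 rel D.
have [q [t [al [be [ga [q0 Q]]]]]] := isotropic_basis sp rel D.
have [q' [t' [al' [be' [ga' [q0' [u1 [v1 [sp1 rel1]]] nf]]]]]] := normal_form_exists q0 Q.
have Vuv x : x = u1 \/ x = v1 -> V x.
  by move=> [->|->]; apply/sp1; [exists 1, 0, 0|exists 0, 1, 0]; rewrite /lin3 scale1r !scale0r !addr0 ?add0r.
have gen1 : generates (fun x => x = u1 \/ x = v1).
  move=> P P1 PL PM x; apply: gen x => // x b Px /sp1[c1 [c2 [c3 ->]]].
  have P0 : P 0 by rewrite -(addNr (1 : R)) -scaleN1r; apply: PL.
  rewrite /lin3 !mulrDr -!scalerAr mulr1 -addrA; apply: (PL); first by apply: (PM) => //; left.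
  apply: (PL); first by apply: (PM) => //; right.
  by rewrite -[_ *: x]addr0; apply: PL.
case: nf => [nf|[n [n0 qn hq [t0 al0 be0]]]].
  apply: (normal_form_group_algebra char0 MA IF rel1 (dim6_comb d6 sp1 rel1) gen1 _ q0' nf).
  by move=> h x /Vuv/(pres h)/sp1.
case: nPI; apply: (quantum_weyl_PI char0 _ gen1 n0 qn hq).
by rewrite rel1 t0 al0 be0 !scale0r !addr0.
Qed.

(** * Artin-Schelter regular algebras of dimension 2 *)

Section GradedComponents.
Variables (k : fieldType) (A : algType k) (grade : nat -> A -> Prop).
Hypothesis cg : connected_graded grade.

Lemma grade0 n : grade n 0. Proof. by case: cg => h _ _ _ _; case: (h n). Qed.
Lemma gradeL n a x y : grade n x -> grade n y -> grade n (a *: x + y).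
Proof. by case: cg => h _ _ _ _; case: (h n) => _; apply. Qed.
Lemma gradeZ n a x : grade n x -> grade n (a *: x).
Proof. by move=> hx; rewrite -[_ *: _]addr0; apply: gradeL => //; apply: grade0. Qed.
Lemma gradeM m n x y : grade m x -> grade n y -> grade (m + n) (x * y).
Proof. by case: cg => _ _ _ _; apply. Qed.
Lemma grade0P x : grade 0 x <-> exists a : k, x = a%:A.
Proof. by case: cg. Qed.

Lemma comp_exists a : {f : nat -> A | (forall i, grade i (f i)) /\
  exists N, (forall i, (N <= i)%N -> f i = 0) /\ a = \sum_(i < N) f i}.
Proof.
apply: boolp.cid; case: cg => _ [h _] _ _ _; have [N [f [fg ->]]] := h a.
exists (fun i => if (i < N)%N then f i else 0); split=> [i|].
  by case: ifP => // _; exact: grade0.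
exists N; split=> [i|]; first by rewrite ltnNge => ->.
by apply: eq_bigr => i _; rewrite ltn_ord.
Qed.
Definition hcomp i a := sval (comp_exists a) i.

Lemma comp_grade i a : grade i (hcomp i a).
Proof. by rewrite /hcomp; case: comp_exists => f []. Qed.

Lemma sum_widen (N M : nat) (f : nat -> A) : (N <= M)%N -> (forall i, (N <= i)%N -> f i = 0) ->
  \sum_(i < N) f i = \sum_(i < M) f i.
Proof.
move=> NM f0; rewrite (big_ord_widen _ f NM) [RHS](bigID (fun i : 'I_M => (i < N)%N)) /=.
by rewrite [X in _ = _ + X]big1 ?addr0 // => i; rewrite -leqNgt => /f0.
Qed.

Lemma compE a : exists N, forall M, (N <= M)%N -> a = \sum_(i < M) hcomp i a /\ hcomp M a = 0.
Proof.
rewrite /hcomp; case: comp_exists => f [fg [N [f0 aE]]] /=; exists N => M NM.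
by split; [rewrite {1}aE; apply: sum_widen | apply: f0].
Qed.

Lemma comp_unique N (f : nat -> A) : (forall i, grade i (f i)) -> (forall i, (N <= i)%N -> f i = 0) ->
  forall m, hcomp m (\sum_(i < N) f i) = f m.
Proof.
move=> fg f0 m; have [M hM] := compE (\sum_(i < N) f i).
pose L := maxn (maxn M N) m.+1.
have [|E _] := hM L; first by rewrite /L; lia.
case: cg => _ [_ h] _ _ _.
apply/eqP; rewrite -subr_eq0; apply/eqP.
apply: (h L (fun i => hcomp i (\sum_(i < N) f i) - f i)) => [i||]; last by rewrite /L; lia.
  by rewrite addrC -scaleN1r; apply: gradeL => //; apply: comp_grade.
rewrite sumrB -E; apply/eqP; rewrite subr_eq0; apply/eqP; apply: sum_widen => //; rewrite /L; lia.
Qed.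

Lemma comp_lin m : lin (hcomp m).
Proof.
move=> z a b; have [N1 h1] := compE a; have [N2 h2] := compE b.
have [Ea _] := h1 (maxn N1 N2) (leq_maxl _ _); have [Eb _] := h2 (maxn N1 N2) (leq_maxr _ _).
rewrite {1}Ea {1}Eb scaler_sumr -big_split.
apply: (@comp_unique _ (fun i => z *: hcomp i a + hcomp i b)) => i; last first.
  rewrite geq_max => /andP[/h1[_ ->] /h2[_ ->]]; by rewrite scaler0 addr0.
by apply: gradeL; apply: comp_grade.
Qed.

Lemma comp_hom m r a : grade r a -> hcomp m a = if m == r then a else 0.
Proof.
move=> ga; have := @comp_unique r.+1 (fun i => if i == r then a else 0) _ _ m.
rewrite big_ord_recr /= eqxx big1 ?add0r => [|i _]; last by rewrite ltn_eqF.
apply=> [i|i ri]; first by case: eqP => [->//|_]; exact: grade0.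
by rewrite gtn_eqF.
Qed.

Lemma comp_mull m r a b : grade r a -> hcomp m (a * b) = if (r <= m)%N then a * hcomp (m - r) b else 0.
Proof.
move=> ga; have [N h] := compE b; have [E _] := h N (leqnn N).
have := @comp_unique (r + N) (fun i => if (r <= i)%N then a * hcomp (i - r) b else 0) _ _ m.
rewrite big_split_ord /= big1 ?add0r => [|i _]; last by rewrite leqNgt ltn_ord.
under eq_bigr do rewrite leq_addr addKn.
rewrite -mulr_sumr -E; apply=> [i|i ri].
  by case: ifP => ri; [rewrite -{1}(subnKC ri); apply: gradeM => //; apply: comp_grade | apply: grade0].
case: ifP => // ri'; have [|_ ->] := h (i - r)%N; [lia|by rewrite mulr0].
Qed.

Lemma comp_mulr m r a b : grade r b -> hcomp m (a * b) = if (r <= m)%N then hcomp (m - r) a * b else 0.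
Proof.
move=> gb; have [N h] := compE a; have [E _] := h N (leqnn N).
have := @comp_unique (r + N) (fun i => if (r <= i)%N then hcomp (i - r) a * b else 0) _ _ m.
rewrite big_split_ord /= big1 ?add0r => [|i _]; last by rewrite leqNgt ltn_ord.
under eq_bigr do rewrite leq_addr addKn.
rewrite -mulr_suml -E; apply=> [i|i ri].
  by case: ifP => ri; [rewrite -{1}(subnK ri); apply: gradeM => //; apply: comp_grade | apply: grade0].
case: ifP => // ri'; have [|_ ->] := h (i - r)%N; [lia|by rewrite mul0r].
Qed.

Variable eps : {rmorphism A -> k}.
Hypothesis aug : augmentation grade eps.

Lemma comp0E a : hcomp 0 a = (eps a)%:A.
Proof.
have [N h] := compE a; have [E _] := h N.+1 (leqnSn N).
rewrite [in RHS]E raddf_sum big_ord_recl big1 ?addr0 /= => [|i _]; last first.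
  by case: aug => _; apply; [|apply: comp_grade].
by have /grade0P[c ->] := comp_grade 0 a; case: aug => ->.
Qed.
End GradedComponents.

Section Linear.
Variables (B : pzRingType) (U V : lmodType B) (f : U -> V).
Hypothesis fL : forall a x y, f (a *: x + y) = a *: f x + f y.
Definition mk_linear : {linear U -> V} := HB.pack f (GRing.isLinear.Build B U V *:%R f fL).
Lemma mk_linearE x : mk_linear x = f x. Proof. by []. Qed.
End Linear.

Section DualBasis.
Variables (B : nzRingType) (P : lmodType B).
Hypothesis projP : projective P.

(** P is a split quotient of the free module on its own underlying set; the coordinates of [s] are
    the dual basis functionals. *)
Lemma dual_basis : exists s : {linear P -> {malg B[P]}}, forall p, malg_map id (s p) = p.
Proof.
apply: (@projP _ _ (mk_linear (malg_map_linear id)) idfun) => p.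
by exists (mkmalgU p 1); rewrite mk_linearE malg_mapU scale1r.
Qed.

(** The map g has to reach only the image of f. This is what lifting along [syz_map] requires, since
    its image is just the augmentation ideal. *)
Lemma projective_lift (M N : lmodType B) (g : {linear M -> N}) (f : {linear P -> N}) :
  (forall p, exists m, g m = f p) -> exists h : {linear P -> M}, forall p, g (h p) = f p.
Proof.
move=> /boolp.choice[y yE]; have [s sE] := dual_basis.
have hL a p p' : malg_map y (s (a *: p + p')) = a *: malg_map y (s p) + malg_map y (s p').
  by rewrite linearP malg_map_linear.
exists (mk_linear hL) => p; rewrite mk_linearE -[in RHS](sE p) /malg_map !linear_sum.
by apply: eq_bigr => j _; rewrite !linearZ /= yE.
Qed.
End DualBasis.

(** * Syzygies read off from Ext groups *)

Section Syzygies.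
Variables (k : fieldType) (A : algType k) (eps : {rmorphism A -> k}) (n : nat) (x : 'I_n -> A).

Definition syz_map (y : 'rV[A]_n) : A^o := \sum_i y 0 i * x i.
Local Notation d := syz_map.

Lemma syz_mapL a y z : d (a *: y + z) = a *: d y + d z.
Proof.
rewrite /d [X in _ = X + _]/GRing.scale /= mulr_sumr -big_split; apply: eq_bigr => i _.
by rewrite !mxE mulrDl mulrA.
Qed.
HB.instance Definition _ := GRing.isLinear.Build A 'rV[A]_n A^o *:%R d syz_mapL.

(** The submodule A_+ Z of the syzygies Z, with A_+ the kernel of [eps]; the quotient Z / A_+ Z
    counts the minimal relations. *)
Inductive aug_syz : 'rV[A]_n -> Prop :=
| aug_syz0 : aug_syz 0
| aug_syzS c z y : eps c = 0 -> d z = 0 -> aug_syz y -> aug_syz (c *: z + y).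

Lemma aug_syzD y z : aug_syz y -> aug_syz z -> aug_syz (y + z).
Proof.
move=> hy hz; elim: hy => [|c w {}y ec dw _ IH]; first by rewrite add0r.
by rewrite -addrA; apply: aug_syzS.
Qed.
Lemma aug_syz_sum (J : Type) (r : seq J) (c : J -> A) (z : J -> 'rV[A]_n) :
  (forall j, eps (c j) = 0) -> (forall j, d (z j) = 0) -> aug_syz (\sum_(j <- r) c j *: z j).
Proof.
move=> hc hz; elim: r => [|j r IH]; first by rewrite big_nil; apply: aug_syz0.
by rewrite big_cons; apply: aug_syzS.
Qed.

Hypothesis eps_scal : forall c : k, eps c%:A = c.
Hypothesis aug_ideal : forall a, eps a = 0 <-> exists y, a = d y.
Hypothesis syz_aug : forall z i, d z = 0 -> eps (z 0 i) = 0.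
Hypothesis gl2 : gldim_le A 2.
Hypothesis gor : gorenstein eps 2.

(* The comparison maps between a projective resolution P of k and the start A^n -> A of the
   minimal resolution translate the Ext groups computed from P into statements on syzygies. *)
Lemma gorenstein_syzygies :
  [/\ exists (beta : 'rV[A]_n -> k) (w : 'rV[A]_n),
        [/\ d w = 0,
            forall z, d z = 0 -> exists y, aug_syz y /\ z = (beta z)%:A *: w + y
          & forall z j, d z = 0 -> exists (phi : A) (c : 'I_n -> A),
              eps phi = beta z /\ phi * x j = \sum_i z 0 i * c i],
      (0 < n)%N -> exists z, d z = 0 /\ z != 0
    & forall r : A, (forall a, eps a = 0 -> a * r = 0) -> r = 0].
Proof.
have [P Pz] := gl2 (trivial_mod eps); have [Evan [phi [phiD phiM phiS phi0]]] := gor P.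
(* P has length two, so every functional on P_2 is a cocycle and represents a class of Ext^2. *)
have coc2 (f : {linear P 2%N -> A^o}) : cocycle f by move=> y; rewrite (Pz 3%N isT y) !linear0.
have [p0 p0E] := res_aug_surj P (1 : k).
have epsLin a (y z : A^o) : (eps (a *: y + z) : trivial_mod eps) = a *: (eps y : trivial_mod eps) + eps z.
  by rewrite rmorphD; congr (_ + _); rewrite [in LHS]/GRing.scale /= rmorphM.
pose epsL : {linear A^o -> trivial_mod eps} := mk_linear epsLin.
have [|g0 g0E] := @res_proj _ _ P 0%N _ _ epsL (res_aug P).
  by move=> c; exists (c : k)%:A; apply: eps_scal.
have g0E' p : eps (g0 p) = res_aug P p by rewrite -g0E.
have augdiff p : res_aug P (res_diff P 0%N p) = 0 by apply/res_exact0; exists p.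
have /boolp.choice[q qE] : forall i, exists q, res_diff P 0%N q = x i *: p0.
  move=> i; apply/res_exact0; rewrite linearZ /= p0E.
  suff E : eps (x i) = 0 by rewrite -[LHS]/(eps (x i) * 1) E mul0r.
  apply/aug_ideal; exists (delta_mx 0 i); rewrite /d (bigD1 i) //= big1 ?addr0 => [|j ji].
    by rewrite mxE !eqxx mul1r.
  by rewrite mxE (negPf ji) andbF mul0r.
have f1L a (y z : 'rV[A]_n) : \sum_i (a *: y + z) 0 i *: q i = a *: (\sum_i y 0 i *: q i) + \sum_i z 0 i *: q i.
  by rewrite scaler_sumr -big_split; apply: eq_bigr => i _; rewrite !mxE scalerDl scalerA.
pose f1 : {linear 'rV[A]_n -> P 1%N} := mk_linear f1L.
have f1E y : f1 y = \sum_i y 0 i *: q i by [].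
have df1 y : res_diff P 0%N (f1 y) = d y *: p0.
  by rewrite f1E linear_sum /d scaler_suml; apply: eq_bigr => i _; rewrite linearZ /= qE scalerA.
have g0dL a p p' : g0 (res_diff P 0%N (a *: p + p')) = a *: g0 (res_diff P 0%N p) + g0 (res_diff P 0%N p').
  by rewrite !linearP.
have [|g1 g1E] := @projective_lift _ _ (@res_proj _ _ P 1%N) _ _ d (mk_linear g0dL).
  by move=> p; rewrite mk_linearE; have /aug_ideal[y ->] : eps (g0 (res_diff P 0%N p)) = 0;
    [rewrite g0E' augdiff | exists y].
have {}g1E p : d (g1 p) = g0 (res_diff P 0%N p) by rewrite g1E.
have [y0 y0E] : exists y, (g0 p0 : A) - 1 = d y.
  by apply/aug_ideal; rewrite rmorphB rmorph1 g0E' p0E subrr.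
have h1L a (y z : 'rV[A]_n) : g1 (f1 (a *: y + z)) - (a *: y + z) - d (a *: y + z) *: y0 =
   a *: (g1 (f1 y) - y - d y *: y0) + (g1 (f1 z) - z - d z *: y0).
  rewrite !linearP /= ?scalerN !scalerDl -scalerA !scalerBr !opprD !addrA.
  by rewrite [LHS](+%R.[AC 6 (1*3*5*2*4*6)]).
(* The failure of g1 f1 to be the identity, corrected by y0; it takes values in the syzygies. *)
pose h1 : {linear 'rV[A]_n -> 'rV[A]_n} := mk_linear h1L.
have h1E y : h1 y = g1 (f1 y) - y - d y *: y0 by [].
have dh1 y : d (h1 y) = 0.
  rewrite h1E !linearB linearZ /= g1E df1 linearZ /= -y0E.
  by rewrite scalerBr [X in _ - (_ - X)](_ : _ = d y) ?subKr ?subrr // /GRing.scale /= mulr1.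
have /boolp.choice[pz pzE] : forall z, exists p : P 2%N, d z = 0 -> res_diff P 1%N p = f1 z.
  move=> z; have [dz|dz] := boolp.EM (d z = 0); last by exists 0.
  have /res_exact[p pE] : res_diff P 0%N (f1 z) = 0 by rewrite df1 dz scale0r.
  by exists p.
have [s sE] := dual_basis (@res_proj _ _ P 2%N).
have sjL j a p p' : mcoeff j (s (a *: p + p')) = a *: (mcoeff j (s p) : A^o) + mcoeff j (s p').
  by rewrite linearP mcoeffD mcoeffZ.
pose sj j : {linear P 2%N -> A^o} := @mk_linear A (P 2%N) A^o (fun p => mcoeff j (s p)) (sjL j).
have [Phi [_ PhiE]] := phiS 1.
have mulL (f : {linear P 2%N -> A^o}) (c : A) a p p' :
    (f (a *: p + p') * c : A^o) = a *: (f p * c : A^o) + f p' * c.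
  by rewrite linearP mulrDl -scalerAl.
pose b j := phi (sj j).
(* Ext^2 is one-dimensional with basis the class of [Phi], so each coordinate functional on P_2 is
   b_j times [Phi] up to a coboundary. *)
have /boolp.choice[rho rhoE] : forall j, exists r : {linear P 1%N -> A^o},
    forall p, sj j p = (Phi p : A) * (b j)%:A + r (res_diff P 1%N p) :> A.
  move=> j; pose h' : {linear P 2%N -> A^o} := @mk_linear A (P 2%N) A^o (fun p => Phi p * (- (b j))%:A) (mulL Phi (- (b j))%:A).
  have hL a p p' : sj j (a *: p + p') + h' (a *: p + p') = a *: (sj j p + h' p) + (sj j p' + h' p').
    by rewrite !linearP scalerDr addrACA.
  pose h : {linear P 2%N -> A^o} := @mk_linear A (P 2%N) A^o (fun p => sj j p + h' p) hL.
  have phih' : phi h' = - b j by rewrite (phiM Phi h' (- (b j))%:A) // PhiE eps_scal mul1r.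
  have : phi h = 0 by rewrite (phiD (sj j) h' h) // phih' addrN.
  move/(phi0 h (coc2 h)) => [r rE]; exists r => p.
  have -> : r (res_diff P 1%N p) = (sj j p : A) + (Phi p : A) * (- b j)%:A :> A by rewrite -rE.
  by rewrite scaleNr mulrN addrC subrK.
pose beta z := eps (Phi (pz z)).
have rhof1 j z : rho j (f1 z) = \sum_i z 0 i * (rho j (q i) : A) :> A.
  by rewrite f1E linear_sum; apply: eq_bigr => i _; rewrite linearZ.
have epssj z j : d z = 0 -> eps (sj j (pz z)) = beta z * b j.
  move=> dz; rewrite rhoE (pzE z dz) rhof1 rmorphD rmorphM eps_scal raddf_sum big1 ?addr0 // => i _.
  by etransitivity; [exact: (rmorphM eps) | rewrite syz_aug // mul0r].
pose G j := g1 (res_diff P 1%N j).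
have dG j : d (G j) = 0.
  rewrite /G g1E; have -> : res_diff P 0%N (res_diff P 1%N j) = 0 by apply/res_exact; exists j.
  exact: linear0.
(* On syzygies the identity is g1 f1 - h1. The first part expands in the syzygies G_j; the second
   lies in A_+ Z because the entries of z lie in A_+. *)
have zE z : d z = 0 -> z = \sum_(j <- msupp (s (pz z))) (sj j (pz z) : A) *: G j - \sum_i z 0 i *: h1 (delta_mx 0 i).
  move=> dz; have {1}-> : z = g1 (f1 z) - h1 z by rewrite h1E dz scale0r subr0 opprB addrC subrK.
  congr (_ - _).
    by rewrite -(pzE z dz) -{1}[pz z]sE /malg_map !linear_sum; apply: eq_bigr => j _; rewrite !linearZ.
  by rewrite {1}[z]row_sum_delta linear_sum; apply: eq_bigr => i _; rewrite linearZ.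
have aug_h1 z : d z = 0 -> aug_syz (- \sum_i z 0 i *: h1 (delta_mx 0 i)).
  move=> dz; rewrite -sumrN; under eq_bigr do rewrite -scaleNr.
  by apply: aug_syz_sum => // i; rewrite rmorphN syz_aug ?oppr0.
split.
- have aug_part z : d z = 0 -> aug_syz (\sum_(j <- msupp (s (pz z))) ((sj j (pz z) : A) - (beta z * b j)%:A) *: G j).
    by move=> dz; apply: aug_syz_sum => // j; rewrite rmorphB eps_scal epssj // subrr.
  have main z : d z = 0 -> exists y, aug_syz y /\ z = \sum_(j <- msupp (s (pz z))) (beta z * b j)%:A *: G j + y.
    move=> dz; eexists; split; first exact: aug_syzD (aug_part z dz) (aug_h1 z dz).
    rewrite addrA -big_split /=.
    under [X in X - _]eq_bigr do rewrite -scalerDl addrC subrK.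
    exact: zE.
  (* The candidate for w is the sum of all b_j G_j, but only finitely many terms are available at a
     time. Where [beta] is nonzero, b_j vanishes off the support, so the finite sums for different z
     agree. *)
  have supp_indep z z1 : d z = 0 -> d z1 = 0 -> beta z != 0 -> beta z1 != 0 ->
      \sum_(j <- msupp (s (pz z))) (b j)%:A *: G j = \sum_(j <- msupp (s (pz z1))) (b j)%:A *: G j.
    move=> dz dz1 bz bz1.
    have b0 z' j : d z' = 0 -> beta z' != 0 -> j \notin msupp (s (pz z')) -> (b j)%:A *: G j = 0.
      move=> dz' bz' /mcoeff_outdom E; have := epssj z' j dz'.
      rewrite [sj j _]E rmorph0 => /esym/eqP; rewrite mulf_eq0 (negPf bz') /= => /eqP ->.
      by rewrite scale0r scale0r.
    pose U := fsetU (msupp (s (pz z))) (msupp (s (pz z1))).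
    rewrite (big_fset_incl _ (fsubsetUl _ (msupp (s (pz z1))))) /=; last by move=> j _; apply: b0.
    by rewrite [RHS](big_fset_incl _ (fsubsetUr (msupp (s (pz z))) _)) //= => j _; apply: b0.
  exists beta.
  (* The generator x_j acts by zero on Ext^2 = k, so [Phi] times x_j is a coboundary; evaluating at
     the lift of z gives the identity. *)
  have cob z j : d z = 0 -> exists (phi : A) (c : 'I_n -> A), eps phi = beta z /\ phi * x j = \sum_i z 0 i * c i.
    move=> dz; pose h : {linear P 2%N -> A^o} := @mk_linear A (P 2%N) A^o (fun p => Phi p * x j) (mulL Phi (x j)).
    have xj : eps (x j) = 0.
      apply/aug_ideal; exists (delta_mx 0 j); rewrite /d (bigD1 j) //= big1 ?addr0 => [|i ji].
        by rewrite mxE !eqxx mul1r.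
      by rewrite mxE (negPf ji) andbF mul0r.
    have /(phi0 h (coc2 h)) [r rE] : phi h = 0 by rewrite (phiM Phi h (x j)) // xj mulr0.
    exists (Phi (pz z)), (fun i => r (q i)); split=> //.
    rewrite -[LHS]/(h (pz z)) rE (pzE z dz) f1E linear_sum; by apply: eq_bigr => i _; rewrite linearZ.
  have [[z1 [dz1 bz1]]|no] := boolp.EM (exists z1, d z1 = 0 /\ beta z1 != 0).
    exists (\sum_(j <- msupp (s (pz z1))) (b j)%:A *: G j); split=> //.
      by rewrite linear_sum big1 // => j _; rewrite linearZ /= dG scaler0.
    move=> z dz; have [y [hy E]] := main z dz; exists y; split=> //; rewrite {1}E; congr (_ + _).
    have [bz|bz] := eqVneq (beta z) 0.
      by rewrite bz scale0r scale0r big1 // => j _; rewrite mul0r !scale0r.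
    rewrite -(supp_indep z z1 dz dz1 bz bz1) scaler_sumr; apply: eq_bigr => j _.
    by rewrite scalerA -scalerAl mul1r scalerA.
  exists 0; split=> //; first exact: linear0.
  move=> z dz; have [y [hy E]] := main z dz; exists y; split=> //; rewrite {1}E scaler0; congr (_ + _).
  have -> : beta z = 0 by apply/eqP/negP => /negP bz; apply: no; exists z.
  by rewrite big1 // => j _; rewrite mul0r !scale0r.
(* If there were no syzygies, a coordinate of g1 would be a cocycle on P_1. By vanishing of Ext^1 it
   is a coboundary, and at a basis vector the augmentation would give 1 = 0. *)
- move=> n0; apply: boolp.contrapT => no.
  have Z0 z : d z = 0 -> z = 0.
    by move=> dz; apply/eqP/negP => /negP z0; apply: no; exists z.
  pose i0 := Ordinal n0.
  have eL a p p' : (g1 (a *: p + p')) 0 i0 = a *: (g1 p 0 i0 : A^o) + g1 p' 0 i0.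
    by rewrite linearP !mxE.
  pose h : {linear P 1%N -> A^o} := @mk_linear A (P 1%N) A^o (fun p => g1 p 0 i0) eL.
  have ch : cocycle h by move=> y; rewrite [LHS](_ : _ = G y 0 i0) // (Z0 _ (dG y)) mxE.
  have [r rE] := Evan 1%N isT h ch.
  pose e0 : 'rV[A]_n := delta_mx 0 i0.
  have : g1 (f1 e0) 0 i0 = r (res_diff P 0%N (f1 e0)) by rewrite -rE.
  have -> : g1 (f1 e0) = e0 + d e0 *: y0.
    by have := Z0 _ (dh1 e0); rewrite h1E => /subr0_eq/eqP; rewrite subr_eq addrC => /eqP.
  have ed : eps (d e0) = 0 by apply/aug_ideal; exists e0.
  rewrite df1 linearZ /= !mxE !eqxx => /(congr1 eps).
  rewrite rmorphD rmorph1 rmorphM ed mul0r addr0 [RHS](_ : _ = eps (d e0) * eps (r p0)).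
    by rewrite ed mul0r => /eqP; rewrite oner_eq0.
  exact: rmorphM.
(* An r killed by A_+ from the left gives a cocycle on P_0, which is zero since Ext^0 vanishes. *)
move=> r hr; have rL a p p' : (g0 (a *: p + p') * r : A^o) = a *: (g0 p * r : A^o) + g0 p' * r.
  by rewrite linearP mulrDl -scalerAl.
pose h : {linear P 0%N -> A^o} := @mk_linear A (P 0%N) A^o (fun p => g0 p * r) rL.
have ch : cocycle h.
  by move=> y; rewrite -[LHS]/((g0 (res_diff P 0%N y) : A) * r) hr // g0E' augdiff.
have h0 := Evan 0%N isT h ch p0; rewrite -[LHS]/((g0 p0 : A) * r) in h0.
have : d y0 * r = 0 by apply: hr; apply/aug_ideal; exists y0.
by rewrite -y0E mulrBl h0 mul1r sub0r => /eqP; rewrite oppr_eq0 => /eqP.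
Qed.
End Syzygies.

Section Growth.
Variables (k : fieldType) (V : lmodType k).

Lemma lspan_seq_coord (s : seq V) v : lspan_seq s v -> exists c : 'I_(size s) -> k, v = \sum_j c j *: s`_j.
Proof.
case=> N [c [y [ys ->]]].
have /boolp.choice[J JE] : forall i, exists j : 'I_(size s), y i = s`_j.
  by move=> i; have yi := ys i; rewrite -index_mem in yi; exists (Ordinal yi); rewrite /= nth_index.
exists (fun j => \sum_(i | J i == j) c i).
rewrite (partition_big J predT) //=; apply: eq_bigr => j _; rewrite scaler_suml.
by apply: eq_bigr => i /eqP <-; rewrite JE.
Qed.

Lemma independent_size N (x : 'I_N -> V) (s : seq V) : independent x -> (forall i, lspan_seq s (x i)) ->
  (N <= size s)%N.
Proof.
move=> ix xs; have /boolp.choice[c cE] : forall i, exists c : 'I_(size s) -> k, x i = \sum_j c j *: s`_j.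
  by move=> i; apply: lspan_seq_coord.
pose M := \matrix_(i, j) c i j.
suff : row_free M by rewrite /row_free => /eqP <-; apply: rank_leq_col.
rewrite -kermx_eq0; apply/eqP/row_matrixP => i; rewrite row0.
have := sub_kermxP (row_sub i (kermx M)); set w := row i _ => wM.
suff w0 : forall l, w 0 l = 0 by apply/rowP => l; rewrite w0 mxE.
apply: ix; under eq_bigr do rewrite cE scaler_sumr.
rewrite exchange_big big1 //= => j _; under eq_bigr do rewrite scalerA.
rewrite -scaler_suml; have /rowP/(_ j) := wM; rewrite !mxE => E.
by rewrite (eq_bigr (fun l => w 0 l * M l j)) ?E ?scale0r // => l _; rewrite !mxE.
Qed.
End Growth.

Lemma exp_dominates (C d : nat) : exists m, (0 < m)%N /\ (C * m ^ d < 2 ^ m)%N.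
Proof.
(* With m = 2^(2r) one has C m^d < 2^(C + 2rd), and C + 2rd <= (r + 1)^2 <= 2^(2r) = m. *)
pose r := (C + d.*2)%N; exists (2 ^ (r.*2))%N; split; first by rewrite expn_gt0.
rewrite -expnM; apply: (@leq_trans (2 ^ (C + r.*2 * d))).
  by rewrite expnD ltn_pmul2r ?expn_gt0 // ltn_expl.
rewrite leq_exp2l // -addnn expnD.
have h : (r.+1 <= 2 ^ r)%N by apply: ltn_expl.
apply: leq_trans (leq_mul h h); rewrite /r; nia.
Qed.

(** * The quadratic syzygy and the number of generators *)

Section QuadraticRegular.
Variables (k : fieldType) (A : algType k) (grade : nat -> A -> Prop) (cg : connected_graded grade).
Variables (eps : {rmorphism A -> k}) (augm : augmentation grade eps).
Variables (n : nat) (x : 'I_n -> A).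
Hypotheses (xg : forall i, grade 1 (x i)) (ix : independent x).
Hypothesis gen : forall m a, grade m.+1 a -> exists y : 'I_n -> A, (forall i, grade m (y i)) /\ a = \sum_i y i * x i.
Local Notation d := (syz_map x).
Local Notation hcomp := (hcomp cg).
Local Notation aug_syz := (aug_syz eps x).

Let eps_scal c : eps c%:A = c. Proof. by case: augm => ->. Qed.
Let eps_x i : eps (x i) = 0. Proof. by case: augm => _; apply; last exact: xg. Qed.

Lemma aug_ideal a : eps a = 0 <-> exists y, a = d y.
Proof.
split=> [a0|[y ->]]; last first.
  by rewrite /syz_map raddf_sum big1 // => i _; rewrite /= rmorphM eps_x mulr0.
have [N hN] := compE cg a; have [-> _] := hN N (leqnn N).
have h m : exists y, hcomp m a = d y.
  case: m => [|m].
    by exists 0; rewrite (comp0E cg augm) a0 scale0r linear0.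
  have [y [_ ->]] := gen (comp_grade cg m.+1 a); exists (\row_i y i).
  by apply: eq_bigr => i _; rewrite mxE.
elim/big_ind: _ => [|_ _ [y1 ->] [y2 ->]|i _]; last exact: h.
  by exists 0; rewrite linear0.
by exists (y1 + y2); rewrite linearD.
Qed.

Lemma comp_syz m (z : 'rV[A]_n) : hcomp m.+1 (d z) = \sum_i hcomp m (z 0 i) * x i.
Proof.
rewrite /syz_map (linS (comp_lin cg _)); apply: eq_bigr => i _.
by rewrite (comp_mulr cg _ _ (xg i)) subSS subn0.
Qed.

(** Minimality of the resolution: the degree one part of the syzygy is a linear relation among the
    independent x_i, with coefficients eps(z_i). *)
Lemma syz_aug (z : 'rV[A]_n) i : d z = 0 -> eps (z 0 i) = 0.
Proof.
move=> dz; have := comp_syz 0 z; rewrite dz (lin0 (comp_lin cg _)) => E.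
apply: (ix (c := fun i => eps (z 0 i))); rewrite [RHS]E.
by apply: eq_bigr => j _; rewrite (comp0E cg augm) mulr_algl.
Qed.

Definition compv m (z : 'rV[A]_n) : 'rV[A]_n := \row_i hcomp m (z 0 i).

Lemma compv_syz m z : d z = 0 -> d (compv m z) = 0.
Proof.
move=> dz; have := comp_syz m z; rewrite dz (lin0 (comp_lin cg _)) => E.
by rewrite [RHS]E; apply: eq_bigr => i _; rewrite mxE.
Qed.

Lemma compvD m y z : compv m (y + z) = compv m y + compv m z.
Proof. by apply/rowP => i; rewrite !mxE (linD (comp_lin cg m)). Qed.

Lemma compvE z : exists N, z = \sum_(m < N) compv m z.
Proof.
have /boolp.choice[N NE] := fun i => compE cg (z 0 i).
exists (\max_i N i)%N; apply/rowP => i; rewrite summxE.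
have [-> _] := NE i _ (leq_bigmax i); apply: eq_bigr => m _.
rewrite mxE; congr hcomp; by have [-> _] := NE i _ (leq_bigmax i).
Qed.

Lemma compv_mull m r a z : grade r a -> compv m (a *: z) = if (r <= m)%N then a *: compv (m - r) z else 0.
Proof.
move=> ga; apply/rowP => i; rewrite !mxE (comp_mull cg _ _ ga).
by case: ifP => _; rewrite !mxE.
Qed.

(* Graded Nakayama, by induction on the degree of the components of z. *)
Lemma syz_cyclic e (w : 'rV[A]_n) : (forall i, grade e (w 0 i)) -> d w = 0 ->
  (forall z, d z = 0 -> exists (b : k) y, aug_syz y /\ z = b%:A *: w + y) ->
  forall z, d z = 0 -> exists a, z = a *: w.
Proof.
move=> gw dw hw.
pose C (z : 'rV[A]_n) := exists a, z = a *: w.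
have C0 : C 0 by exists 0; rewrite scale0r.
have CD y z : C y -> C z -> C (y + z) by move=> [a ->] [b ->]; exists (a + b); rewrite scalerDl.
have CZ a z : C z -> C (a *: z) by move=> [b ->]; exists (a * b); rewrite scalerA.
have h m : forall z, d z = 0 -> C (compv m z).
  elim/ltn_ind: m => m IH z dz; have [b [y [hy ->]]] := hw z dz.
  rewrite compvD; apply: (CD).
    rewrite (compv_mull _ _ (r := 0%N)) ?leq0n ?subn0; last by apply/(grade0P cg); exists b.
    apply: CZ; rewrite (_ : compv m w = if m == e then w else 0); last first.
      by apply/rowP => i; rewrite mxE (comp_hom cg _ (gw i)); case: eqP => _; rewrite ?mxE.
    by case: eqP => _ //; exists 1; rewrite scale1r.
  elim: hy => [|c {}z {}y ec {}dz _ IHy].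
    by rewrite (_ : compv m 0 = 0) //; apply/rowP => i; rewrite !mxE (lin0 (comp_lin cg m)).
  rewrite compvD; apply: (CD) => //.
  have [N hN] := compE cg c; have [-> _] := hN N (leqnn N).
  rewrite scaler_suml (big_morph (compv m) (compvD m) (_ : _ = 0)); last first.
    by apply/rowP => i; rewrite !mxE (lin0 (comp_lin cg m)).
  apply: (big_ind C) => // -[[|i] iN] _ /=.
    rewrite (comp0E cg augm) ec scale0r scale0r.
    by rewrite (_ : compv m 0 = 0) //; apply/rowP => j; rewrite !mxE (lin0 (comp_lin cg m)).
  rewrite (compv_mull _ _ (comp_grade cg _ _)); case: ifP => // im.
  by apply: CZ; apply: IH => //; lia.
by move=> z dz; have [N ->] := compvE z; apply: (big_ind C) => // i _; apply: h.
Qed.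

Hypotheses (gl2 : gldim_le A 2) (gor : gorenstein eps 2) (gk : finite_GKdim A).

Lemma aug_syzZ a y : aug_syz y -> aug_syz (a *: y).
Proof.
elim=> [|c z {}y ec dz _ IH]; first by rewrite scaler0; apply: aug_syz0.
by rewrite scalerDr scalerA; apply: aug_syzS => //; rewrite rmorphM ec mulr0.
Qed.

Lemma rank_gt0 : (0 < n)%N.
Proof.
rewrite lt0n; apply/eqP => n0.
have [_ _ ext0] := gorenstein_syzygies eps_scal aug_ideal syz_aug gl2 gor.
have : (1 : A) = 0; last by move/eqP; rewrite oner_eq0.
apply: ext0 => a /aug_ideal[y ->]; rewrite mulr1 /syz_map big1 // => -[i ilt]; exfalso.
by move: ilt; rewrite n0.
Qed.

Lemma x_neq0 i : x i <> 0.
Proof.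
move=> xi; have : ((i == i)%:R : k) = 0; last by move/eqP; rewrite eqxx oner_eq0.
apply: (ix (c := fun j => (j == i)%:R)).
by rewrite (bigD1 i) //= eqxx xi scaler0 add0r big1 // => j /negPf ->; rewrite scale0r.
Qed.

Lemma syzygy_generator : exists f : 'rV[A]_n,
  [/\ d f = 0, forall i, grade 1 (f 0 i), forall z, d z = 0 -> exists a, z = a *: f
    & forall j, exists c : 'I_n -> k, x j = \sum_i c i *: f 0 i].
Proof.
have [[beta [w' [dw' hw' cob]]] ext1 _] := gorenstein_syzygies eps_scal aug_ideal syz_aug gl2 gor.
have [z0 [dz0 z0n]] := ext1 rank_gt0.
have [all_aug|/boolp.existsNP[e we]] := boolp.EM (forall e, aug_syz (compv e w')).
  have w'a : aug_syz w'.
    have [N ->] := compvE w'; apply: (big_ind (fun y => aug_syz y)) => //; [exact: aug_syz0 | exact: aug_syzD].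
  have [|||a za] := @syz_cyclic 0 0 _ _ _ z0 dz0.
  - by move=> i; rewrite mxE; apply: grade0.
  - exact: linear0.
  - move=> z dz; have [y [hy E]] := hw' z dz; exists 0, z; split; last by rewrite scaler0 add0r.
    by rewrite E; apply: aug_syzD => //; apply: aug_syzZ.
  by move: z0n; rewrite za scaler0 eqxx.
pose f := compv e w'.
have df : d f = 0 by apply: compv_syz.
have gf i : grade e (f 0 i) by rewrite mxE; apply: comp_grade.
have [y0 [hy0 fE]] := hw' f df.
have bf : beta f != 0.
  by apply/eqP => b0; apply: we; rewrite -/f fE b0 scale0r scale0r add0r.
have cyc : forall z, d z = 0 -> exists a, z = a *: f.
  apply: (syz_cyclic gf df) => z dz; have [y [hy zE]] := hw' z dz.
  exists (beta z / beta f), ((- (beta z / beta f)%:A) *: y0 + y); split.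
    by apply: aug_syzD => //; apply: aug_syzZ.
  have -> : (beta z / beta f)%:A *: f = (beta z)%:A *: w' + (beta z / beta f)%:A *: y0.
    by rewrite {2}fE scalerDr scalerA -scalerAl mul1r scalerA divfK.
  by rewrite scaleNr -addrA [X in _ + X]addrA addrN add0r.
(* For e > 1 the right side has no part of degree one, and for e = 0 the entries vanish by
   minimality; either way x_j would be zero. *)
have e1 : e = 1%N.
  have j : 'I_n := Ordinal rank_gt0.
  have [phi [c [phib E]]] := cob f j df.
  apply: boolp.contrapT => e1; apply: (x_neq0 (i := j)).
  have := congr1 (hcomp 1) E; rewrite (comp_mulr cg _ _ (xg j)) /= subnn (comp0E cg augm) phib.
  rewrite (linS (comp_lin cg 1)) big1 => [|i _].
    by move/eqP; rewrite mulr_algl scaler_eq0 (negPf bf) => /eqP.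
  rewrite (comp_mull cg _ _ (gf i)); case: ifP => // e_le.
  have e0 : e = 0%N by lia.
  have := comp_hom cg 0 (gf i); rewrite e0 eqxx (comp0E cg augm) syz_aug // scale0r => <-.
  by rewrite mul0r.
exists f; split=> // [i|j]; first by have := gf i; rewrite e1.
have [phi [c [phib E]]] := cob f j df.
exists (fun i => (beta f)^-1 * eps (c i)).
have := congr1 (hcomp 1) E; rewrite (comp_mulr cg _ _ (xg j)) /= subnn (comp0E cg augm) phib mulr_algl.
move/(congr1 (fun z => (beta f)^-1 *: z)); rewrite scalerA mulVf // scale1r => ->.
rewrite (linS (comp_lin cg 1)) scaler_sumr; apply: eq_bigr => i _.
by rewrite (comp_mull cg _ _ (gf i)) e1 /= subnn (comp0E cg augm) mulr_algr scalerA.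
Qed.

Lemma grade1_coord a : grade 1 a -> exists c : 'I_n -> k, a = \sum_i c i *: x i.
Proof.
move=> /gen[y [gy ->]].
have /boolp.choice[c cE] : forall i, exists c : k, y i = c%:A by move=> i; apply/(grade0P cg).
by exists c; apply: eq_bigr => i _; rewrite cE mulr_algl.
Qed.

(** If c y = 0 with y = Σ gam_l x_l, the row of the gam_l c is a syzygy, hence a' f with a' of lower
    degree than c. Two of its entries combine to a' times a nonzero linear element equal to zero, so
    a' = 0 by induction and c = 0. *)
Lemma regular_linear y a : (1 < n)%N -> grade 1 y -> y <> 0 -> a * y = 0 -> a = 0.
Proof.
move=> n1; have [f [df gf cyc span]] := syzygy_generator.
have indf : independent (fun i => f 0 i).
  by apply: (exchange_independent ix) => j; have [c ->] := span j; exists c.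
move=> gy0 y00; move: y a gy0 y00.
have pre y c : grade 1 y -> y <> 0 -> c * y = 0 ->
    exists (gam : 'I_n -> k) (l0 : 'I_n) (a' : A), gam l0 != 0 /\ forall l, gam l *: c = a' * f 0 l.
  move=> gy y0 cy0; have [gam yE] := grade1_coord gy.
  have [l0 gl0] : exists l, gam l != 0.
    apply: boolp.contrapT => no; apply: y0; rewrite yE big1 // => i _.
    by have [->|gi] := eqVneq (gam i) 0; [rewrite scale0r | case: no; exists i].
  pose z : 'rV[A]_n := \row_l (gam l *: c).
  have dz : d z = 0 by rewrite -[RHS]cy0 yE mulr_sumr; apply: eq_bigr => i _; rewrite mxE -scalerAl scalerAr.
  have [a' zE] := cyc z dz; exists gam, l0, a'; split=> // l.
  by have := congr1 (fun u : 'rV_n => u 0 l) zE; rewrite !mxE.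
have h m : forall y c, grade 1 y -> y <> 0 -> grade m c -> c * y = 0 -> c = 0.
  elim: m => [|m IH] y c gy y0 gc cy0; have [gam [l0 [a' [gl0 cl]]]] := pre y c gy y0 cy0.
    have := congr1 (hcomp 0) (cl l0).
    rewrite (linZ (comp_lin cg 0)) (comp_hom cg 0 gc) (comp_mulr cg _ _ (gf l0)) /= => /eqP.
    by rewrite scaler_eq0 (negPf gl0) => /eqP.
  have {}cl l : gam l *: c = hcomp m a' * f 0 l.
    have := congr1 (hcomp m.+1) (cl l).
    by rewrite (linZ (comp_lin cg _)) (comp_hom cg _ gc) eqxx (comp_mulr cg _ _ (gf l)) /= subSS subn0.
  have [l1 l10] : exists l1, l1 != l0.
    have [->|l00] := eqVneq l0 (Ordinal n1); first by exists (Ordinal (ltnW n1)); rewrite -val_eqE.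
    by exists (Ordinal n1); rewrite eq_sym.
  have a0 : hcomp m a' = 0.
    apply: (IH (gam l0 *: f 0 l1 - gam l1 *: f 0 l0)); last 2 first.
    - exact: comp_grade.
    - by rewrite mulrBr -!scalerAr -!cl !scalerA mulrC subrr.
    - by rewrite addrC -scaleNr; apply: gradeL => //; apply: gradeZ.
    move=> E; move/eqP: gl0; apply.
    pose w l := if l == l1 then gam l0 else if l == l0 then - gam l1 else 0.
    rewrite -[gam l0](_ : w l1 = _); last by rewrite /w eqxx.
    have l01 : l0 != l1 by rewrite eq_sym.
    apply: indf; rewrite (bigD1 l1) //= (bigD1 l0) //= /w eqxx (negPf l01) eqxx big1 => [|i /andP[/negPf -> /negPf ->]].
      by rewrite addr0 scaleNr.
    by rewrite scale0r.
  by have /eqP := cl l0; rewrite a0 mul0r scaler_eq0 (negPf gl0) => /eqP.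
move=> y a gy y0 ay; have [N hN] := compE cg a; have [-> _] := hN N (leqnn N).
rewrite big1 // => m _; apply: (h m y) => //; first exact: comp_grade.
have := congr1 (hcomp m.+1) ay.
by rewrite (comp_mulr cg _ _ gy) /= subSS subn0 (lin0 (comp_lin cg _)).
Qed.

(** With a third generator, a syzygy supported on the first two is c f with c f_2 = 0, so c = 0 by
    regularity. Thus x_0 and x_1 are left independent and have 2^m independent words of length m,
    against finite Gelfand-Kirillov dimension. *)
Lemma rank_le2 : (n <= 2)%N.
Proof.
rewrite leqNgt; apply/negP => n3.
have [f [df gf cyc span]] := syzygy_generator.
have indf : independent (fun i => f 0 i).
  by apply: (exchange_independent ix) => j; have [c ->] := span j; exists c.
pose i0 : 'I_n := Ordinal (leq_trans (isT : (0 < 3)%N) n3).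
pose i1 : 'I_n := Ordinal (leq_trans (isT : (1 < 3)%N) n3).
pose i2 : 'I_n := Ordinal n3.
have free2 a b : a * x i0 + b * x i1 = 0 -> a = 0 /\ b = 0.
  move=> E; pose z : 'rV[A]_n := \row_l (if l == i0 then a else if l == i1 then b else 0).
  have dz : d z = 0.
    rewrite -[RHS]E /syz_map (bigD1 i0) //= (bigD1 i1) //= !mxE /= big1 ?addr0 // => i /andP[/negPf h0 /negPf h1].
    by rewrite mxE h0 h1 mul0r.
  have [c zE] := cyc z dz.
  have c0 : c = 0.
    apply: (regular_linear _ (gf i2)); first exact: ltnW.
      move=> f2; have := indf (fun l => (l == i2)%:R) _ i2; rewrite eqxx => h.
      have /eqP : (1 : k) = 0; last by rewrite oner_eq0.
      apply: h; rewrite (bigD1 i2) //= f2 scaler0 add0r big1 // => i /negPf ->; by rewrite scale0r.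
    by have := congr1 (fun u : 'rV_n => u 0 i2) zE; rewrite !mxE.
  have zl l : z 0 l = 0 by rewrite zE c0 scale0r mxE.
  by have := zl i0; have := zl i1; rewrite !mxE /=.
pose s := [seq x i | i : 'I_n].
have words m : exists N (X : 'I_N -> A), [/\ N = (2 ^ m)%N, independent X & forall i, filt (lspan_seq s) m (X i)].
  elim: m => [|m [N [X [NE iX fX]]]].
    exists 1%N, (fun=> 1); split=> // [c|_]; last by exists 1; rewrite scale1r.
    by rewrite big_ord1 => /eqP; rewrite scaler_eq0 oner_eq0 orbF => /eqP c0 i; rewrite ord1.
  exists (N + N)%N, (fun i => match split i with inl j => X j * x i0 | inr j => X j * x i1 end).
  split; first by rewrite NE expnS mul2n addnn.
    move=> c; rewrite big_split_ord /=.
    rewrite (eq_bigr (fun i => c (lshift N i) *: X i * x i0)) => [|i _]; last first.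
      by rewrite -[lshift N i]/(unsplit (inl i)) unsplitK scalerAl.
    rewrite [X in _ + X](eq_bigr (fun i => c (rshift N i) *: X i * x i1)) => [|i _]; last first.
      by rewrite -[rshift N i]/(unsplit (inr i)) unsplitK scalerAl.
    rewrite -!mulr_suml => /free2[/iX c0 /iX c1] i.
    by rewrite -[i]splitK; case: (split i) => j /=; [exact: c0 | exact: c1].
  have fx y i : filt (lspan_seq s) m y -> filt (lspan_seq s) m.+1 (y * x i).
    move=> hy; exists 1%N, (fun=> 1), (fun=> y * x i); split; last by rewrite big_ord1 scale1r.
    move=> _; exists y, (x i); split=> //; exists 0, (x i); split; last by rewrite scale0r add0r.
    exists 1%N, (fun=> 1), (fun=> x i); split; last by rewrite big_ord1 scale1r.
    by move=> _; apply: image_f.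
  by move=> i; case: (split i) => j; apply: fx.
have [e /(_ s)[C hC]] := gk; have [m [m0 big]] := exp_dominates C e.
have [N [X [NE iX fX]]] := words m; have [s' [ss hs]] := hC m m0.
have := independent_size iX (fun i => hs _ (fX i)); rewrite NE => le.
by have := leq_trans big (leq_trans le ss); rewrite ltnn.
Qed.

(** For n = 1 the element x is a multiple of f, and f x = 0 gives x^2 = 0. So x is killed by A_+
    from the left, contradicting Ext^0 = 0. *)
Lemma rank_neq1 : n != 1%N.
Proof.
apply/eqP => n1; have [f [df gf cyc span]] := syzygy_generator.
have i0 : 'I_n by rewrite n1; exact: ord0.
have one i : i = i0 by apply: val_inj; case: i i0 => [a ha] [b hb] /=; move: ha hb; rewrite n1; lia.
have sum1 (F : 'I_n -> A) : \sum_i F i = F i0.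
  by rewrite (bigD1 i0) //= big1 ?addr0 // => i; rewrite (one i) eqxx.
have [_ _ ext0] := gorenstein_syzygies eps_scal aug_ideal syz_aug gl2 gor.
apply: (x_neq0 (i := i0)); apply: ext0 => a /aug_ideal[y ->].
rewrite /syz_map sum1 -mulrA; have [c xE] := span i0.
rewrite sum1 in xE; rewrite {1}xE -scalerAl.
by have := df; rewrite /syz_map sum1 => ->; rewrite scaler0 mulr0.
Qed.

Lemma rank2 : n = 2%N.
Proof. by have := rank_gt0; have := rank_le2; have := rank_neq1; lia. Qed.
End QuadraticRegular.

(** * Filtered Artin-Schelter regular algebras *)

Section FiniteBasis.
Variables (k : fieldType) (V : lmodType k).

Lemma lspan_ind (X : V -> Prop) (P : V -> Prop) : P 0 ->
  (forall a x y, X x -> P y -> P (a *: x + y)) -> forall v, lspan X v -> P v.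
Proof.
move=> P0 PS v [N [c [x [hx ->]]]]; elim: N c x hx => [|N IH] c x hx; first by rewrite big_ord0.
by rewrite big_ord_recl; apply: PS => //; apply: IH => i.
Qed.

Lemma lspan_incl (X : V -> Prop) x : X x -> lspan X x.
Proof. by move=> hx; exists 1%N, (fun=> 1), (fun=> x); split=> //; rewrite big_ord1 scale1r. Qed.

Lemma lspanL (X : V -> Prop) a x y : lspan X x -> lspan X y -> lspan X (a *: x + y).
Proof.
move=> [N [c [p [hp ->]]]] [M [d [q [hq ->]]]].
exists (N + M)%N, (fun i => match split i with inl j => a * c j | inr j => d j end),
  (fun i => match split i with inl j => p j | inr j => q j end); split.
  by move=> i; case: (split i).
rewrite big_split_ord /= scaler_sumr; congr (_ + _); apply: eq_bigr => i _.
  by rewrite -[lshift M i]/(unsplit (inl i)) unsplitK scalerA.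
by rewrite -[rshift N i]/(unsplit (inr i)) unsplitK.
Qed.

Lemma lspan0 (X : V -> Prop) : lspan X 0.
Proof. by exists 0%N, (fun=> 0), (fun=> 0); split=> [[]|] //; rewrite big_ord0. Qed.

(** Independent families in U are lengthened until they span; a finite spanning list bounds their
    size. *)
Lemma finite_basis (U : V -> Prop) : fin_dim U -> exists N (x : 'I_N -> V),
  [/\ independent x, forall i, U (x i) & forall y, U y -> exists c : 'I_N -> k, y = \sum_i c i *: x i].
Proof.
case=> s Us.
have h j : (exists N (x : 'I_N -> V), [/\ (j <= N)%N, independent x & forall i, U (x i)]) \/
    exists N (x : 'I_N -> V), [/\ independent x, forall i, U (x i) & forall y, U y -> exists c : 'I_N -> k, y = \sum_i c i *: x i].
  elim: j => [|j [[N [x [jN ix Ux]]]|]]; last by right.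
    by left; exists 0%N, (fun=> 0); split=> // [c _ []|[]].
  have [sp|/boolp.existsNP[y /boolp.not_implyP[Uy ny]]] :=
    boolp.EM (forall y, U y -> exists c : 'I_N -> k, y = \sum_i c i *: x i).
    by right; exists N, x.
  left; exists N.+1, (fun i => if unlift ord0 i is Some j then x j else y); split=> // [c|i]; last first.
    by case: (unlift ord0 i).
  rewrite big_ord_recl unlift_none; under eq_bigr do rewrite liftK.
  move=> E; have c0 : c ord0 = 0.
    apply/eqP/negP => /negP c0; apply: ny; exists (fun i => - (c ord0)^-1 * c (lift ord0 i)).
    have := congr1 (fun z => (c ord0)^-1 *: z) E.
    rewrite scalerDr scaler0 scalerA mulVf // scale1r => /eqP; rewrite addr_eq0 => /eqP ->.
    by rewrite scaler_sumr -sumrN; apply: eq_bigr => i _; rewrite scalerA mulNr scaleNr.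
  move: E; rewrite c0 scale0r add0r => /ix cS i.
  by case: (unliftP ord0 i) => [l ->|->].
have [[N [x [jN ix Ux]]]|//] := h (size s).+1.
have := independent_size ix (fun i => (Us _).1 (Ux i)) => le.
by have := leq_trans jN le; rewrite ltnn.
Qed.
End FiniteBasis.

Section FilteredRegular.
Variables (k : closedFieldType) (R : algType k) (U : R -> Prop).
Hypotheses (subU : subspace U) (finU : fin_dim U) (U1 : ~ U 1) (exhU : forall x, exists n, filt U n x).
Variables (A : algType k) (grade : nat -> A -> Prop) (sym : nat -> R -> A).
Hypothesis assoc : is_assoc_graded U grade sym.
Local Notation V := (one_plus U).

Lemma one_plusL a x y : V x -> V y -> V (a *: x + y).
Proof.
move=> [b [p [Up ->]]] [c [q [Uq ->]]]; exists (a * b + c), (a *: p + q); split; first by apply: subU.2.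
by rewrite scalerDr scalerA scalerDl addrACA.
Qed.
Lemma one_plus_scal a : V a%:A. Proof. by exists a, 0; split; [apply: subU.1 | rewrite addr0]. Qed.
Lemma one_plus_U x : U x -> V x. Proof. by move=> Ux; exists 0, x; rewrite scale0r add0r. Qed.

Lemma filtL m a x y : filt U m x -> filt U m y -> filt U m (a *: x + y).
Proof.
case: m => [|m]; last exact: lspanL.
by move=> [b ->] [c ->]; exists (a * b + c); rewrite scalerDl scalerA.
Qed.
Lemma filt_0 m : filt U m 0.
Proof. by case: m => [|m]; [exists 0; rewrite scale0r | apply: lspan0]. Qed.
Lemma filtS m x y : filt U m x -> V y -> filt U m.+1 (x * y).
Proof. by move=> fx Vy; apply: lspan_incl; exists x, y. Qed.
Lemma filt1 x : filt U 1 x <-> V x.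
Proof.
split=> [|Vx]; last by rewrite -[x]mul1r; apply: filtS => //; exists 1; rewrite scale1r.
apply: lspan_ind => [|a z y [_ [w [[b ->] Vw ->]]] Vy]; first by rewrite -(scale0r 1); apply: one_plus_scal.
by rewrite mulr_algl scalerA; apply: one_plusL.
Qed.

Lemma filt_generates : generates V.
Proof.
move=> P P1 PL PM x; have P0 : P 0 by rewrite -(addNr (1 : R)) -scaleN1r; apply: PL.
have [n] := exhU x; elim: n x => [x [a ->]|n IH x]; first by rewrite -[_ *: _]addr0; apply: PL.
by apply: lspan_ind => // a _ z [p [w [/IH Pp Vw ->]]] Pz; apply: PL => //; apply: PM.
Qed.

Lemma symL n a x y : filt U n x -> filt U n y -> sym n (a *: x + y) = a *: sym n x + sym n y.
Proof. by case: assoc => _ h _ _ _; apply: h. Qed.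
Lemma sym_grade n x : filt U n x -> grade n (sym n x).
Proof. by case: assoc => _ _ h _ _ fx; apply/h; exists x. Qed.
Lemma sym_eq0 n x : filt U n x -> sym n x = 0 <-> filt_pred U n x.
Proof. by case: assoc => _ _ _ h _; apply: h. Qed.
Lemma symM m n x y : filt U m x -> filt U n y -> sym (m + n) (x * y) = sym m x * sym n y.
Proof. by case: assoc => _ _ _ _ [_ h]; apply: h. Qed.
Lemma sym0 n : sym n 0 = 0.
Proof. by apply/(sym_eq0 (filt_0 n)); case: n => //= n; apply: filt_0. Qed.
Lemma symZ n a x : filt U n x -> sym n (a *: x) = a *: sym n x.
Proof. by move=> fx; rewrite -[a *: x]addr0 symL ?sym0 ?addr0 //; apply: filt_0. Qed.
Lemma symD n x y : filt U n x -> filt U n y -> sym n (x + y) = sym n x + sym n y.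
Proof. by move=> fx fy; rewrite -{1}[x]scale1r symL // scale1r. Qed.

Variables (N : nat) (u : 'I_N -> R).
Hypotheses (iu : independent u) (Uu : forall i, U (u i))
  (spu : forall y, U y -> exists c : 'I_N -> k, y = \sum_i c i *: u i).

Lemma filt1u i : filt U 1 (u i). Proof. by apply/filt1/one_plus_U. Qed.
Lemma U_sum c : U (\sum_i c i *: u i).
Proof.
apply: (big_ind U) => [|x y Ux Uy|i _]; first exact: subU.1.
  by rewrite -[x]scale1r; apply: subU.2.
by rewrite -[_ *: _]addr0; apply: subU.2 => //; apply: subU.1.
Qed.
Lemma sym1_sum c a : sym 1 (a%:A + \sum_i c i *: u i) = \sum_i c i *: sym 1 (u i).
Proof.
have fa : filt U 1 a%:A by apply/filt1/one_plus_scal.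
rewrite symD //; last by apply/filt1/one_plus_U/U_sum.
have -> : sym 1 a%:A = 0 by apply/(sym_eq0 fa); exists a.
rewrite add0r; have h (r : seq 'I_N) : filt U 1 (\sum_(i <- r) c i *: u i) /\
    sym 1 (\sum_(i <- r) c i *: u i) = \sum_(i <- r) c i *: sym 1 (u i).
  elim: r => [|i r [IH1 IH2]]; first by rewrite !big_nil sym0; split=> //; apply: filt_0.
  by rewrite !big_cons; split; [apply: filtL => //; apply: filt1u | rewrite symL ?IH2 //; apply: filt1u].
by case: (h (index_enum 'I_N)).
Qed.

Lemma affine_indep a c : a%:A + \sum_i c i *: u i = 0 -> a = 0 /\ forall i, c i = 0.
Proof.
move=> E; have a0 : a = 0.
  apply/eqP/negP => /negP a0; apply: U1.
  have -> : 1 = (- a^-1) *: (\sum_i c i *: u i) + 0.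
    by rewrite -(subr0 (_ *: _ + 0)) addr0 subr0 -[\sum_i _](addKr a%:A) E addr0 scalerN scaleNr opprK scalerA mulVf // scale1r.
  by apply: subU.2; [apply: U_sum | apply: subU.1].
by split=> //; apply: iu; move: E; rewrite a0 scale0r add0r.
Qed.

(** A combination of the u_i with zero symbol lies in F_0 = k1, and 1 does not belong to U. *)
Lemma sym_independent : independent (fun i => sym 1 (u i)).
Proof.
move=> c; rewrite -(sym1_sum c 0) scale0r add0r => /(sym_eq0 _)[|a E].
  by apply/filt1/one_plus_U/U_sum.
have [|_ h i] := @affine_indep (- a) c; first by rewrite E scaleNr addNr.
exact: h.
Qed.

Lemma sym_gen m a : grade m.+1 a ->
  exists y : 'I_N -> A, (forall i, grade m (y i)) /\ a = \sum_i y i * sym 1 (u i).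
Proof.
have [ds _ gr _ _] := assoc.
have g0 : grade m 0 by rewrite -(sym0 m); apply: sym_grade; apply: filt_0.
move=> /gr[x [fx <-]]; move: x fx.
pose Q x := filt U m.+1 x /\
    exists y : 'I_N -> A, (forall i, grade m (y i)) /\ sym m.+1 x = \sum_i y i * sym 1 (u i).
suff h x : filt U m.+1 x -> Q x by move=> x /h[].
apply: (@lspan_ind _ _ _ Q) => [|z _ x' [p [w [fp Vw ->]]] [fx' [y [gy yE]]]].
  by split; [apply: filt_0 | exists (fun=> 0); split=> //; rewrite sym0 big1 // => i _; rewrite mul0r].
have fpw := filtS fp Vw; split; first exact: filtL.
have [b [w' [/spu[c ->] wE]]] := Vw.
exists (fun i => (z * c i) *: sym m p + y i); split=> [i|].
  have /gr[q [fq <-]] := gy i; rewrite -symL //; apply: sym_grade; exact: filtL.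
rewrite symL // yE -addn1 symM //; last by apply/filt1.
rewrite wE sym1_sum mulr_sumr scaler_sumr -big_split; apply: eq_bigr => i _ /=.
by rewrite -scalerAr scalerA mulrDl scalerAl.
Qed.
End FilteredRegular.

Section QuadraticFiltered.
Variables (k : closedFieldType) (R : algType k).

(** The last hypothesis says that the relations of degree at most two form at most a line. Leaving
    out one quadratic monomial with nonzero coefficient, uu or else vu, makes the other six products
    independent; nondegeneracy guarantees that one of these two coefficients is nonzero. *)
Lemma dim6_of_relation (V : R -> Prop) (u v : R) (x1 x2 x3 x4 : k) : V u -> V v -> V 1 ->
  x1 * x4 - x2 * x3 != 0 ->
  (forall c1 c2 c3 c4 c5 c6 c7, comb7 u v c1 c2 c3 c4 c5 c6 c7 = 0 -> exists al : k,
     [/\ c1 = al * x1, c2 = al * x2, c3 = al * x3, c4 = al * x4 & al = 0 -> [/\ c5 = 0, c6 = 0 & c7 = 0]]) ->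
  dim6 V.
Proof.
move=> Vu Vv V1 D uniq.
have vanish c1 c2 c3 c4 c5 c6 c7 : comb7 u v c1 c2 c3 c4 c5 c6 c7 = 0 ->
    (c1 = 0 /\ x1 != 0) \/ (c3 = 0 /\ x3 != 0) ->
    [/\ c1 = 0, c2 = 0, c3 = 0, c4 = 0 & [/\ c5 = 0, c6 = 0 & c7 = 0]].
  move=> /uniq[al [E1 E2 E3 E4 h]] hc.
  have al0 : al = 0.
    by case: hc => -[c0 x0]; apply/eqP; [move: E1 | move: E3]; rewrite c0 => /esym/eqP;
      rewrite mulf_eq0 (negPf x0) orbF.
  by rewrite E1 E2 E3 E4 al0 !mul0r; split=> //; apply: h.
have [x10|x10] := eqVneq x1 0.
  have x30 : x3 != 0 by apply: contraNneq D => ->; rewrite x10 mul0r mulr0 subrr.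
  exists (fun i : 'I_6 => nth 0 [:: u * u; u * v; v * v; u * 1; v * 1; 1 * 1] i); split=> [c|].
    pose C (l : nat) := c (inord l); have cC l : c l = C l by rewrite /C inord_val.
    under eq_bigr do rewrite cC.
    rewrite !big_ord_recr big_ord0 /= add0r !mulr1 => E.
    have [||e1 e2 _ e4 [e5 e6 e7]] := vanish (C 0%N) (C 1%N) 0 (C 2) (C 3) (C 4) (C 5).
    - by rewrite /comb7 scale0r addr0.
    - by right.
    by move=> l; rewrite cC; case: l => -[|[|[|[|[|[|//]]]]]] i6 /=.
  by case=> -[|[|[|[|[|[|//]]]]]] i6 /=; [exists u, u|exists u, v|exists v, v|exists u, 1|exists v, 1|exists 1, 1].
exists (fun i : 'I_6 => nth 0 [:: u * v; v * u; v * v; u * 1; v * 1; 1 * 1] i); split=> [c|].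
  pose C (l : nat) := c (inord l); have cC l : c l = C l by rewrite /C inord_val.
  under eq_bigr do rewrite cC.
  rewrite !big_ord_recr big_ord0 /= add0r !mulr1 => E.
  have [||_ e2 e3 e4 [e5 e6 e7]] := vanish 0 (C 0%N) (C 1%N) (C 2) (C 3) (C 4) (C 5).
  - by rewrite /comb7 scale0r add0r.
  - by left.
  by move=> l; rewrite cC; case: l => -[|[|[|[|[|[|//]]]]]] i6 /=.
by case=> -[|[|[|[|[|[|//]]]]]] i6 /=; [exists u, v|exists v, u|exists v, v|exists u, 1|exists v, 1|exists 1, 1].
Qed.

Variable U : R -> Prop.

Theorem filtered_regular_quadratic : filtered_AS_regular U 2 ->
  generates (one_plus U) /\ exists (u v : R) (x1 x2 x3 x4 l1 l2 l3 : k),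
    [/\ spans3 (one_plus U) u v, dim6 (one_plus U), comb7 u v x1 x2 x3 x4 l1 l2 l3 = 0 & x1 * x4 - x2 * x3 != 0].
Proof.
case=> [[subU finU] U1 exh [A [grade [sym [assoc [cg [[gl2 _] _] gk [eps [aug gor _]]]]]]]].
split; first exact: filt_generates.
have [N [b [ib Ub spb]]] := finite_basis finU.
have bf i := filt1u subU Ub i.
have xg i : grade 1%N (sym 1%N (b i)) := sym_grade assoc (bf i).
have ix := sym_independent subU U1 assoc ib Ub.
have gen := sym_gen subU assoc Ub spb.
have N2 := rank2 cg aug xg ix gen gl2 gor gk; subst N.
have [f [df gf cyc span]] := syzygy_generator cg aug xg ix gen gl2 gor.
have /boolp.choice[m mE] : forall i, exists c : 'I_2 -> k, f 0 i = \sum_j c j *: sym 1%N (b j).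
  by move=> i; apply: (grade1_coord cg gen).
have /boolp.choice[c cE] := span.
pose j0 : 'I_2 := ord0; pose j1 : 'I_2 := lift ord0 ord0.
have sum2 (V : nmodType) (F : 'I_2 -> V) : \sum_i F i = F j0 + F j1.
  by rewrite big_ord_recl big_ord1.
pose u := b j0; pose v := b j1; pose x := sym 1%N u; pose y := sym 1%N v.
have xy0 a1 a2 a1' a2' : a1 *: x + a2 *: y = a1' *: x + a2' *: y -> a1 = a1' /\ a2 = a2'.
  move=> E; have := ix (fun i => if i == j0 then a1 - a1' else a2 - a2') _.
  rewrite sum2 /= !scalerBl => h.
  have {}h : forall i : 'I_2, (if i == j0 then a1 - a1' else a2 - a2') = 0.
    by apply: h; rewrite addrACA -opprD E subrr.
  by have := h j0; have := h j1; rewrite /= => /subr0_eq -> /subr0_eq ->.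
have ai a a1 a2 : a%:A + (a1 *: u + a2 *: v) = 0 -> [/\ a = 0, a1 = 0 & a2 = 0].
  move=> E; have [|a0 h] := affine_indep subU U1 ib Ub (a := a) (c := fun i => if i == j0 then a1 else a2).
    by rewrite sum2.
  by split=> //; [have := h j0 | have := h j1].
have fE i : f 0 i = m i j0 *: x + m i j1 *: y by rewrite mE sum2.
(* The symbols of u and v lie in the span of the entries of f, so the coefficient matrix of f is
   invertible. *)
have D : m j0 j0 * m j1 j1 - m j1 j0 * m j0 j1 != 0.
  have eq_c j : b j = b j -> sym 1%N (b j) = (c j j0 * m j0 j0 + c j j1 * m j1 j0) *: x
      + (c j j0 * m j0 j1 + c j j1 * m j1 j1) *: y.
    by move=> _; rewrite cE sum2 !fE !scalerDr !scalerA !scalerDl addrACA.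
  have := eq_c j0 erefl; rewrite -/u -/x -[X in X = _](_ : 1 *: x + 0 *: y = x); last by rewrite scale1r scale0r addr0.
  move=> /xy0[E1 E2]; have := eq_c j1 erefl.
  rewrite -/v -/y -[X in X = _](_ : 0 *: x + 1 *: y = y); last by rewrite scale1r scale0r add0r.
  move=> /xy0[E3 E4]; apply/eqP => D0.
  have : (1 : k) = 0; last by move/eqP; rewrite oner_eq0.
  transitivity ((c j0 j0 * m j0 j0 + c j0 j1 * m j1 j0) * (c j1 j0 * m j0 j1 + c j1 j1 * m j1 j1)
     - (c j0 j0 * m j0 j1 + c j0 j1 * m j1 j1) * (c j1 j0 * m j0 j0 + c j1 j1 * m j1 j0)).
    by rewrite -E1 -E2 -E3 -E4 mulr1 mul0r subr0.
  by rewrite -(mulr0 (c j0 j0 * c j1 j1 - c j0 j1 * c j1 j0)) -D0; ring.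
have Vb i := one_plus_U (Ub i).
have [Vu Vv] : one_plus U u /\ one_plus U v by split; apply: Vb.
have f2 i j : filt U 2 (b i * b j) by apply: filtS; [apply: bf | apply: Vb].
have [[fuu fuv] [fvu fvv]] : (filt U 2 (u * u) /\ filt U 2 (u * v)) /\ (filt U 2 (v * u) /\ filt U 2 (v * v)).
  by split; split; apply: f2.
have sym2 a1 a2 a3 a4 : filt U 2 (a1 *: (u * u) + (a2 *: (u * v) + (a3 *: (v * u) + a4 *: (v * v)))) /\
   sym 2%N (a1 *: (u * u) + (a2 *: (u * v) + (a3 *: (v * u) + a4 *: (v * v)))) =
   (a1 *: x + a3 *: y) * x + (a2 *: x + a4 *: y) * y.
  have f4 : filt U 2 (a4 *: (v * v)) by rewrite -[_ *: _]addr0; apply: filtL => //; apply: filt_0.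
  have f3 : filt U 2 (a3 *: (v * u) + a4 *: (v * v)) by apply: filtL.
  have f2' : filt U 2 (a2 *: (u * v) + (a3 *: (v * u) + a4 *: (v * v))) by apply: filtL.
  split; first exact: filtL.
  rewrite !(symL assoc) // (symZ assoc) // !(symM assoc (m := 1%N) (n := 1%N)); try exact: bf.
  by rewrite !mulrDl -!scalerAl !addrA [LHS](+%R.[AC 4 (1*3*2*4)]).
(* The symbol of this quadratic expression is f_0 x + f_1 y = 0, so it lies in F_1, which supplies
   the linear and constant terms. As f multiplies from the left, uv has coefficient [m j1 j0] and vu
   has [m j0 j1]. *)
have [b0 [w [Uw E]]] : one_plus U (m j0 j0 *: (u * u) + (m j1 j0 *: (u * v) + (m j0 j1 *: (v * u) + m j1 j1 *: (v * v)))).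
  have [F2 S2] := sym2 (m j0 j0) (m j1 j0) (m j0 j1) (m j1 j1).
  apply/(filt1 subU); apply/(sym_eq0 assoc F2); rewrite S2 -!fE.
  by move: df; rewrite /syz_map sum2.
have [cw wE] := spb w Uw; rewrite sum2 in wE.
exists u, v, (m j0 j0), (m j1 j0), (m j0 j1), (m j1 j1), (- cw j0), (- cw j1), (- b0).
split.
- move=> z; split=> [[a [_ [/spb[cz ->] ->]]]|[c1 [c2 [c3 ->]]]].
    exists (cz j0), (cz j1), a; rewrite sum2 /lin3. exact: addrC.
  rewrite /lin3 -addrA; apply: (one_plusL subU _ Vu); apply: (one_plusL subU _ Vv); exact: (one_plus_scal subU).
- apply: (dim6_of_relation (Vb j0) (Vb j1) _ D).
    by rewrite -(scale1r 1); apply: one_plus_scal.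
  move=> c1 c2 c3 c4 c5 c6 c7 Ec.
  have [F2 S2] := sym2 c1 c2 c3 c4.
  have : one_plus U (c1 *: (u * u) + (c2 *: (u * v) + (c3 *: (v * u) + c4 *: (v * v)))).
    move/eqP: Ec; rewrite /comb7 -!addrA.
    have -> : c1 *: (u * u) + (c2 *: (u * v) + (c3 *: (v * u) + (c4 *: (v * v) + (c5 *: u + (c6 *: v + c7%:A))))) =
      (c1 *: (u * u) + (c2 *: (u * v) + (c3 *: (v * u) + c4 *: (v * v)))) + (c5 *: u + (c6 *: v + c7%:A)).
      by rewrite !addrA.
    rewrite addr_eq0 => /eqP ->; rewrite -scaleN1r -[_ *: _]addr0.
    have V0 : one_plus U 0 by rewrite -(scale0r 1); apply: (one_plus_scal subU).
    apply: (one_plusL subU) => //; apply: (one_plusL subU) => //; apply: (one_plusL subU) => //.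
    exact: (one_plus_scal subU).
  (* Conversely, a quadratic expression that falls into F_1 has a syzygy as symbol, a multiple a f;
     in degree one only the scalar eps(a) remains, the factor of proportionality. *)
  move=> /(filt1 subU)/(sym_eq0 assoc F2); rewrite S2 => dz.
  pose z : 'rV[A]_2 := \row_l (if l == j0 then c1 *: x + c3 *: y else c2 *: x + c4 *: y).
  have [a zE] : exists a, z = a *: f by apply: cyc; rewrite /syz_map sum2 !mxE /=.
  have gx a1 a2 : grade 1%N (a1 *: x + a2 *: y) by apply: (gradeL cg); [exact: (xg j0) | apply: (gradeZ cg); exact: (xg j1)].
  have zc l : z 0 l = (eps a * m l j0) *: x + (eps a * m l j1) *: y.
    have := congr1 (fun r : 'rV_2 => hcomp cg 1 (r 0 l)) zE.
    rewrite [in RHS]mxE (comp_mulr cg _ _ (gf l)) /= subnn (comp0E cg aug) mulr_algl fE scalerDr !scalerA => <-.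
    by rewrite (comp_hom cg 1%N (r := 1%N)) // mxE; case: eqP.
  have := zc j0; have := zc j1; rewrite !mxE /= => /xy0[E2 E4] /xy0[E1 E3].
  exists (eps a); split=> // a0; move: Ec.
  rewrite E1 E2 E3 E4 a0 !mul0r /comb7 !scale0r !add0r addrC => /ai[-> -> ->].
  by [].
- rewrite /comb7; have -> : m j0 j0 *: (u * u) + m j1 j0 *: (u * v) + m j0 j1 *: (v * u) + m j1 j1 *: (v * v) = b0%:A + (cw j0 *: u + cw j1 *: v).
    by rewrite -!addrA E wE.
  by rewrite !scaleNr !addrA [LHS](+%R.[AC 6 ((1*6)*(2*4)*(3*5))]) !subrr !addr0.
exact: D.
Qed.
End QuadraticFiltered.

(** * The Weyl algebra *)

Section FreeAction.
Variables (k : fieldType) (I : choiceType) (V : lmodType k) (op : I -> V -> V).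
Hypothesis op_lin : forall i, lin (op i).
Implicit Types f g : free_alg k I.

(** The representation of the free algebra given by one operator per variable. Evaluation in R is
    the case of left multiplications applied to 1, and an ideal element acts by zero wherever the
    relator does. *)
Definition free_act f (z : V) : V := word_map (fun w : {fmonom I} => foldr op z (fmonom_val w)) f.

Lemma word_act_lin (w : seq I) : lin (fun z => foldr op z w).
Proof. by elim: w => //= i w IH a x y; rewrite IH op_lin. Qed.

Lemma free_act_linl z : lin (fun f => free_act f z).
Proof. exact: word_map_lin. Qed.

Lemma free_actD f g z : free_act (f + g) z = free_act f z + free_act g z.
Proof. exact: (linD (free_act_linl z)). Qed.
Lemma free_actN f z : free_act (- f) z = - free_act f z.
Proof. by rewrite -[- f]scaleN1r -[RHS]scaleN1r; exact: (linZ (free_act_linl z)). Qed.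
Lemma free_actZ a f z : free_act (a *: f) z = a *: free_act f z.
Proof. exact: (linZ (free_act_linl z)). Qed.

Lemma free_act0 f : free_act f 0 = 0.
Proof.
rewrite /free_act /word_map /malg_map big1 // => w _.
by rewrite (lin0 (word_act_lin _)) scaler0.
Qed.

Lemma free_actM f g z : free_act (f * g) z = free_act f (free_act g z).
Proof.
rewrite [f * g]malgME (linS (free_act_linl z)); apply: eq_bigr => w1 _.
rewrite (linS (free_act_linl z)) (linS (word_act_lin _)) scaler_sumr; apply: eq_bigr => w2 _.
rewrite /free_act word_mapU (linZ (word_act_lin _)) scalerA; congr (_ *: _).
by rewrite fmM foldr_cat.
Qed.

Lemma free_act_var i z : free_act (fvar k i) z = op i z.
Proof. by rewrite /free_act word_mapU scale1r fmU. Qed.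

Lemma free_act1 z : free_act 1 z = z.
Proof. by rewrite /free_act word_mapU scale1r fm1. Qed.

Lemma free_act_ideal r f z : (forall z, free_act r z = 0) -> ideal_gen r f -> free_act f z = 0.
Proof.
move=> r0 [N [c [x [hx ->]]]]; rewrite (linS (free_act_linl z)) big1 // => i _.
have [a [b ->]] := hx i; by rewrite (linZ (free_act_linl z)) !free_actM r0 free_act0 scaler0.
Qed.
End FreeAction.

Lemma free_act_weyl (k : fieldType) (I : choiceType) (V : lmodType k) (op : I -> V -> V)
    (f g : free_alg k I) z : (forall i, lin (op i)) ->
  free_act op (g * f - f * g - 1) z =
  free_act op g (free_act op f z) - free_act op f (free_act op g z) - z.
Proof.
move=> op_lin; rewrite -(free_actM op_lin g f) -(free_actM op_lin f g) -[X in _ = _ - _ - X](free_act1 op z).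
move: (g * f) (f * g) (1 : free_alg k I) => p q r.
by rewrite (free_actD _ (p - q) (- r)) (free_actD _ p (- q)) (free_actN _ q) (free_actN _ r).
Qed.

Lemma free_act_comb (k : fieldType) (I : choiceType) (V : lmodType k) (op : I -> V -> V)
    (f g : free_alg k I) z c1 c2 c3 c4 c5 c6 : (forall i, lin (op i)) ->
  free_act op (c1 *: (f * f) + c2 *: (f * g) + c3 *: (g * g) + c4 *: f + c5 *: g + c6 *: 1) z =
  c1 *: free_act op f (free_act op f z) + c2 *: free_act op f (free_act op g z)
  + c3 *: free_act op g (free_act op g z) + c4 *: free_act op f z + c5 *: free_act op g z + c6 *: z.
Proof.
move=> op_lin; rewrite -(free_actM op_lin f f) -(free_actM op_lin f g) -(free_actM op_lin g g).
rewrite -[X in _ + c6 *: X](free_act1 op z).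
move: (f * f) (f * g) (g * g) (1 : free_alg k I) => p1 p2 p3 p4.
rewrite -!free_actZ; move: (c1 *: _) (c2 *: _) (c3 *: _) (c4 *: _) (c5 *: _) (c6 *: _) => x1 x2 x3 x4 x5 x6.
by rewrite -!free_actD.
Qed.

Lemma free_eval_act (k : fieldType) (I : choiceType) (R : algType k) (x : I -> R) (f : free_alg k I) :
  free_eval x f = free_act (fun i z => x i * z) f 1.
Proof.
apply: eq_bigr => w _; congr (_ *: _); elim: (fmonom_val w) => [|i s IH] /=; first by rewrite big_nil.
by rewrite big_cons IH.
Qed.

Section Weyl.
Variables (k : closedFieldType) (char0 : [pchar k] =i pred0) (W : algType k) (u v : W).
Hypothesis weyl : is_weyl u v.
Let gens (i : bool) : W := if i then v else u.
Let fU := fvar k false.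
Let fV := fvar k true.

Let left_lin (i : bool) : lin (fun z => gens i * z).
Proof. by apply: lin_mull; apply: lin_idf. Qed.

Lemma weyl_rel : v * u = u * v + 1.
Proof.
have [_ /(_ (fV * fU - fU * fV - 1))[_ h]] := weyl.
have : free_eval gens (fV * fU - fU * fV - 1) = 0.
  by apply: h; apply: lspan_incl; exists 1, 1; rewrite mul1r mulr1.
rewrite free_eval_act (free_act_weyl fU fV _ left_lin) !free_act_var !mulr1 /=.
by rewrite -addrA => /eqP; rewrite addr_eq0 -opprD opprK => /eqP.
Qed.

Lemma weyl_generates : generates (fun x => x = u \/ x = v).
Proof.
move=> P P1 PL PM x; have P0 : P 0 by rewrite -(addNr (1 : W)) -scaleN1r; apply: PL.
have [/(_ x)[f <-] _] := weyl; rewrite /free_eval.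
apply: (big_ind P) => // [y z Py Pz|w _]; first by rewrite -[y]scale1r; apply: PL.
rewrite -[_ *: _]addr0; apply: PL => //; elim/last_ind: (fmonom_val w) => [|s i IH]; first by rewrite big_nil.
by rewrite -cats1 big_cat big_seq1 /=; apply: PM => //; case: i; [right | left].
Qed.

(* W acts on k[X], u by multiplication by X and v by d/dX. *)
Let poly_op (i : bool) (p : {poly k}) : {poly k} := if i then p^`() else 'X * p.
Let poly_op_lin i : lin (poly_op i).
Proof. by case: i => a x y /=; [rewrite derivD derivZ | rewrite mulrDr scalerAr]. Qed.

(** An expression that vanishes in W lies in the ideal, hence acts by zero on k[X]; its images of 1,
    X and X^2 exhibit the six coefficients, c3 with a factor 2. *)
Lemma weyl_independent c1 c2 c3 c4 c5 c6 : comb u v c1 c2 c3 c4 c5 c6 = 0 ->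
  [/\ c1 = 0, c2 = 0, c3 = 0, c4 = 0 & c5 = 0 /\ c6 = 0].
Proof.
move=> E; pose f : free_alg k bool := c1 *: (fU * fU) + c2 *: (fU * fV) + c3 *: (fV * fV) + c4 *: fU + c5 *: fV + c6 *: 1.
have fE : free_eval gens f = 0.
  by rewrite free_eval_act (free_act_comb fU fV _ _ _ _ _ _ _ left_lin) !free_act_var !mulr1.
have [_ /(_ f)[/(_ fE) fI _]] := weyl.
have T p : c1 *: ('X * ('X * p)) + c2 *: ('X * p^`()) + c3 *: p^`()^`() + c4 *: ('X * p) + c5 *: p^`() + c6 *: p = 0.
  have r0 z : free_act poly_op (fV * fU - fU * fV - 1) z = 0.
    by rewrite (free_act_weyl fU fV _ poly_op_lin) !free_act_var /= derivM derivX mul1r addrK subrr.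
  by have := free_act_ideal poly_op_lin p r0 fI; rewrite (free_act_comb fU fV _ _ _ _ _ _ _ poly_op_lin) !free_act_var.
have q (p : {poly k}) i := congr1 (fun r : {poly k} => r`_i) (T p).
have cf := (coefD, coefZ, coefXM, coef_deriv, coef1, coefX, coef0).
have e1 : c1 = 0 by have := q 1 2; rewrite /= !cf /= ?(mul0rn, mulr0, mulr1, addr0, add0r).
have e4 : c4 = 0 by have := q 1 1%N; rewrite /= !cf /= ?(mul0rn, mulr0, mulr1, addr0, add0r).
have e6 : c6 = 0 by have := q 1 0%N; rewrite /= !cf /= ?(mul0rn, mulr0, mulr1, addr0, add0r).
have e2 : c2 = 0.
  by have := q 'X 1%N; rewrite /= !cf /= e4 e6 ?(mul0rn, mul0r, mulr0, mulr1, addr0, add0r, mulr1n).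
have e5 : c5 = 0.
  by have := q 'X 0%N; rewrite /= !cf /= e6 ?(mul0rn, mul0r, mulr0, mulr1, addr0, add0r, mulr1n).
have e3 : c3 = 0.
  have := q ('X * 'X) 0%N; rewrite /= !cf /= ?(mul0rn, mul0r, mulr0, mulr1, addr0, add0r, mulr1n) => /eqP.
  by rewrite mulf_eq0 (negPf (natr_neq0 char0 _)) // orbF => /eqP.
by [].
Qed.
End Weyl.

Theorem theorem0p1 (k : closedFieldType) (char0 : [pchar k] =i pred0) :
  (forall (R : algType k) (U : R -> Prop) (H : falgType k)
      (S : hopf_structure H) (act : H -> R -> R),
    filtered_AS_regular U 2 -> ~ PI R ->
    module_algebra S act -> inner_faithful S act -> preserves_filtration act U ->
    is_group_algebra S)
  /\
  (forall (W : algType k) (u v : W) (H : falgType k)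
      (S : hopf_structure H) (act : H -> W -> W),
    is_weyl u v ->
    module_algebra S act -> inner_faithful S act ->
    preserves_filtration act (lspan_seq [:: u; v]) ->
    is_group_algebra S).
Proof.
split=> [R U H S act reg nPI MA IF pres|W u v H S act weyl MA IF pres].
  have [gen [u [v [x1 [x2 [x3 [x4 [l1 [l2 [l3 [sp d6 rel D]]]]]]]]]]] := filtered_regular_quadratic reg.
  exact: (quadratic_action char0 MA IF pres gen nPI sp d6 rel D).
(* The Weyl relation is already the fourth normal form, so the argument enters at this point, with
   independence and generation taken from the presentation. *)
apply: (@normal_form_group_algebra k char0 H S W act u v 1 0 0 0 1) => //.
- by rewrite (weyl_rel weyl) !scale0r !scale1r !addr0.
- exact: weyl_independent.
- exact: weyl_generates.
- move=> h x hx; have /(pres h)[a [_ [/lspan_seq_coord[c ->] ->]]] : one_plus (lspan_seq [:: u; v]) x.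
    exists 0, x; split; last by rewrite scale0r add0r.
    by apply: lspan_incl; case: hx => ->; rewrite !inE eqxx ?orbT.
  exists (c ord0), (c (lift ord0 ord0)), a.
  by rewrite big_ord_recl big_ord1 /= addrC.
- exact: oner_neq0.
by constructor 4.
Qed.
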